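(* Let $\Sigma=\mathbb{D}/\Gamma$ be a compact Riemann surface of genus $\ge 2$ and $\Omega=(\mathbb{D}\times\mathbb{D})/\Gamma$ (diagonal action). Then the weighted Bergman space $A^2_\alpha(\Omega)$ is infinite dimensional for every $\alpha>-1$.
   Context: $\mathbb{D}\subset\mathbb{C}$ is the unit disk, $\Gamma<\mathrm{Aut}(\mathbb{D})=PSU(1,1)$ is a Fuchsian group such that $\mathbb{D}\to\Sigma=\mathbb{D}/\Gamma$ is the universal covering of a compact Riemann surface of genus $\ge 2$. $\Gamma$ acts on $\mathbb{D}\times\mathbb{D}$ by $\gamma\cdot(z,w)=(\gamma z,\gamma w)$. Let $\delta=\frac{(1-|z|^2)(1-|w|^2)}{|1-\bar z w|^2}$ and $dV=\frac{4}{|1-\bar z w|^4}\,\frac i2dz\wedge d\bar z\wedge\frac i2dw\wedge d\bar w$, both $\Gamma$-invariant and hence defined on $\Omega$. For $\alpha>-1$, $\|f\|_\alpha^2=\frac{1}{\Gamma(\alpha+1)}\int_\Omega|f|^2\delta^\alpha dV$ (here $\Gamma(\cdot)$ is the gamma function), and $A^2_\alpha(\Omega)=\{f\in\mathcal{O}(\Omega):\|f\|_\alpha<\infty\}$, where $\mathcal{O}(\Omega)$ is the space of holomorphic functions on $\Omega$. *)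

(* Defs.v *)
From HB Require Import structures.
From mathcomp Require Import all_boot all_order all_algebra.
From mathcomp Require Import complex.
From mathcomp Require Import all_classical all_reals all_analysis.
Set Implicit Arguments.
Unset Strict Implicit.
Unset Printing Implicit Defensive.
Import Order.TTheory GRing.Theory Num.Theory.
Import numFieldNormedType.Exports.
Import ComplexField.Normc.
Local Open Scope classical_set_scope.
Local Open Scope quotient_scope.
Local Open Scope ring_scope.

(* Typing R[i] as a numClosedFieldType is what gives it MathComp-Analysis's
   topology and its structure of normed module over itself. *)
Definition C (R : realType) : numClosedFieldType := R[i].

Definition unit_disk (R : realType) : set (C R) := [set z | `|z| < 1].

(* The open disk as a type, with the topology induced from C. *)
Definition disk (R : realType) : topologicalType := set_type (@unit_disk R).

(** ** Subgroups of Aut(D) = PSU(1,1) *)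

(* A point of PSU(1,1) is represented by the self-map of the disk it induces;
   the matrix [a b; b^* a^*] of SU(1,1) is determined by it up to sign. *)
Definition su11 (R : realType) (a b : C R) : Prop :=
  `|a| ^+ 2 - `|b| ^+ 2 = 1.

Definition moebius_of (R : realType) (a b : C R) (g : disk R -> disk R) : Prop :=
  forall z, \val (g z) = (a * \val z + b) / (b^* * \val z + a^*).

Definition PSU11 (R : realType) : set (disk R -> disk R) :=
  [set g | exists a b, su11 a b /\ moebius_of a b g].

Record aut_subgroup (R : realType) := AutSubgroup {
  aut_set : set (disk R -> disk R);
  aut_setP : aut_set `<=` @PSU11 R;
  aut_set_id : aut_set id;
  aut_set_comp : forall g h, aut_set g -> aut_set h -> aut_set (g \o h);
  aut_set_inv : forall g, aut_set g ->
    exists2 h, aut_set h & cancel g h /\ cancel h g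
}.

(* Discreteness in PSU(1,1): the identity is isolated, a neighbourhood basis of
   it being given by the matrices of SU(1,1) close to the identity matrix. *)
Definition fuchsian (R : realType) (G : aut_subgroup R) : Prop :=
  exists2 e : R, 0 < e &
    forall (a b : C R) g, su11 a b -> moebius_of a b g -> aut_set G g ->
      normc (a - 1) < e -> normc b < e -> g = id.

(** ** The quotients Sigma = D / G and Omega = (D x D) / G *)

Section Quotients.
Variables (R : realType) (G : aut_subgroup R).

Definition orbit_rel : rel (disk R) :=
  fun x y => `[< exists2 g, aut_set G g & y = g x >].

Definition diag_orbit_rel : rel (disk R * disk R) :=
  fun p q => `[< exists2 g, aut_set G g & q = (g p.1, g p.2) >].

Lemma orbit_rel_refl : reflexive orbit_rel.
Proof. by move=> x; apply/asboolP; exists id => //; exact: aut_set_id. Qed.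

Lemma orbit_rel_sym : symmetric orbit_rel.
Proof.
suff H x y : orbit_rel x y -> orbit_rel y x by move=> x y; apply/idP/idP => /H.
move=> /asboolP [g Gg ->]; have [h Gh [gK _]] := aut_set_inv Gg.
by apply/asboolP; exists h => //; rewrite gK.
Qed.

Lemma orbit_rel_trans : transitive orbit_rel.
Proof.
move=> y x z /asboolP [g Gg ->] /asboolP [h Gh ->].
by apply/asboolP; exists (h \o g) => //; exact: aut_set_comp.
Qed.

Lemma diag_orbit_rel_refl : reflexive diag_orbit_rel.
Proof.
by move=> [x y]; apply/asboolP; exists id => //; exact: aut_set_id.
Qed.

Lemma diag_orbit_rel_sym : symmetric diag_orbit_rel.
Proof.
suff H p q : diag_orbit_rel p q -> diag_orbit_rel q p.
  by move=> p q; apply/idP/idP => /H.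
case: p => x y /asboolP [g Gg ->]; have [h Gh [gK _]] := aut_set_inv Gg.
by apply/asboolP; exists h => //=; rewrite !gK.
Qed.

Lemma diag_orbit_rel_trans : transitive diag_orbit_rel.
Proof.
move=> q p r /asboolP [g Gg ->] /asboolP [h Gh ->].
by apply/asboolP; exists (h \o g) => //; exact: aut_set_comp.
Qed.

Definition orbit_equiv :=
  EquivRel orbit_rel orbit_rel_refl orbit_rel_sym orbit_rel_trans.

Definition diag_orbit_equiv :=
  EquivRel diag_orbit_rel
    diag_orbit_rel_refl diag_orbit_rel_sym diag_orbit_rel_trans.

Definition Sigma : topologicalType :=
  quotient_topology {eq_quot orbit_equiv}.

Definition Sigma_proj (x : disk R) : Sigma := \pi_({eq_quot orbit_equiv}) x.

Definition Omega : Type := {eq_quot diag_orbit_equiv}.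

Definition Omega_proj (p : disk R * disk R) : Omega :=
  \pi_({eq_quot diag_orbit_equiv}) p.

End Quotients.

Definition covering_map (X Y : topologicalType) (p : X -> Y) : Prop :=
  continuous p /\
  forall y, exists V : set Y, [/\ open V, V y &
    exists (I : Type) (U : I -> set X),
      [/\ forall i, open (U i), trivIset [set: I] U,
          p @^-1` V = \bigcup_i U i &
          forall i, [/\ set_bij (U i) V p &
            forall W, open W -> W `<=` U i -> open (p @` W)]]].

(* Topological genus, by dim H^1(Sigma; RR) = 2 g. As the disk is the universal
   covering of Sigma, H^1(Sigma; RR) is the space Hom(G, RR) of additive
   characters of the deck group; functions are only compared on G. *)
Definition real_character (R : realType) (G : aut_subgroup R)
    (chi : (disk R -> disk R) -> R) : Prop :=
  forall g h, aut_set G g -> aut_set G h -> chi (g \o h) = chi g + chi h.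

Definition Sigma_genus (R : realType) (G : aut_subgroup R) (g : nat) : Prop :=
  exists e : 'I_(2 * g) -> (disk R -> disk R) -> R,
    [/\ forall i, real_character G (e i),
        forall c : 'I_(2 * g) -> R,
          (forall s, aut_set G s -> \sum_i c i * e i s = 0) ->
          forall i, c i = 0 &
        forall chi, real_character G chi ->
          exists c : 'I_(2 * g) -> R,
            forall s, aut_set G s -> chi s = \sum_i c i * e i s].

(** ** Holomorphic functions on Omega *)

(* Composition with the projection D x D -> Omega, extended by 0 to C x C. *)
Definition pullback (R : realType) (G : aut_subgroup R) (f : Omega G -> C R)
    (p : C R * C R) : C R :=
  if (insub p.1 : option (disk R), insub p.2 : option (disk R))
    is (Some z, Some w) then f (Omega_proj G (z, w)) else 0.

(* The complex structure of Omega is the one making D x D -> Omega a local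
   biholomorphism; [differentiable] is Frechet differentiability over C R. *)
Definition holomorphic (R : realType) (G : aut_subgroup R)
    (f : Omega G -> C R) : Prop :=
  forall p : C R * C R, unit_disk p.1 -> unit_disk p.2 ->
    differentiable (pullback f) p.

(** ** Weighted Bergman spaces *)

Definition delta (R : realType) (p : C R * C R) : R :=
  (1 - normc p.1 ^+ 2) * (1 - normc p.2 ^+ 2) / normc (1 - p.1^* * p.2) ^+ 2.

(* Density of dV with respect to Lebesgue measure: (i/2) dz /\ dz^* is the
   Lebesgue measure of the plane. *)
Definition dV_density (R : realType) (p : C R * C R) : R :=
  4 / normc (1 - p.1^* * p.2) ^+ 4.

Definition real_coords (R : realType) (p : disk R * disk R) :
    (R * R) * (R * R) :=
  ((complex.Re (\val p.1), complex.Im (\val p.1)),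
   (complex.Re (\val p.2), complex.Im (\val p.2))).

Definition of_real_coords (R : realType) (q : (R * R) * (R * R)) : C R * C R :=
  (q.1.1 +i* q.1.2, q.2.1 +i* q.2.2)%C.

Definition lebesgue4 (R : realType) :=
  ((@lebesgue_measure R \x @lebesgue_measure R) \x
   (@lebesgue_measure R \x @lebesgue_measure R))%E.

(* Borel subsets of D x D embedded in Omega by the projection. *)
Definition embedded_borel (R : realType) (G : aut_subgroup R)
    (E : set (disk R * disk R)) : Prop :=
  measurable (@real_coords R @` E) /\ set_inj E (Omega_proj G).

(* \int_Omega F dV for F >= 0 on C x C that is G-invariant on D x D. The supremum
   is the integral for the measure on Omega locally given by dV; it is attained
   at every Borel fundamental domain of G in D x D. *)
Definition integral_Omega (R : realType) (G : aut_subgroup R)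
    (F : C R * C R -> R) : \bar R :=
  ereal_sup [set (\int[@lebesgue4 R]_(q in @real_coords R @` E)
                    (F (of_real_coords q) * dV_density (of_real_coords q))%:E)%E
            | E in embedded_borel G].

Definition gamma_fun (R : realType) (s : R) : R :=
  \int[@lebesgue_measure R]_(t in `]0, +oo[) (t `^ (s - 1) * expR (- t)).

Definition bergman_norm2 (R : realType) (G : aut_subgroup R) (alpha : R)
    (f : Omega G -> C R) : \bar R :=
  ((gamma_fun (alpha + 1))^-1%:E *
   integral_Omega G
     (fun p => (normc (pullback f p) ^+ 2 * delta p `^ alpha)%R))%E.

Definition bergman_space (R : realType) (G : aut_subgroup R) (alpha : R) :
    set (Omega G -> C R) :=
  [set f | holomorphic f /\ (bergman_norm2 alpha f < +oo)%E].

Definition infinite_dimensional (K : fieldType) (V : lmodType K) (S : set V) :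
    Prop :=
  ~ exists (n : nat) (v : 'I_n -> V), (forall i, S (v i)) /\
      forall x, S x -> exists c : 'I_n -> K, x = \sum_i c i *: v i.

(* Main.v *)
Require Import Defs.
From HB Require Import structures.
From mathcomp Require Import all_boot all_order all_algebra.
From mathcomp Require Import complex.
From mathcomp Require Import all_classical all_reals all_analysis.
From mathcomp Require Import measurable_realfun.
From mathcomp Require Import ring lra.
Import Order.TTheory GRing.Theory Num.Theory.
Import numFieldNormedType.Exports.
Import ComplexField.Normc.
Local Open Scope classical_set_scope.
Local Open Scope ring_scope.
Set Implicit Arguments.
Unset Strict Implicit.
Unset Printing Implicit Defensive.

#[local] Arguments normc : simpl never.

(** The functions that make the space infinite dimensional are the powers of one
    Poincare-type series. For N >= 2 put
      F(z, w) = \sum_(gamma in G) (gamma w - gamma z) ^ N.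
    Right multiplication permutes G, so F is invariant under the diagonal action; it is
    holomorphic, and it vanishes on the diagonal. With [a b; b^* a^*] a matrix of gamma,
      gamma w - gamma z = (w - z) / ((b^* z + a^* ) (b^* w + a^* )),
    which is of size |a|^-2 for fixed z and w, and \sum |a|^-4 is finite because the
    translates of a small disk are disjoint inside the unit disk (packing).

    The main point is that F grows more slowly than every power of 1/delta. The sum
    S(z, w) = \sum |gamma w - gamma z| ^ N is invariant and is the N-th power of a
    pseudo-distance. By compactness of the quotient it is bounded wherever delta is
    bounded below (gap_sum_delta). Move z to a compact part of the disk, hence to the
    origin, and walk from 0 to w in steps that halve 1 - |w|. As
    (x + y) ^ N <= q x ^ N + C_q y ^ N with q as close to 1 as desired (exprD_le), each step
    multiplies the bound by q only, and about log2 (1 / (1 - |w|)) steps are needed. This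
    gives |F| <= K delta ^ (- eps) for every eps > 0 (poincare_bound).

    Let alpha > -1 and choose b with -1 < b < min (alpha, 0). For every k >= 1 the previous
    bound gives |F ^ k| ^ 2 delta ^ alpha <= c delta ^ b, and delta ^ b has a finite integral
    over Omega (finite_volume): a Borel set embedded in Omega is cut into pieces that group
    elements move to {|z| < r} x D, where r < 1 exists by compactness; the translates of the
    set are disjoint, and on {|z| < r} x D the integrand is at most a multiple of
    (1 - |w|^2) ^ b.
    The change of variables used here rests on the fact that a Moebius map is an affine map,
    an inversion and an affine map again. The inversion is handled through the invariance of
    Haar measure of C^* under z |-> 1/z, a consequence of commutativity (haar_inv). Hence all
    powers F, F ^ 2, ... lie in the Bergman space (bergman_descend).

    For N large, F is not identically 0: at (0, t) the identity contributes t ^ N, and the other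
    terms are geometrically smaller (nonvanishing). By the intermediate value theorem |F|
    then takes a continuum of values, so no nonzero polynomial annihilates it and its powers
    are linearly independent (powers_independent).

    The hypotheses on the group enter through the following facts. The covering property
    makes the action free with disjoint translates of a small disk, so that the group is
    countable; the compactness of the quotient makes it infinite. The group is then
    enumerated without repetition as gam 0, gam 1, ... with matrices given by A n and B n, and
    sums over G become series. *)

(** * Affine changes of variable on the line *)

Section affine_line.
Variable R : realType.
Local Notation leb := (@lebesgue_measure R).
Local Notation RR := (measurableTypeR R).

Lemma measurable_affine (a b : R) : measurable_fun [set: RR] (fun x : RR => a * x + b : RR).
Proof. by apply: measurable_funD => //; apply: measurable_funM. Qed.

(** The image of Lebesgue measure under an affine map, rescaled, has the right value on
    half-open intervals, which generate the Borel sets and determine the measure. *)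
Lemma lebesgue_affine (a b : R) (A : set RR) : a != 0 -> measurable A ->
  leb A = (`|a|%:E * leb ((fun x : RR => (a * x + b)%R) @^-1` A))%E.
Proof.
move=> a0 mA.
have mphi := measurable_affine a b.
pose phi : {mfun RR >-> RR} := HB.pack (fun x : RR =>
  a * x + b : RR) (isMeasurableFun.Build _ _ _ _ _ mphi).
have an : 0 <= `|a| by [].
rewrite (@lebesgue_measure_unique _ (mscale (NngNum an) (pushforward leb phi)) _ A mA)//.
move=> X [[s t] _ <-].
rewrite -[RHS]/(`|a|%:E * leb ((fun x : RR => (a * x + b)%R) @^-1` `]s, t]))%E.
have [a_gt|a_lt] : a > 0 \/ a < 0 by move: a0; rewrite neq_lt orbC => /orP.
  have -> : (fun x : RR => a * x + b) @^-1` `]s, t] = `](s - b) / a, (t - b) / a]%classic.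
    by apply/seteqP; split => x /=; rewrite !in_itv /= ltr_pdivrMr// ler_pdivlMr// ltrBlDr lerBrDr
      mulrC.
  rewrite !lebesgue_measure_itv/= !lte_fin ltr_pM2r ?invr_gt0// ltrBlDr subrK gtr0_norm//.
  case: ifPn => _; last by rewrite mule0.
  by rewrite -!EFinB -EFinM; congr EFin; field.
have -> : (fun x : RR => a * x + b) @^-1` `]s, t] = `[(t - b) / a, (s - b) / a[%classic.
  by apply/seteqP; split => x /=; rewrite !in_itv /= ltr_ndivlMr// ler_ndivrMr// ltrBlDr lerBrDr
    mulrC andbC.
rewrite !lebesgue_measure_itv/= !lte_fin ltr_nM2r ?invr_lt0// ltrBlDr subrK ltr0_norm//.
case: ifPn => _; last by rewrite mule0.
by rewrite -!EFinB -EFinM; congr EFin; field.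
Qed.

Lemma integral_affine (a b : R) (h : RR -> \bar R) : a != 0 ->
  measurable_fun setT h -> (forall x, (0 <= h x)%E) ->
  (\int[leb]_x h x = `|a|%:E * \int[leb]_x h (a * x + b)%R)%E.
Proof.
move=> a0 mh h0.
have mphi := measurable_affine a b.
pose phi : {mfun RR >-> RR} := HB.pack (fun x : RR =>
  a * x + b : RR) (isMeasurableFun.Build _ _ _ _ _ mphi).
have an : 0 <= `|a| by [].
rewrite (@eq_measure_integral _ _ _ _ (mscale (NngNum an) (pushforward leb phi))).
  by rewrite ge0_integral_mscale//= ge0_integral_pushforward.
by move=> A mA _; exact: lebesgue_affine.
Qed.
End affine_line.

(** * Lebesgue measure of the plane and its shears *)

Section plane.
Variable R : realType.
Local Notation leb := (@lebesgue_measure R).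
Local Notation RR := (measurableTypeR R).

Definition plane_measure := (leb \x leb)%E.
HB.instance Definition _ := Measure.copy plane_measure (leb \x leb)%E.

Lemma plane_measure_sigma_finite : sigma_finite setT plane_measure.
Proof.
exists (fun n => `[- n%:R, n%:R]%classic `*` `[- n%:R, n%:R]%classic).
  apply/esym; rewrite -subTset => -[x y] _.
  exists (Num.bound (`|x| + `|y|)) => //.
  have B : `|x| + `|y| <= (Num.bound (`|x| + `|y|))%:R.
    by rewrite ltW// archi_boundP// addr_ge0.
  by split; rewrite /= in_itv/= -ler_norml (le_trans _ B)// ?lerDl ?lerDr.
move=> n; split; first by apply: measurableX; exact: measurable_itv.
rewrite [ltLHS](_ : _ = leb `[(- n%:R)%R, n%:R%R]%classic * leb `[(- n%:R)%R, n%:R%R]%classic)%E;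
  last first.
  by apply: product_measure1E; exact: measurable_itv.
by rewrite !lebesgue_measure_itv; case: ifPn => _; rewrite ?mul0e// -?EFinB -?EFinM ltry.
Qed.

HB.instance Definition _ := Measure_isSigmaFinite.Build _ _ _ plane_measure
  plane_measure_sigma_finite.
Local Notation leb2 := plane_measure.

Lemma plane_tonelli1 (f : RR * RR -> \bar R) : measurable_fun setT f -> (forall p, (0 <= f p)%E) ->
  (\int[leb2]_p f p = \int[leb]_x \int[leb]_y f (x, y))%E.
Proof. by move=> mf f0; exact: (@fubini_tonelli1 _ _ _ _ _ leb leb f mf f0). Qed.

Lemma plane_tonelli2 (f : RR * RR -> \bar R) : measurable_fun setT f -> (forall p, (0 <= f p)%E) ->
  (\int[leb2]_p f p = \int[leb]_y \int[leb]_x f (x, y))%E.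
Proof. by move=> mf f0; exact: (@fubini_tonelli2 _ _ _ _ _ leb leb f mf f0). Qed.

Definition toC (p : R * R) : C R := (p.1 +i* p.2)%C.

(** Tonelli reduces a shear to an affine map of one variable; composites of shears give the
    affine maps of the plane without a general Jacobian formula. *)
Lemma integral_shear2 (k : R) (g : RR -> RR) (h : RR * RR -> \bar R) : k != 0 ->
  measurable_fun setT g -> measurable_fun setT h -> (forall p, (0 <= h p)%E) ->
  (\int[leb2]_p h p = `|k|%:E * \int[leb2]_p h (p.1, (k * p.2 + g p.1)%R))%E.
Proof.
move=> k0 mg mh h0.
have mh2 : measurable_fun setT (fun p : RR * RR => h (p.1, k * p.2 + g p.1)).
  apply: (measurableT_comp mh); apply: measurable_fun_pair => //.
  apply: measurable_funD; last exact: measurableT_comp.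
  exact: measurable_funM.
rewrite (plane_tonelli1 mh)// (plane_tonelli1 mh2)//= -ge0_integralZl//=; last 2 first.
- exact: (measurable_fun_fubini_tonelli_F _ mh2).
- by move=> x _; exact: integral_ge0.
apply: eq_integral => x _; rewrite /fubini_F/= (integral_affine (g x) k0)//.
exact: measurable_fun_pair2.
Qed.

Lemma integral_shear1 (k : R) (g : RR -> RR) (h : RR * RR -> \bar R) : k != 0 ->
  measurable_fun setT g -> measurable_fun setT h -> (forall p, (0 <= h p)%E) ->
  (\int[leb2]_p h p = `|k|%:E * \int[leb2]_p h ((k * p.1 + g p.2)%R, p.2))%E.
Proof.
move=> k0 mg mh h0.
have mh2 : measurable_fun setT (fun p : RR * RR => h (k * p.1 + g p.2, p.2)).
  apply: (measurableT_comp mh); apply: measurable_fun_pair => //.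
  apply: measurable_funD; last exact: measurableT_comp.
  exact: measurable_funM.
rewrite (plane_tonelli2 mh)// (plane_tonelli2 mh2)//= -ge0_integralZl//=; last 2 first.
- exact: (measurable_fun_fubini_tonelli_G _ mh2).
- by move=> x _; exact: integral_ge0.
apply: eq_integral => x _; rewrite /fubini_G/= (integral_affine (g x) k0 (h := fun y =>
  h (y, x)))//.
exact: measurable_fun_pair1.
Qed.

(** * Measurability of complex-valued functions *)

Definition cmeasurable d (T : measurableType d) (f : T -> C R) : Prop :=
  measurable_fun [set: T] (fun t => complex.Re (f t) : RR) /\
  measurable_fun [set: T] (fun t => complex.Im (f t) : RR).

Definition measurable_on_C (h : C R -> \bar R) := measurable_fun [set: RR * RR] (h \o toC).

Lemma Re_add (x y : C R) : complex.Re (x + y) = complex.Re x + complex.Re y.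
Proof. by case: x y => [? ?] [? ?]. Qed.
Lemma Im_add (x y : C R) : complex.Im (x + y) = complex.Im x + complex.Im y.
Proof. by case: x y => [? ?] [? ?]. Qed.
Lemma Re_mul (x y : C R) : complex.Re (x * y) =
    complex.Re x * complex.Re y - complex.Im x * complex.Im y.
Proof. by case: x y => [? ?] [? ?]. Qed.
Lemma Im_mul (x y : C R) : complex.Im (x * y) =
    complex.Re x * complex.Im y + complex.Im x * complex.Re y.
Proof. by case: x y => [? ?] [? ?]. Qed.
Lemma Re_inv (x : C R) : complex.Re (x^-1) = complex.Re x / (complex.Re x ^+ 2 + complex.Im x ^+ 2).
Proof. by case: x => [? ?]. Qed.
Lemma Im_inv (x : C R) : complex.Im (x^-1) =
    - (complex.Im x) / (complex.Re x ^+ 2 + complex.Im x ^+ 2).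
Proof. by case: x => [? ?] /=; rewrite mulNr. Qed.
Lemma Re_conj (x : C R) : complex.Re (x^*) = complex.Re x.
Proof. by case: x. Qed.
Lemma Im_conj (x : C R) : complex.Im (x^*) = - complex.Im x.
Proof. by case: x. Qed.
Lemma normc2E (x : C R) : normc x ^+ 2 = complex.Re x ^+ 2 + complex.Im x ^+ 2.
Proof. by case: x => [? ?]; rewrite /normc /= sqr_sqrtr// addr_ge0// sqr_ge0. Qed.

Lemma toCK (x : C R) : toC (complex.Re x, complex.Im x) = x.
Proof. by case: x. Qed.

Section cmeasurable.
Context d (T : measurableType d).
Implicit Types f g : T -> C R.

Lemma measurable_on_C_comp (h : C R -> \bar R) f : measurable_on_C h -> cmeasurable f ->
    measurable_fun setT (h \o f).
Proof.
move=> mh [mf1 mf2]; rewrite (_ : h \o f = (h \o toC) \o (fun t =>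
  (complex.Re (f t) : RR, complex.Im (f t) : RR))).
  by apply: measurableT_comp => //; exact: measurable_fun_pair.
by apply/funext => t /=; rewrite toCK.
Qed.

Lemma cmeasurable_cst (c : C R) : cmeasurable (fun _ : T => c).
Proof. by split; exact: measurable_cst. Qed.

Lemma cmeasurableD f g : cmeasurable f -> cmeasurable g -> cmeasurable (fun t => f t + g t).
Proof.
move=> [f1 f2] [g1 g2]; split.
  by under eq_fun do rewrite Re_add; exact: measurable_funD.
by under eq_fun do rewrite Im_add; exact: measurable_funD.
Qed.

Lemma cmeasurableM f g : cmeasurable f -> cmeasurable g -> cmeasurable (fun t => f t * g t).
Proof.
move=> [f1 f2] [g1 g2]; split.
  by under eq_fun do rewrite Re_mul; apply: measurable_funB; exact: measurable_funM.
by under eq_fun do rewrite Im_mul; apply: measurable_funD; exact: measurable_funM.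
Qed.

Lemma cmeasurableN f : cmeasurable f -> cmeasurable (fun t => - f t).
Proof.
move=> mf; rewrite (_ : (fun t => - f t) = (fun t => (-1) * f t)).
  by apply: cmeasurableM => //; exact: cmeasurable_cst.
by apply/funext => t; rewrite mulN1r.
Qed.

Lemma cmeasurableJ f : cmeasurable f -> cmeasurable (fun t => (f t)^*).
Proof.
move=> [f1 f2]; split.
  by under eq_fun do rewrite Re_conj.
by under eq_fun do rewrite Im_conj; exact: measurable_funN.
Qed.

Lemma measurable_normc2 f : cmeasurable f -> measurable_fun setT (fun t => normc (f t) ^+ 2 : RR).
Proof.
move=> [f1 f2]; under eq_fun do rewrite normc2E.
by apply: measurable_funD; exact: measurable_funX.
Qed.

Lemma measurable_normc2V f : cmeasurable f ->
    measurable_fun setT (fun t => (normc (f t) ^+ 2)^-1 : RR).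
Proof.
move=> mf; under eq_fun do rewrite -powR_inv1 ?sqr_ge0//.
by apply: (measurableT_comp (measurable_powR _)); exact: measurable_normc2.
Qed.

Lemma cmeasurableV f : cmeasurable f -> cmeasurable (fun t => (f t)^-1).
Proof.
move=> mf; case: (mf) => f1 f2.
have mV : measurable_fun setT
    (fun t => (complex.Re (f t) ^+ 2 + complex.Im (f t) ^+ 2)^-1 : RR).
  by under eq_fun do rewrite -normc2E; exact: measurable_normc2V.
split.
  by under eq_fun do rewrite Re_inv; exact: measurable_funM.
by under eq_fun do rewrite Im_inv; apply: measurable_funM => //; exact: measurable_funN.
Qed.

Lemma measurable_normc f : cmeasurable f -> measurable_fun setT (fun t => normc (f t) : RR).
Proof.
move=> mf.
have n0 z : 0 <= normc z :> R by case: z => ? ?; exact: sqrtr_ge0.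
rewrite (_ : (fun t => _) = (fun t => powR (normc (f t) ^+ 2) 2^-1)).
  by apply: (measurableT_comp (measurable_powR _)); exact: measurable_normc2.
by apply/funext => t; rewrite -powR_mulrn// -powRrM mulfV// powRr1.
Qed.

End cmeasurable.

Lemma cmeasurable_toC : cmeasurable (fun p : RR * RR => toC p).
Proof. by split; [exact: measurable_fst|exact: measurable_snd]. Qed.

Lemma cmeasurable_comp d1 d2 (T1 : measurableType d1) (T2 : measurableType d2)
    (f : T2 -> C R) (g : T1 -> T2) :
  cmeasurable f -> measurable_fun setT g -> cmeasurable (f \o g).
Proof. by move=> [f1 f2] mg; split;
  [exact: (measurableT_comp f1)|exact: (measurableT_comp f2)]. Qed.

(** * Affine changes of variable in the complex plane *)

Definition integralC (h : C R -> \bar R) : \bar R := (\int[leb2]_p h (toC p))%E.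

Lemma measurable_on_C_precomp (h : C R -> \bar R) (f : C R -> C R) : measurable_on_C h ->
    cmeasurable (f \o toC) -> measurable_on_C (h \o f).
Proof. by move=> mh mf; exact: (measurable_on_C_comp mh mf). Qed.

Lemma cmeasurable_affine (c d : C R) : cmeasurable ((fun z => c * z + d) \o toC).
Proof.
apply: cmeasurableD; last exact: cmeasurable_cst.
by apply: cmeasurableM; [exact: cmeasurable_cst|exact: cmeasurable_toC].
Qed.

(** If c = a + i b with a <> 0, then z |-> c z + d is a shear that rescales the first coordinate
    by a, followed by one that rescales the second by (a^2 + b^2) / a. *)
Lemma integralC_affine_Re (c d : C R) (h : C R -> \bar R) : complex.Re c != 0 ->
  measurable_on_C h -> (forall z, (0 <= h z)%E) ->
  (integralC h = (normc c ^+ 2)%:E * integralC (fun z => h (c * z + d)%R))%E.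
Proof.
case: c d => [a b] [d1 d2] /= a0 mh h0.
have ab0 : a ^+ 2 + b ^+ 2 > 0.
  by rewrite ltr_wpDr ?sqr_ge0// lt_def sqrf_eq0 a0 sqr_ge0.
pose k := (a ^+ 2 + b ^+ 2) / a.
have k0 : k != 0 by rewrite mulf_neq0 ?invr_eq0// gt_eqF.
pose g u : RR := (b / a) * (u - d1) + d2.
have mg : measurable_fun setT (g : RR -> RR).
  apply: measurable_funD => //; apply: measurable_funM => //.
  exact: measurable_funB.
pose g1 u : RR := - b * u + d1.
have mg1 : measurable_fun setT (g1 : RR -> RR).
  by apply: measurable_funD => //; exact: measurable_funM.
rewrite /integralC (integral_shear2 (h := h \o toC) k0 mg)//; last by move=> ?; exact: h0.
rewrite (integral_shear1 (g := g1) (h := fun p => (h \o toC) (p.1, k * p.2 + g p.1)) a0 mg1)//;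
  last 2 first.
- apply: (measurableT_comp mh); apply: measurable_fun_pair => //.
  apply: measurable_funD; last exact: measurableT_comp.
  exact: measurable_funM.
- by move=> p; exact: h0.
rewrite muleA -EFinM -normrM (_ : k * a = normc (a +i* b)%C ^+ 2); last first.
  by rewrite normc2E /= /k -mulrA mulVf// mulr1.
congr (_ * _)%E; first by rewrite ger0_norm// sqr_ge0.
apply: eq_integral => -[x y] _; congr h; apply/eqP; rewrite /toC /= eq_complex /=.
by rewrite /g1 /g /k; apply/andP; split; apply/eqP; field.
Qed.

(** A nonzero c with zero real part is the product of 1 + i and a number with nonzero real part. *)
Lemma integralC_affine (c d : C R) (h : C R -> \bar R) : c != 0 ->
  measurable_on_C h -> (forall z, (0 <= h z)%E) ->
  (integralC h = (normc c ^+ 2)%:E * integralC (fun z => h (c * z + d)%R))%E.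
Proof.
move=> c0 mh h0.
have [c1|c1] := eqVneq (complex.Re c) 0; last exact: integralC_affine_Re.
have c2 : complex.Im c != 0.
  by apply: contra c0 => /eqP c2; rewrite -(toCK c) c1 c2.
pose c' : C R := (((complex.Im c) / 2) +i* ((complex.Im c) / 2))%C.
have cE : c = (1 +i* 1)%C * c'.
  by apply/eqP; rewrite eq_complex /= c1; apply/andP; split; apply/eqP; field.
have e1 : complex.Re ((1 +i* 1)%C : C R) != 0 by rewrite /= oner_neq0.
have e2 : complex.Re c' != 0 by rewrite /= mulf_neq0// invr_neq0.
rewrite (integralC_affine_Re d e1)//.
rewrite (integralC_affine_Re 0 e2); last 2 first.
- by apply: (measurable_on_C_precomp mh); exact: cmeasurable_affine.
- by move=> z; exact: h0.
rewrite muleA -EFinM -exprMn -normcM -cE; congr (_ * _)%E.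
by apply: eq_integral => p _; rewrite addr0 mulrA -cE.
Qed.

Lemma normcC0 : normc (0 : C R) = 0.
Proof. exact: normc0. Qed.

Lemma normcC_ge0 (z : C R) : 0 <= normc z.
Proof. by case: z => ? ?; exact: sqrtr_ge0. Qed.

Lemma measurable_on_CM (h : C R -> \bar R) (w : C R -> R) : measurable_on_C h ->
  measurable_fun [set: RR * RR] (fun p => w (toC p) : RR) ->
    measurable_on_C (fun z => (h z * (w z)%:E)%E).
Proof.
by move=> mh mw; apply: emeasurable_funM => //; exact/measurable_EFinP.
Qed.

(** * Haar measure of the multiplicative group and inversion *)

(** Integral against dz / |z|^2, the Haar measure of the multiplicative group C^*; the density
    is 0 at the origin. *)
Local Notation haar f := (integralC (fun z => f z * ((normc z ^+ 2)^-1)%:E)%E).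

Lemma measurable_haar (f : C R -> \bar R) : measurable_on_C f ->
    measurable_on_C (fun z => (f z * ((normc z ^+ 2)^-1)%:E)%E).
Proof. by move=> mf; apply: measurable_on_CM => //; apply: measurable_normc2V;
  exact: cmeasurable_toC. Qed.

Lemma normc2V_ge0 (z : C R) : 0 <= (normc z ^+ 2)^-1.
Proof. by rewrite invr_ge0 sqr_ge0. Qed.

Lemma haar_mul (c : C R) (f : C R -> \bar R) : c != 0 -> measurable_on_C f ->
    (forall z, (0 <= f z)%E) ->
  haar f = haar (fun z => f (c * z)%R).
Proof.
move=> c0 mf f0; rewrite (integralC_affine 0 c0 (measurable_haar mf)); last first.
  by move=> z; rewrite mule_ge0// lee_fin normc2V_ge0.
rewrite /integralC -ge0_integralZl//=; last 3 first.
- exact: (measurable_on_C_precomp (measurable_haar mf) (cmeasurable_affine c 0)).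
- by move=> p _; rewrite mule_ge0// lee_fin normc2V_ge0.
- by rewrite lee_fin sqr_ge0.
apply: eq_integral => p _; rewrite addr0 muleCA -EFinM; congr (_ * _%:E)%E.
rewrite normcM exprMn invfM mulrA mulfV ?mul1r// sqrf_eq0.
by apply: contra c0 => /eqP/eq0_normc ->.
Qed.

Definition haar_box : set (RR * RR) := `[1, 2]%classic `*` `[0, 1]%classic.

(** The factor |z|^2 cancels the density of Haar measure, so that the Haar integral is the area
    of the box. *)
Definition haar_bump (z : C R) : \bar R :=
  ((normc z ^+ 2 * \1_haar_box (complex.Re z, complex.Im z))%:E).

Lemma measurable_haar_box : measurable (haar_box : set (RR * RR)).
Proof. by apply: measurableX; exact: measurable_itv. Qed.

Lemma measurable_haar_bump : measurable_on_C haar_bump.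
Proof.
apply/measurable_EFinP; apply: measurable_funM.
  by apply: measurable_normc2; exact: cmeasurable_toC.
rewrite (_ : (fun _ => _) = \1_haar_box :> (RR * RR -> RR)); last by apply/funext => -[].
by apply: measurable_indic; exact: measurable_haar_box.
Qed.

Lemma haar_bump_ge0 z : (0 <= haar_bump z)%E.
Proof. by rewrite lee_fin mulr_ge0// sqr_ge0. Qed.

Lemma haar_bump_integral : haar haar_bump = 1%E.
Proof.
transitivity (\int[leb2]_p (\1_haar_box p)%:E)%E.
  apply: eq_integral => -[x y] _; rewrite /haar_bump /= -EFinM; congr EFin.
  rewrite indicE; have [|] := boolP ((x, y) \in haar_box); last by rewrite mulr0 mul0r.
  rewrite inE => -[/=]; rewrite !in_itv/= => /andP[x1 _] _.
  rewrite mulr1 mulfV// /normc /= sqrf_eq0 sqrtr_eq0 -ltNge.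
  by rewrite ltr_pwDl ?sqr_ge0// exprn_gt0// (lt_le_trans _ x1).
rewrite integral_indic//; last exact: measurable_haar_box.
rewrite setIT; transitivity (leb `[1%R, 2%R]%classic * leb `[0%R, 1%R]%classic)%E.
  by apply: product_measure1E; exact: measurable_itv.
rewrite !lebesgue_measure_itv/= !lte_fin.
rewrite ltr1n ltr01 -!EFinB -EFinM; congr EFin; lra.
Qed.

(** The Haar measure of a commutative group is invariant under inversion. Let g have integral 1.
    Then f(1/p) integrates to the double integral of f(1/p) g(p q); the substitution of p / q
    for p at fixed q turns the integrand into f(q/p) g(p), and the substitution of p q for q at
    fixed p splits it into f(q) g(p). *)
Lemma haar_inv (f : C R -> \bar R) : measurable_on_C f -> (forall z, (0 <= f z)%E) ->
  haar (fun z => f (z^-1)%R) = haar f.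
Proof.
move=> mf f0.
have cx : cmeasurable (fun q : (RR * RR) * (RR * RR) => toC q.1).
  by apply: (cmeasurable_comp cmeasurable_toC); exact: measurable_fst.
have cy : cmeasurable (fun q : (RR * RR) * (RR * RR) => toC q.2).
  by apply: (cmeasurable_comp cmeasurable_toC); exact: measurable_snd.
have mV (g : (RR * RR) * (RR * RR) -> C R) : cmeasurable g -> measurable_fun setT
    (fun q => ((normc (g q) ^+ 2)^-1)%:E).
  by move=> mg; apply/measurable_EFinP; exact: measurable_normc2V.
pose F1 (q : (RR * RR) * (RR * RR)) : \bar R :=
  (f ((toC q.1)^-1)%R * ((normc (toC q.1) ^+ 2)^-1)%:E *
   (haar_bump (toC q.1 * toC q.2)%R * ((normc (toC q.2) ^+ 2)^-1)%:E))%E.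
have mF1 : measurable_fun setT F1.
  apply: emeasurable_funM; apply: emeasurable_funM.
  - by apply: (measurable_on_C_comp mf); exact: cmeasurableV.
  - exact: mV.
  - by apply: (measurable_on_C_comp measurable_haar_bump); exact: cmeasurableM.
  - exact: mV.
pose F2 (q : (RR * RR) * (RR * RR)) : \bar R :=
  (haar_bump (toC q.1) * ((normc (toC q.1) ^+ 2)^-1)%:E *
   (f ((toC q.1)^-1 * toC q.2)%R * ((normc (toC q.2) ^+ 2)^-1)%:E))%E.
have mF2 : measurable_fun setT F2.
  apply: emeasurable_funM; apply: emeasurable_funM.
  - exact: (measurable_on_C_comp measurable_haar_bump).
  - exact: mV.
  - by apply: (measurable_on_C_comp mf); apply: cmeasurableM => //; exact: cmeasurableV.
  - exact: mV.
have V0 (z : C R) : (0 <= ((normc z ^+ 2)^-1)%:E)%E by rewrite lee_fin normc2V_ge0.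
have F10 q : (0 <= F1 q)%E by rewrite /F1 !mule_ge0// haar_bump_ge0.
have F20 q : (0 <= F2 q)%E by rewrite /F2 !mule_ge0// haar_bump_ge0.
have mZ (c : C R) (g : C R -> \bar R) : measurable_on_C g -> measurable_on_C (fun z => g (c * z)).
  move=> mg; apply: (measurable_on_C_precomp mg); apply: cmeasurableM; first exact: cmeasurable_cst.
  exact: cmeasurable_toC.
transitivity (\int[leb2]_p \int[leb2]_q F1 (p, q))%E.
  apply: eq_integral => p _; rewrite /F1 /=.
  rewrite ge0_integralZl//; last 3 first.
  - exact: (measurable_haar (mZ _ _ measurable_haar_bump)).
  - by move=> q _; rewrite mule_ge0// haar_bump_ge0.
  - by rewrite mule_ge0.
  have [->|p0] := eqVneq (toC p) 0.
    by rewrite normcC0 expr0n/= !invr0 mule0 mul0e.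
  by rewrite -[LHS]mule1 -haar_bump_integral (haar_mul p0 measurable_haar_bump haar_bump_ge0).
transitivity (\int[leb2]_q \int[leb2]_p F1 (p, q))%E.
  exact: (fubini_tonelli F1).
transitivity (\int[leb2]_q \int[leb2]_p F2 (p, q))%E.
  apply: eq_integral => q _; rewrite /F1 /F2 /=.
  have [q0|q0] := eqVneq (toC q) 0.
    rewrite [LHS]integral0_eq ?[RHS]integral0_eq// => p _.
      by rewrite q0 normcC0 expr0n/= !invr0 !mule0.
    by rewrite q0 normcC0 expr0n/= !invr0 !mule0.
  pose phi z : \bar R := (f (z^-1)%R * haar_bump (z * toC q)%R * ((normc (toC q) ^+ 2)^-1)%:E)%E.
  have mphi : measurable_on_C phi.
    apply: emeasurable_funM => //; apply: emeasurable_funM.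
      by apply: (measurable_on_C_comp mf); apply: cmeasurableV; exact: cmeasurable_toC.
    apply: (measurable_on_C_comp measurable_haar_bump); apply: cmeasurableM;
      [exact: cmeasurable_toC|exact: cmeasurable_cst].
  have phi0 z : (0 <= phi z)%E by rewrite /phi !mule_ge0// haar_bump_ge0.
  transitivity (haar phi).
    apply: eq_integral => p _; rewrite /phi -!muleA; congr (_ * _)%E.
    by rewrite muleC -!muleA.
  rewrite (haar_mul (invr_neq0 q0))//.
  apply: eq_integral => p _; rewrite /phi.
  rewrite invfM invrK (mulrC _ (toC p)) mulfVK// (mulrC (toC q)).
  rewrite muleAC [in LHS](muleC (f _)) -!muleA; congr (_ * _)%E.
  by rewrite muleCA.
transitivity (\int[leb2]_p \int[leb2]_q F2 (p, q))%E.
  by apply/esym; exact: (fubini_tonelli F2).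
transitivity (\int[leb2]_p (haar_bump (toC p) * ((normc (toC p) ^+ 2)^-1)%:E * haar f))%E.
  apply: eq_integral => p _; rewrite /F2 /=.
  rewrite ge0_integralZl//; last 3 first.
  - exact: (measurable_haar (mZ _ _ mf)).
  - by move=> q _; rewrite mule_ge0.
  - by rewrite mule_ge0// haar_bump_ge0.
  have [->|p0] := eqVneq (toC p) 0.
    by rewrite normcC0 expr0n/= !invr0 mule0 !mul0e.
  congr (_ * _)%E.
  by rewrite [RHS](haar_mul (invr_neq0 p0)).
rewrite ge0_integralZr//; last 3 first.
- exact: (measurable_haar measurable_haar_bump).
- by move=> p _; rewrite mule_ge0// haar_bump_ge0.
- by apply: integral_ge0 => p _; rewrite mule_ge0.
by rewrite -[RHS]mul1e -haar_bump_integral.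
Qed.

(** Haar and Lebesgue densities differ by the factor |z|^2, which costs |z|^-4 under an
    inversion. The passage back to Lebesgue measure loses the value at the origin, whence an
    inequality. *)
Lemma integralC_inv_le (h : C R -> \bar R) : measurable_on_C h -> (forall z, (0 <= h z)%E) ->
  (integralC (fun z => h (z^-1)%R * ((normc z ^+ 4)^-1)%:E) <= integralC h)%E.
Proof.
move=> mh h0.
pose f z := (h z * (normc z ^+ 2)%:E)%E.
have mf : measurable_on_C f by apply: measurable_on_CM => //; apply: measurable_normc2;
  exact: cmeasurable_toC.
have f0 z : (0 <= f z)%E by rewrite mule_ge0// lee_fin sqr_ge0.
rewrite [leLHS](_ : _ = haar (fun z => f (z^-1)%R)); last first.
  apply: eq_integral => p _; rewrite /f -muleA -EFinM; congr (_ * _%:E)%E.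
  by rewrite normcV -!exprVn -exprD.
rewrite haar_inv//; apply: ge0_le_integral => //.
- by move=> p _; rewrite mule_ge0// lee_fin normc2V_ge0.
- exact: (measurable_haar mf).
- move=> p _; rewrite /f -muleA -EFinM -[leRHS]mule1 lee_wpmul2l// lee_fin.
  have [->|p0] := eqVneq (normc (toC p)) 0; first by rewrite expr0n mul0r.
  by rewrite mulfV// sqrf_eq0.
Qed.

(** * Moebius changes of variable *)

Definition den (a b z : C R) : C R := b^* * z + a^*.
Definition mob (a b z : C R) : C R := (a * z + b) / den a b z.

Lemma norm_normc (z : C R) : `|z| = (normc z)%:C%C.
Proof. by []. Qed.

Lemma normcCJ (z : C R) : normc z^* = normc z.
Proof. by case: z => x y; rewrite /normc /= sqrrN. Qed.

Lemma su11_normc (a b : C R) : su11 a b -> normc a ^+ 2 = 1 + normc b ^+ 2.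
Proof.
rewrite /su11 !norm_normc -!rmorphXn -rmorphB/= => /eqP; rewrite eq_complex /= => /andP[/eqP H _].
by rewrite -H subrK.
Qed.

Lemma normc_eq0 (z : C R) : (normc z == 0) = (z == 0).
Proof. by apply/eqP/eqP => [/eq0_normc|->] //; exact: normcC0. Qed.

Lemma su11_a_neq0 (a b : C R) : su11 a b -> a != 0.
Proof.
move=> /su11_normc H; apply/negP => /eqP a0.
by move: H; rewrite a0 normcC0 expr0n/= => /eqP; rewrite lt_eqF// ltr_wpDr// sqr_ge0.
Qed.

Lemma cmeasurable_den d (T : measurableType d) (f : T -> C R) a b : cmeasurable f ->
    cmeasurable (fun t => den a b (f t)).
Proof.
move=> mf; apply: cmeasurableD; last exact: cmeasurable_cst.
by apply: cmeasurableM => //; exact: cmeasurable_cst.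
Qed.

Lemma cmeasurable_mob d (T : measurableType d) (f : T -> C R) a b : cmeasurable f ->
    cmeasurable (fun t => mob a b (f t)).
Proof.
move=> mf; apply: cmeasurableM; last by apply: cmeasurableV; exact: cmeasurable_den.
apply: cmeasurableD; last exact: cmeasurable_cst.
by apply: cmeasurableM => //; exact: cmeasurable_cst.
Qed.

(** For b <> 0 a Moebius map is an affine map followed by the inversion and by another affine
    map; for b = 0 it is a rotation. At the pole the density is 0, as 0^-1 = 0. *)
Lemma integralC_mob_le (a b : C R) (h : C R -> \bar R) : su11 a b -> measurable_on_C h ->
    (forall z, (0 <= h z)%E) ->
  (integralC (fun z => h (mob a b z) * ((normc (den a b z) ^+ 4)^-1)%:E) <= integralC h)%E.
Proof.
move=> sab mh h0.
have a0 := su11_a_neq0 sab.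
have Na0 : normc a != 0 by rewrite normc_eq0.
have [b0|b0] := eqVneq b 0.
  have Na : normc a ^+ 2 = 1.
    by rewrite (su11_normc sab) b0 normcC0 expr0n addr0.
  have ac0 : a / a^* != 0 by rewrite mulf_neq0// invr_eq0 conjC_eq0.
  have E z : mob a b z = a / a^* * z + 0.
    by rewrite /mob /den b0 conjC0 mul0r add0r !addr0 mulrAC.
  have nE : normc (a / a^*) = 1 by rewrite normcM normcV normcCJ mulfV.
  rewrite [leRHS](integralC_affine 0 ac0)// nE expr1n mul1e.
  rewrite le_eqVlt; apply/orP; left; apply/eqP; apply: eq_integral => p _.
  rewrite E /den b0 conjC0 mul0r add0r normcCJ -[4%N]/(2 * 2)%N exprM Na expr1n invr1.
  by rewrite mule1.
pose g v := h (- (b^*)^-1 * v + a / b^*).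
have bc0 : b^* != 0 by rewrite conjC_eq0.
have nb : normc b^* != 0 by rewrite normc_eq0.
have mg : measurable_on_C g by apply: (measurable_on_C_precomp mh); exact: cmeasurable_affine.
have g0 v : (0 <= g v)%E by exact: h0.
pose k u := (g (u^-1)%R * ((normc u ^+ 4)^-1)%:E)%E.
have mk : measurable_on_C k.
  apply: emeasurable_funM.
    by apply: (measurable_on_C_comp mg); apply: cmeasurableV; exact: cmeasurable_toC.
  apply/measurable_EFinP; under eq_fun do rewrite -[4%N]/(2 * 2)%N exprM -exprVn.
  by apply: measurable_funX; apply: measurable_normc2V; exact: cmeasurable_toC.
have k0 u : (0 <= k u)%E.
  by rewrite mule_ge0// lee_fin invr_ge0 exprn_ge0// normcC_ge0.
have E z : (h (mob a b z) * ((normc (den a b z) ^+ 4)^-1)%:E)%E = k (b^* * z + a^*).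
  rewrite /k -/(den a b z).
  have [->|d0] := eqVneq (den a b z) 0.
    by rewrite normcC0 expr0n/= !invr0 !mule0.
  congr (h _ * _)%E.
  have ab1 : a * a^* - b * b^* = 1 by rewrite -!normCK.
  rewrite /mob; apply: (mulIf d0); rewrite mulfVK// [RHS]mulrDl -mulrA mulVf// mulr1.
  apply: (mulIf bc0); rewrite [RHS]mulrDl mulNr mulVf// (mulrAC (a / _)) mulfVK//.
  by rewrite -ab1 /den; ring.
rewrite [leLHS](_ : _ = integralC (fun z => k (b^* * z + a^*)%R)); last first.
  by apply: eq_integral => p _; rewrite E.
have I0 : (0 <= integralC (fun z => k (b^* * z + a^*)%R))%E by exact: integral_ge0.
have b2 : 0 < normc b^* ^+ 2 by rewrite lt_def sqrf_eq0 nb sqr_ge0.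
rewrite -(@lee_pmul2l _ (normc b^* ^+ 2)%:E)//.
rewrite -(integralC_affine a^* bc0 mk k0).
apply: (le_trans (integralC_inv_le mg g0)).
have nbc0 : - (b^*)^-1 != 0 by rewrite oppr_eq0 invr_eq0.
rewrite [X in (_ <= _ * X)%E](integralC_affine (a / b^*) nbc0 mh h0).
rewrite muleA -EFinM -exprMn normcN normcV mulfV// expr1n mul1e.
exact: lexx.
Qed.

End plane.

(** * Moebius changes of variable for pairs of points *)

Section tonelli4.
Variable R : realType.
Local Notation leb := (@lebesgue_measure R).
Local Notation RR := (measurableTypeR R).
Local Notation leb2 := (@plane_measure R).

Lemma lebesgue4_eq : @lebesgue4 R = (leb2 \x leb2)%E.
Proof. by apply/funext => A. Qed.

Lemma tonelli4 (H : (RR * RR) * (RR * RR) -> \bar R) : measurable_fun setT H ->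
    (forall q, (0 <= H q)%E) ->
  (\int[@lebesgue4 R]_q H q = \int[leb2]_x \int[leb2]_y H (x, y))%E /\
  (\int[@lebesgue4 R]_q H q = \int[leb2]_y \int[leb2]_x H (x, y))%E.
Proof.
move=> mH H0.
rewrite lebesgue4_eq; split; [exact: (fubini_tonelli1 H)|exact: (fubini_tonelli2 H)].
Qed.

(** By Tonelli it suffices to move one variable at a time. *)
Lemma integral4_mob_le (a b : C R) (H : C R * C R -> \bar R) : su11 a b ->
  measurable_fun [set: (RR * RR) * (RR * RR)] (H \o @of_real_coords R) ->
  (forall p, (0 <= H p)%E) ->
  (\int[@lebesgue4 R]_q (H (mob a b (toC q.1), mob a b (toC q.2)) *
     ((normc (den a b (toC q.1)) ^+ 4)^-1 * (normc (den a b (toC q.2)) ^+ 4)^-1)%:E)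
   <= \int[@lebesgue4 R]_q H (of_real_coords q))%E.
Proof.
move=> sab mH H0.
have cx : cmeasurable (fun q : (RR * RR) * (RR * RR) => toC q.1).
  exact: (cmeasurable_comp (cmeasurable_toC R) measurable_fst).
have cy : cmeasurable (fun q : (RR * RR) * (RR * RR) => toC q.2).
  exact: (cmeasurable_comp (cmeasurable_toC R) measurable_snd).
have V0 z : (0 <= ((normc (den a b z) ^+ 4)^-1)%:E)%E.
  by rewrite lee_fin invr_ge0 exprn_ge0// normcC_ge0.
have mV (f : (RR * RR) * (RR * RR) -> C R) : cmeasurable f -> measurable_fun setT
    (fun q => ((normc (den a b (f q)) ^+ 4)^-1)%:E).
  move=> mf; apply/measurable_EFinP; under eq_fun do rewrite -[4%N]/(2 * 2)%N exprM -exprVn.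
  by apply: measurable_funX; apply: measurable_normc2V; exact: cmeasurable_den.
have mcomp (f g : (RR * RR) * (RR * RR) -> C R) : cmeasurable f -> cmeasurable g ->
    measurable_fun setT (fun q => H (f q, g q)).
  move=> [f1 f2] [g1 g2].
  rewrite (_ : (fun q => _) = (H \o @of_real_coords R) \o (fun q =>
    ((complex.Re (f q) : RR, complex.Im (f q) : RR), (complex.Re (g q) : RR,
      complex.Im (g q) : RR)))).
    apply: (measurableT_comp mH).
    by apply: measurable_fun_pair; apply: measurable_fun_pair.
  apply/funext => q /=; congr (H (_, _)); last by rewrite -[LHS]toCK.
  by rewrite -[LHS]toCK.
pose H1 (q : (RR * RR) * (RR * RR)) := (H (mob a b (toC q.1), mob a b (toC q.2)) *
     ((normc (den a b (toC q.1)) ^+ 4)^-1 * (normc (den a b (toC q.2)) ^+ 4)^-1)%:E)%E.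
pose H2 (q : (RR * RR) * (RR * RR)) := (H (toC q.1, mob a b (toC q.2)) *
     ((normc (den a b (toC q.2)) ^+ 4)^-1)%:E)%E.
have mH1 : measurable_fun setT H1.
  apply: emeasurable_funM; first by apply: mcomp; exact: cmeasurable_mob.
  by under eq_fun do rewrite EFinM; apply: emeasurable_funM; exact: mV.
have mH2 : measurable_fun setT H2.
  apply: emeasurable_funM; last exact: mV.
  by apply: mcomp => //; exact: cmeasurable_mob.
have H10 q : (0 <= H1 q)%E by rewrite mule_ge0// EFinM mule_ge0.
have H20 q : (0 <= H2 q)%E by rewrite mule_ge0.
have mH' : measurable_fun setT (fun q => H (of_real_coords q)) by exact: mH.
apply: (@le_trans _ _ (\int[@lebesgue4 R]_q H2 q)%E).
  rewrite (proj2 (tonelli4 mH1 H10)) (proj2 (tonelli4 mH2 H20)).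
  apply: ge0_le_integral => //.
  - by move=> y _; exact: integral_ge0.
  - exact: (measurable_fun_fubini_tonelli_G _ mH1).
  - exact: (measurable_fun_fubini_tonelli_G _ mH2).
  move=> y _.
  pose h z := (H (z, mob a b (toC y)) * ((normc (den a b (toC y)) ^+ 4)^-1)%:E)%E.
  have mh : measurable_on_C h by exact: (measurable_fun_pair1 y mH2).
  have h0 z : (0 <= h z)%E by rewrite mule_ge0.
  apply: le_trans (integralC_mob_le sab mh h0).
  rewrite le_eqVlt; apply/orP; left; apply/eqP.
  by apply: eq_integral => x _; rewrite /H1 /h /= EFinM -!muleA; congr (_ * _)%E; rewrite muleC.
rewrite (proj1 (tonelli4 mH2 H20)) (proj1 (tonelli4 mH' _))//.
apply: ge0_le_integral => //.
- by move=> x _; exact: integral_ge0.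
- exact: (measurable_fun_fubini_tonelli_F _ mH2).
- exact: (@measurable_fun_fubini_tonelli_F _ _ _ _ _ leb2 (fun q =>
  H (of_real_coords q)) mH' (fun q => H0 _)).
move=> x _.
have mh : measurable_on_C (fun z => H (toC x, z)) by exact: (measurable_fun_pair2 x mH').
exact: (integralC_mob_le sab mh).
Qed.

End tonelli4.

(** * Identities and estimates for SU(1,1) *)

Section moebius.
Variable R : realType.
Implicit Types a b z w : C R.

Lemma unit_diskP z : unit_disk z <-> normc z < 1.
Proof. by rewrite /unit_disk /= norm_normc -[1]/((1 : R)%:C%C) ltcR. Qed.

Lemma normcJ_mul z : z^* * z = ((normc z ^+ 2)%:C%C : C R).
Proof. by rewrite mulrC -normCK norm_normc -rmorphXn. Qed.

Lemma normc_triangle z w : normc (z + w) <= normc z + normc w.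
Proof. exact: le_normcD. Qed.

Lemma normc_sub_ge z w : normc z - normc w <= normc (z + w).
Proof.
rewrite lerBlDr; apply: le_trans (_ : _ <= normc ((z + w) + - w)) _; first by rewrite addrK.
by rewrite -[X in _ <= _ + X]normcN; exact: normc_triangle.
Qed.

Lemma su11_le a b : su11 a b -> normc b <= normc a.
Proof.
move=> /su11_normc H; rewrite -(@ler_pXn2r _ 2)// ?nnegrE ?normcC_ge0//.
by rewrite H lerDr.
Qed.

Lemma su11_ge1 a b : su11 a b -> 1 <= normc a.
Proof.
move=> /su11_normc H; rewrite -(@ler_pXn2r _ 2)// ?nnegrE ?normcC_ge0//.
by rewrite H expr1n lerDl sqr_ge0.
Qed.

Lemma den_lower a b z : su11 a b -> normc z < 1 ->
  normc a * (1 - normc z) <= normc (den a b z).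
Proof.
move=> sab z1; rewrite /den [X in _ <= normc X]addrC; apply: le_trans (normc_sub_ge _ _).
rewrite normcM !normcCJ mulrBr mulr1 lerD2l lerN2 ler_wpM2r ?normcC_ge0//.
exact: su11_le sab.
Qed.

Lemma den_upper a b z : su11 a b -> normc z < 1 -> normc (den a b z) <= 2 * normc a.
Proof.
move=> sab z1; apply: (le_trans (normc_triangle _ _)).
rewrite normcM !normcCJ mulr2n mulrDl mul1r lerD2r.
rewrite -[leRHS]mulr1 ler_pM ?normcC_ge0 ?(su11_le sab)//.
exact: ltW.
Qed.

Lemma den_gt0 a b z : su11 a b -> normc z < 1 -> 0 < normc (den a b z).
Proof.
move=> sab z1; apply: lt_le_trans (den_lower sab z1).
by rewrite mulr_gt0 ?subr_gt0// (lt_le_trans ltr01 (su11_ge1 sab)).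
Qed.

Lemma den_neq0 a b z : su11 a b -> normc z < 1 -> den a b z != 0.
Proof. by move=> sab z1; rewrite -normc_eq0 gt_eqF// den_gt0. Qed.

Lemma su11E a b : su11 a b -> a * a^* - b * b^* = 1.
Proof. by move=> sab; rewrite -!normCK. Qed.

(** Each denominator has size |a| on compact parts of the disk, so displacements shrink like
    |a|^-2; this governs the convergence of all the series below. *)
Lemma mob_sub a b z w : su11 a b -> normc z < 1 -> normc w < 1 ->
  mob a b w - mob a b z = (w - z) / (den a b z * den a b w).
Proof.
move=> sab z1 w1; have d1 := den_neq0 sab z1; have d2 := den_neq0 sab w1.
have -> : w - z = (w - z) * (a * a^* - b * b^*) by rewrite su11E ?mulr1.
have -> : mob a b w - mob a b z =
    ((a * w + b) * den a b z - (a * z + b) * den a b w) / (den a b z * den a b w).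
  by rewrite /mob; field; rewrite d1 d2.
by congr (_ / _); rewrite /den; ring.
Qed.

Lemma conj_den a b z : (den a b z)^* = b * z^* + a.
Proof. by rewrite /den rmorphD rmorphM/= !conjCK. Qed.

(** The polarised form of the invariance under SU(1,1) of the hermitian form |u|^2 - |v|^2. The
    invariance of delta and of dV follows from it. *)
Lemma one_sub_conj_mob a b z w : su11 a b -> normc z < 1 -> normc w < 1 ->
  1 - (mob a b z)^* * mob a b w = (1 - z^* * w) / ((den a b z)^* * den a b w).
Proof.
move=> sab z1 w1; have d1 := den_neq0 sab z1; have d2 := den_neq0 sab w1.
have d1c : (den a b z)^* != 0 by rewrite conjC_eq0.
have -> : 1 - z^* * w = (1 - z^* * w) * (a * a^* - b * b^*) by rewrite su11E ?mulr1.
apply: (mulIf (mulf_neq0 d1c d2)); rewrite mulfVK ?mulf_neq0//.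
have -> : (mob a b z)^* = (a^* * z^* + b^*) / (den a b z)^*.
  by rewrite /mob rmorphM/= fmorphV rmorphD rmorphM.
rewrite mulrBl mul1r /mob.
have -> : (a^* * z^* + b^*) / (den a b z)^* * ((a * w + b) / den a b w) *
    ((den a b z)^* * den a b w) = (a^* * z^* + b^*) * (a * w + b).
  by field; rewrite d2 d1c.
by rewrite conj_den /den; ring.
Qed.

Lemma one_sub_mob2 a b z : su11 a b -> normc z < 1 ->
  1 - normc (mob a b z) ^+ 2 = (1 - normc z ^+ 2) / normc (den a b z) ^+ 2.
Proof.
move=> sab z1; have := one_sub_conj_mob sab z1 z1; rewrite !normcJ_mul.
rewrite -[1]/((1 : R)%:C%C) -!rmorphB -fmorphV -rmorphM /=.
by move=> /eqP; rewrite eq_complex /= => /andP[/eqP].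
Qed.

Lemma mob_lt1 a b z : su11 a b -> normc z < 1 -> normc (mob a b z) < 1.
Proof.
move=> sab z1; rewrite -(@ltr_pXn2r _ 2)// ?nnegrE ?normcC_ge0//.
rewrite expr1n -subr_gt0 one_sub_mob2// divr_gt0 ?exprn_gt0 ?den_gt0//.
by rewrite subr_gt0 exprn_ilt1 ?normcC_ge0.
Qed.

Lemma su11_inv a b : su11 a b -> su11 a^* (- b).
Proof. by rewrite /su11 normrN norm_conjC. Qed.

Lemma mob_inv a b z : su11 a b -> normc z < 1 -> mob a^* (- b) (mob a b z) = z.
Proof.
move=> sab z1; have d1 := den_neq0 sab z1.
have d2 := den_neq0 (su11_inv sab) (mob_lt1 sab z1).
have : den a^* (- b) (mob a b z) = (den a b z)^-1.
  apply: (mulIf d1); rewrite mulVf// /den rmorphN/= conjCK mulrDl.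
  rewrite -/(den a b z) /mob mulNr mulrA mulNr mulfVK// -[RHS](su11E sab).
  by rewrite /den; ring.
move=> E; rewrite {1}/mob E invrK mulrDl /mob mulrA mulfVK//.
rewrite -[RHS]mulr1 -(su11E sab) /den; ring.
Qed.

Lemma normcC1 : normc (1 : C R) = 1.
Proof. exact: normc1. Qed.

Lemma normcX z N : normc (z ^+ N) = normc z ^+ N.
Proof. by elim: N => [|N IH]; rewrite ?expr0 ?normcC1// !exprS normcM IH. Qed.

Lemma sub_conj_gt0 z w : normc z < 1 -> normc w < 1 -> 0 < normc (1 - z^* * w).
Proof.
move=> z1 w1; apply: lt_le_trans (normc_sub_ge _ _).
rewrite normcC1 normcN normcM normcCJ subr_gt0.
have := normcC_ge0 z; have := normcC_ge0 w.
by move=> h1 h2; apply: le_lt_trans w1; rewrite ler_piMl// ltW.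
Qed.

Lemma one_sub2_gt0 z : normc z < 1 -> 0 < 1 - normc z ^+ 2.
Proof. by move=> z1; rewrite subr_gt0 exprn_ilt1 ?normcC_ge0. Qed.

Lemma delta_gt0 z w : normc z < 1 -> normc w < 1 -> 0 < delta (z, w).
Proof.
by move=> z1 w1; rewrite /delta/= divr_gt0 ?mulr_gt0 ?exprn_gt0 ?one_sub2_gt0 ?sub_conj_gt0.
Qed.

Lemma delta_mob a b z w : su11 a b -> normc z < 1 -> normc w < 1 ->
  delta (mob a b z, mob a b w) = delta (z, w).
Proof.
move=> sab z1 w1; rewrite /delta/= !one_sub_mob2// one_sub_conj_mob// normcM normcV normcM normcCJ.
have := den_gt0 sab z1; have := den_gt0 sab w1; have := sub_conj_gt0 z1 w1.
move: (normc (den a b z)) (normc (den a b w)) (normc (1 - _)) => x y t t0 y0 x0.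
by field; rewrite !gt_eqF.
Qed.

Lemma dV_mob a b z w : su11 a b -> normc z < 1 -> normc w < 1 ->
  dV_density (mob a b z, mob a b w) * ((normc (den a b z) ^+ 4)^-1 * (normc (den a b w) ^+ 4)^-1)
    = dV_density (z, w).
Proof.
move=> sab z1 w1; rewrite /dV_density/= one_sub_conj_mob// normcM normcV normcM normcCJ.
have := den_gt0 sab z1; have := den_gt0 sab w1; have := sub_conj_gt0 z1 w1.
move: (normc (den a b z)) (normc (den a b w)) (normc (1 - _)) => x y t t0 y0 x0.
by field; rewrite !gt_eqF.
Qed.

Lemma moebius_ofE a b (g : disk R -> disk R) (z : disk R) : moebius_of a b g ->
    \val (g z) = mob a b (\val z).
Proof. by move=> ->. Qed.

Lemma disk_lt1 (z : disk R) : normc (\val z) < 1.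
Proof. by apply/unit_diskP; exact: set_valP. Qed.

End moebius.

(** * Integrability of a power of the distance to the circle *)

Section boundary_singularity.
Variable R : realType.
Local Notation leb := (@lebesgue_measure R).
Local Notation RR := (measurableTypeR R).

Lemma powR_anti (b s t : R) : b < 0 -> 0 < s -> s <= t -> t `^ b <= s `^ b.
Proof.
move=> b0 s0 st; have t0 := lt_le_trans s0 st.
rewrite -[b]opprK (powRN t) (powRN s) lef_pV2 ?posrE ?powR_gt0//.
by rewrite ge0_ler_powR// ?nnegrE ?oppr_ge0 ?ltW.
Qed.

(** The fundamental theorem of calculus applies on the intervals [c / (i + 2), c], which
    increase to ]0, c]; monotone convergence does the rest. *)
Lemma integral_powR_bound (c b : R) : 0 < c -> -1 < b ->
  (\int[leb]_(t in `]0%R, c]) (t `^ b)%:E <= (c `^ (b + 1) / (b + 1))%:E)%E.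
Proof.
move=> c0 b1.
have b10 : 0 < b + 1 by rewrite -ltrBlDr sub0r.
have b10n : b + 1 != 0 by rewrite gt_eqF.
pose F (i : nat) : set RR := `[c / i.+2%:R, c]%classic.
pose G (t : R) := (b + 1)^-1 * t `^ (b + 1).
have ci i : 0 < c / i.+2%:R by rewrite divr_gt0.
have FE i : (\int[leb]_(t in F i) (t `^ b)%:E = (G c)%:E - (G (c / i.+2%:R))%:E)%E.
  have cpow (t p : R) : 0 < t -> {for t, continuous (@powR R ^~ p)}.
    move=> t0; apply: differentiable_continuous; apply/derivable1_diffP.
    by apply: derivable_powR; rewrite in_itv/= t0.
  have dG (t : R) : 0 < t -> is_derive t 1 G (t `^ b).
    move=> t0; have := is_derive1_powR (b + 1) t0; rewrite addrK => D.
    have := @is_deriveZ _ _ _ (@powR R ^~ (b + 1)) ((b + 1)^-1) t 1 _ D.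
    by rewrite scalerA mulVf// scale1r.
  have cG (t : R) : 0 < t -> {for t, continuous G}.
    by move=> t0; apply: differentiable_continuous; apply/derivable1_diffP; case: (dG t t0).
  apply: continuous_FTC2.
  - by rewrite ltr_pdivrMr// ltr_pMr// ltr1n.
  - apply: continuous_in_subspaceT => t; rewrite inE/= in_itv/= => /andP[t1 _].
    by apply: cpow; exact: lt_le_trans t1.
  - split.
    + by move=> t; rewrite in_itv/= => /andP[t1 _]; case: (dG t (lt_trans (ci i) t1)).
    + by apply: cvg_at_right_filter; apply: cG.
    + by apply: cvg_at_left_filter; apply: cG.
  - move=> t; rewrite in_itv/= => /andP[t1 _].
    by rewrite derive1E; have [_ ->] := dG t (lt_trans (ci i) t1).
have UF : \bigcup_i F i = `]0, c]%classic.
  apply/seteqP; split => t /=.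
    move=> [i _]; rewrite /F/= !in_itv/= => /andP[t1 ->]; rewrite andbT.
    exact: lt_le_trans t1.
  rewrite in_itv/= => /andP[t0 tc].
  exists (Num.bound (c / t)) => //; rewrite /F/= in_itv/= tc andbT.
  rewrite ler_pdivrMr// mulrC -ler_pdivrMr//.
  have /ltW H := archi_boundP (ltW (divr_gt0 c0 t0)).
  by apply: (le_trans H); rewrite ler_nat -addn2 leq_addr.
have ndF : nondecreasing_seq F.
  move=> i j ij; apply/subsetPset => t; rewrite /F/= !in_itv/= => /andP[t1 ->]; rewrite andbT.
  apply: le_trans t1; rewrite ler_pM2l// lef_pV2 ?posrE//.
  by rewrite ler_nat.
have mF i : measurable (F i) by exact: measurable_itv.
have mf i : measurable_fun (F i) (fun t : RR => (t `^ b)%:E).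
  by apply: measurable_funTS; apply/measurable_EFinP; exact: measurable_powR.
have f0 i t : F i t -> (0 <= (t `^ b)%:E)%E by move=> _; rewrite lee_fin powR_ge0.
have cv : (\int[leb]_(t in F i) (t `^ b)%:E)%E @[i --> \oo] -->
    (\int[leb]_(t in \bigcup_i F i) (t `^ b)%:E)%E.
  by apply: ge0_nondecreasing_set_cvg_integral.
rewrite UF in cv; rewrite -(cvg_lim _ cv)//; apply: lime_le; first by apply/cvg_ex; eexists;
  exact: cv.
apply: nearW => i; rewrite FE -EFinB lee_fin /G mulrC gerBl.
by rewrite mulr_ge0 ?powR_ge0// invr_ge0 ltW.
Qed.

(** The exponent b at distance t from an end point of a chord of the disk. *)
Definition edge_weight (b t : R) : \bar R := ((fun t => (t `^ b)%:E) \_ `]0%R, 2]) t.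

Lemma edge_weight_ge0 b t : (0 <= edge_weight b t)%E.
Proof. by rewrite /edge_weight patchE; case: ifPn => // _; rewrite lee_fin powR_ge0. Qed.

Lemma measurable_edge_weight b : measurable_fun [set: RR] (edge_weight b : RR -> \bar R).
Proof.
apply/(measurable_restrictT _ _).1; first exact: measurable_itv.
by apply: measurable_funTS; apply/measurable_EFinP; exact: measurable_powR.
Qed.

Lemma integral_edge_weight (b : R) : -1 < b ->
  (\int[leb]_t edge_weight b t <= (2 `^ (b + 1) / (b + 1))%:E)%E.
Proof. by move=> b1; rewrite -integral_mkcond; exact: integral_powR_bound. Qed.

(** Put c = sqrt (1 - x^2), so that 1 - x^2 - y^2 = (c - y) (c + y). One factor is at least c >=
    1/2 and only the other one is singular. The bound does not depend on x because the chord
    keeps length at least 1, which is what |x| <= 3/4 is for. *)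
Lemma integral_chord (b x : R) (h : RR -> \bar R) : -1 < b -> b < 0 -> `|x| <= 3 / 4 ->
  measurable_fun setT h ->
  (forall y, 0 <= h y)%E ->
  (forall y, x ^+ 2 + y ^+ 2 < 1 -> (h y <= ((1 - x ^+ 2 - y ^+ 2) `^ b)%:E)%E) ->
  (forall y, 1 <= x ^+ 2 + y ^+ 2 -> h y = 0%E) ->
  (\int[leb]_y h y <= (2 * (2^-1 `^ b * (2 `^ (b + 1) / (b + 1))))%:E)%E.
Proof.
move=> b1 b0 x34 mh h0 hle hout.
have x2 : x ^+ 2 <= 9 / 16.
  by move: x34; rewrite ler_norml => /andP[? ?]; nra.
pose c := Num.sqrt (1 - x ^+ 2).
have c2 : c ^+ 2 = 1 - x ^+ 2 by rewrite sqr_sqrtr//; lra.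
have c_ge0 : 0 <= c by exact: sqrtr_ge0.
have c12 : 2^-1 <= c by nra.
have c1 : c <= 1 by nra.
have mb1 : measurable_fun setT (fun y : RR => edge_weight b ((-1) * y + c)).
  by apply: (measurableT_comp (measurable_edge_weight b)); exact: measurable_affine.
have mb2 : measurable_fun setT (fun y : RR => edge_weight b (1 * y + c)).
  by apply: (measurableT_comp (measurable_edge_weight b)); exact: measurable_affine.
have k0 : (0 <= (2^-1 `^ b)%:E :> \bar R)%E by rewrite lee_fin powR_ge0.
apply: (@le_trans _ _ (\int[leb]_y ((2^-1 `^ b)%:E * (edge_weight b ((-1) *
  y + c)%R + edge_weight b (1 * y + c)%R)))%E).
  apply: ge0_le_integral => //.
  - by apply: emeasurable_funM => //; exact: emeasurable_funD.
  move=> y _; have [y1|y1] := ltP (x ^+ 2 + y ^+ 2) 1; last first.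
    by rewrite hout// mule_ge0// adde_ge0// edge_weight_ge0.
  apply: (le_trans (hle _ y1)).
  have P t : 0 < t -> t <= 2 -> edge_weight b t = (t `^ b)%:E.
    by move=> t0 t2; rewrite /edge_weight patchE mem_set//= in_itv/= t0.
  have [yn|yp] := leP y 0.
    have yc : 0 < 1 * y + c by nra.
    apply: (@le_trans _ _ ((2^-1 `^ b)%:E * (edge_weight b (1 * y + c)%R))%E).
      rewrite P//; last by nra.
      rewrite -EFinM lee_fin -powRM ?(ltW yc)//.
      by apply: powR_anti => //; [rewrite mulr_gt0|lra || nra].
    by rewrite lee_wpmul2l// leeDr// edge_weight_ge0.
  have yc : 0 < (-1) * y + c by nra.
  apply: (@le_trans _ _ ((2^-1 `^ b)%:E * (edge_weight b ((-1) * y + c)%R))%E).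
    rewrite P//; last by nra.
    rewrite -EFinM lee_fin -powRM ?(ltW yc)//.
    by apply: powR_anti => //; [rewrite mulr_gt0|lra || nra].
  by rewrite lee_wpmul2l// leeDl// edge_weight_ge0.
rewrite ge0_integralZl//; last 2 first.
- exact: emeasurable_funD.
- by move=> y _; rewrite adde_ge0// edge_weight_ge0.
rewrite ge0_integralD//; last 2 first.
- by move=> y _; exact: edge_weight_ge0.
- by move=> y _; exact: edge_weight_ge0.
have N1 : (-1 : R) != 0 by rewrite oppr_eq0 oner_eq0.
have E1 := @integral_affine R (-1) c _ N1 (measurable_edge_weight b) (edge_weight_ge0 b).
have E2 := @integral_affine R 1 c _ (oner_neq0 _) (measurable_edge_weight b) (edge_weight_ge0 b).
rewrite normrN normr1 mul1e in E1; rewrite normr1 mul1e in E2.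
rewrite -E1 -E2 mulrCA EFinM; apply: lee_wpmul2l; first exact: k0.
by rewrite mulr2n mulrDl mul1r EFinD; apply: leeD; exact: integral_edge_weight.
Qed.

End boundary_singularity.

Section disk_weight.
Variable R : realType.
Local Notation leb := (@lebesgue_measure R).
Local Notation RR := (measurableTypeR R).
Local Notation leb2 := (@plane_measure R).

Definition disk_weight (b : R) (z : C R) : R := if normc z < 1 then (1 - normc z ^+ 2) `^ b else 0.

Lemma disk_weight_ge0 b z : 0 <= disk_weight b z.
Proof. by rewrite /disk_weight; case: ifPn => // _; exact: powR_ge0. Qed.

Lemma measurable_disk_weight d (T : measurableType d) (b : R) (f : T -> C R) : cmeasurable f ->
  measurable_fun setT (fun t => disk_weight b (f t) : RR).
Proof.
move=> mf; apply: measurable_fun_ifT.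
- by apply: measurable_fun_ltr => //; exact: measurable_normc.
- apply: (measurableT_comp (measurable_powR _)); apply: measurable_funB => //.
  exact: measurable_normc2.
- exact: measurable_cst.
Qed.

Lemma integral_bounded_support (M : R) (h : RR -> \bar R) : (forall x, (0 <= h x)%E) ->
    measurable_fun setT h -> 0 <= M ->
  (forall x, (h x <= M%:E)%E) -> (forall x, 1 < `|x| -> h x = 0%E) ->
  (\int[leb]_x h x <= (2 * M)%:E)%E.
Proof.
move=> h0 mh M0 hM hout.
apply: (@le_trans _ _ (\int[leb]_x (M%:E * (\1_(`[(-1)%R, 1%R]%classic) x)%:E))%E).
  apply: ge0_le_integral => //.
  - by apply: emeasurable_funM => //; apply/measurable_EFinP; apply: measurable_indic.
  move=> x _; rewrite indicE; have [|/negP] := boolP (x \in _).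
    by rewrite mule1.
  rewrite inE/= in_itv/= -ler_norml => /negP; rewrite -ltNge => x1.
  by rewrite hout// mule0.
rewrite ge0_integralZl//; last by apply/measurable_EFinP; apply: measurable_indic.
have L : leb `[(-1)%R, 1%R]%classic = 2%:E.
  rewrite lebesgue_measure_itv/= lte_fin.
  have -> : (-1 < 1 :> R) by lra.
  by rewrite -EFinB; congr EFin; lra.
have -> : (\int[leb]_x (\1_(`[(-1)%R, 1%R]%classic) x)%:E = 2%:E)%E.
  by rewrite integral_indic// setIT; exact: L.
by rewrite -EFinM lee_fin mulrC.
Qed.

(** In the disk |x| or |y| is at most 3/4, since 2 (3/4)^2 > 1. Each of the two regions is
    integrated first along its long chords. *)
Lemma disk_weight_integral (b : R) : -1 < b -> b < 0 ->
  (integralC (fun z => (disk_weight b z)%:E) < +oo)%E.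
Proof.
move=> b1 b0.
pose M := 2 * (2^-1 `^ b * (2 `^ (b + 1) / (b + 1))) : R.
have M0 : 0 <= M.
  rewrite /M mulr_ge0// mulr_ge0 ?powR_ge0// divr_ge0 ?powR_ge0//.
  by rewrite -lerBlDr sub0r ltW.
pose g (p : RR * RR) : \bar R := (disk_weight b (toC p))%:E.
have mg : measurable_fun setT g.
  by apply/measurable_EFinP; apply: measurable_disk_weight; exact: cmeasurable_toC.
have g0 p : (0 <= g p)%E by rewrite lee_fin disk_weight_ge0.
have nE (x y : R) : normc (toC (x, y)) ^+ 2 = x ^+ 2 + y ^+ 2 by rewrite normc2E.
have gE (x y : R) : x ^+ 2 + y ^+ 2 < 1 -> g (x, y) = ((1 - x ^+ 2 - y ^+ 2) `^ b)%:E.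
  move=> xy; rewrite /g /disk_weight.
  have -> : normc (toC (x, y)) < 1.
    by rewrite -(@ltr_pXn2r _ 2)// ?nnegrE ?normcC_ge0// expr1n nE.
  by rewrite nE opprD addrA.
have gout (x y : R) : 1 <= x ^+ 2 + y ^+ 2 -> g (x, y) = 0%E.
  move=> xy; rewrite /g /disk_weight ltNge.
  have -> // : 1 <= normc (toC (x, y)).
  by rewrite -(@ler_pXn2r _ 2)// ?nnegrE ?normcC_ge0// expr1n nE.
pose B := `[(- (3 / 4))%R, (3 / 4)%R]%classic : set RR.
pose g1 (p : RR * RR) := (g p * (\1_B p.1)%:E)%E.
pose g2 (p : RR * RR) := (g p * (\1_(~` B) p.1)%:E)%E.
have mB : measurable B by exact: measurable_itv.
have mi (A : set RR) : measurable A ->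
  measurable_fun setT (fun p : RR * RR => (\1_A p.1)%:E : \bar R).
  by move=> mA; apply/measurable_EFinP; apply: (measurableT_comp _ measurable_fst);
    exact: measurable_indic.
have mg1 : measurable_fun setT g1 by apply: emeasurable_funM => //; exact: mi.
have mg2 : measurable_fun setT g2.
  by apply: emeasurable_funM => //; apply: mi; exact: measurableC.
have g10 p : (0 <= g1 p)%E by rewrite mule_ge0// lee_fin.
have g20 p : (0 <= g2 p)%E by rewrite mule_ge0// lee_fin.
rewrite /integralC (eq_integral (fun p => g1 p + g2 p)%E); last first.
  move=> p _; rewrite /g1 /g2 -/(g p) !indicE in_setC.
  by case: (_ \in B); rewrite /= mule0 mule1 ?adde0 ?add0e.
rewrite ge0_integralD//; apply: lte_add_pinfty.
  apply: (@le_lt_trans _ _ (2 * M)%:E); last exact: ltry.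
  rewrite (plane_tonelli1 mg1)//.
  apply: integral_bounded_support => //.
  - by move=> x; exact: integral_ge0.
  - exact: (measurable_fun_fubini_tonelli_F _ mg1).
  - move=> x; have := measurable_fun_pair2 x mg1.
    rewrite /g1/= indicE; move=> mx; move: mx; case: (boolP (x \in B)) => [xB|_] mx; last first.
      by rewrite integral0_eq// => y _; rewrite mule0.
    apply: (@integral_chord _ b x) => //.
    + by move: xB; rewrite inE /B/= in_itv/= ler_norml.
    + by move=> y; rewrite mule_ge0.
    + by move=> y xy; rewrite mule1 gE.
    + by move=> y xy; rewrite gout// mul0e.
  - move=> x x1; rewrite integral0_eq// => y _; rewrite /g1 gout ?mul0e//.
    rewrite ler_wpDr ?sqr_ge0// -real_normK ?num_real// exprn_ege1//; exact: ltW.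
apply: (@le_lt_trans _ _ (2 * M)%:E); last exact: ltry.
rewrite (plane_tonelli2 mg2)//.
apply: integral_bounded_support => //.
- by move=> x; exact: integral_ge0.
- exact: (measurable_fun_fubini_tonelli_G _ mg2).
- move=> y; have [y34|y34] := leP `|y| (3 / 4).
    apply: (@integral_chord _ b y) => //.
    + exact: (measurable_fun_pair1 y mg2).
    + move=> x yx; rewrite /g2 indicE/= -[leRHS]mule1.
      have xy : x ^+ 2 + y ^+ 2 < 1 by rewrite addrC.
      rewrite gE// (_ : 1 - x ^+ 2 - y ^+ 2 = 1 - y ^+ 2 - x ^+ 2); last by ring.
      by rewrite lee_wpmul2l// ?lee_fin ?powR_ge0//; case: (_ \in _).
    + by move=> x yx; rewrite /g2 gout ?mul0e// addrC.
  rewrite integral0_eq ?lee_fin// => x _; rewrite /g2 /= indicE in_setC.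
  have [xB|] := boolP (x \in B); first by rewrite mule0.
  rewrite notin_setE /B/= in_itv/= -ler_norml => /negP; rewrite -ltNge => x34.
  rewrite gout ?mul0e// -(real_normK (num_real x)) -(real_normK (num_real y)).
  nra.
- move=> y y1; rewrite integral0_eq// => x _; rewrite /g2 gout ?mul0e//.
  rewrite ler_wpDl ?sqr_ge0// -(real_normK (num_real y)) exprn_ege1//; exact: ltW.
Qed.

End disk_weight.

(** * Freeness and cocompactness of the action *)

Section group.
Variables (R : realType) (G : aut_subgroup R).
Implicit Types (z w : C R) (g : disk R -> disk R).

Definition mkdisk z (h : normc z < 1) : disk R := exist _ z (mem_set ((unit_diskP z).2 h)).

Lemma mkdiskK z (h : normc z < 1) : \val (mkdisk h) = z.
Proof. by []. Qed.

Lemma disk_inj (x y : disk R) : \val x = \val y -> x = y.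
Proof. exact: val_inj. Qed.

Lemma disk_openP (W : set (disk R)) : open W <->
  forall x, W x -> exists2 e : R, 0 < e & forall y, normc (\val y - \val x) < e -> W y.
Proof.
split.
  move=> [A oA <-] x Ax.
  have := open_nbhs_nbhs (conj oA Ax : open_nbhs _ _).
  move=> /nbhs_normP [e /= e0 eA].
  have eE : e = (normc e)%:C%C by rewrite -norm_normc gtr0_norm.
  exists (normc e); first by rewrite -ltcR -eE.
  move=> y ye; apply: eA; rewrite /ball_ /= distrC norm_normc eE ltcR; exact: ye.
move=> H.
pose A := [set c : C R | exists x e, [/\ W x, normc (c - \val x) < e &
  forall y : disk R, normc (\val y - \val x) < e -> W y]].
exists A; last first.
  apply/seteqP; split => y /=; first by move=> [x [e [_ h1 h2]]]; exact: h2.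
  move=> Wy; have [e e0 h] := H y Wy; exists y, e; split => //.
  by rewrite subrr normcC0.
rewrite openE => c [x [e [Wx h1 h2]]].
apply/nbhs_normP; exists ((e - normc (c - \val x))%:C%C : C R).
  by rewrite /= -[0]/((0 : R)%:C%C) ltcR subr_gt0.
move=> d; rewrite /ball_ /= norm_normc ltcR => dc.
exists x, e; split => //.
have -> : d - \val x = (c - \val x) + - (c - d) by ring.
apply: (le_lt_trans (normc_triangle _ _)); rewrite normcN.
by rewrite -ltrBrDl.
Qed.

Lemma mob_lipschitz (a b : C R) z w : su11 a b -> normc z < 1 -> normc w < 1 ->
  normc (mob a b w - mob a b z) <= normc (w - z) / ((1 - normc z) * (1 - normc w)).
Proof.
move=> sab z1 w1; rewrite mob_sub// normcM normcV normcM.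
rewrite ler_wpM2l ?normcC_ge0// lef_pV2 ?posrE ?mulr_gt0 ?den_gt0 ?subr_gt0//.
have a1 := su11_ge1 sab.
have z0 : 0 <= 1 - normc z by rewrite subr_ge0 ltW.
have w0 : 0 <= 1 - normc w by rewrite subr_ge0 ltW.
apply: ler_pM => //.
  by apply: le_trans (den_lower sab z1); rewrite ler_peMl.
by apply: le_trans (den_lower sab w1); rewrite ler_peMl.
Qed.

(** The modulus of continuity is the same for all of SU(1,1), because |a| >= 1. *)
Lemma mob_equicontinuous z (e : R) : normc z < 1 -> 0 < e -> exists2 d : R, 0 < d &
  forall (a b : C R) w, su11 a b -> normc w < 1 -> normc (w - z) < d ->
    normc (mob a b w - mob a b z) < e.
Proof.
move=> z1 e0; pose s := 1 - normc z.
have s0 : 0 < s by rewrite subr_gt0.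
exists (Num.min (s / 2) (e * s ^+ 2 / 2)).
  by rewrite lt_min !divr_gt0 ?mulr_gt0 ?exprn_gt0.
move=> a b w sab w1; rewrite lt_min => /andP[d1 d2].
apply: (le_lt_trans (mob_lipschitz sab z1 w1)).
have ws : s / 2 <= 1 - normc w.
  have := normc_triangle (w - z) z; rewrite subrK /s; rewrite /s in d1; lra.
rewrite ltr_pdivrMr ?mulr_gt0 ?subr_gt0// -/s.
apply: (lt_le_trans d2); rewrite -subr_ge0.
rewrite (_ : _ - _ = e * s * ((1 - normc w) - s / 2)); last by field.
by apply: mulr_ge0; rewrite ?subr_ge0 ?mulr_ge0// ltW.
Qed.

Lemma aut_matrix g : aut_set G g -> exists a b, su11 a b /\ moebius_of a b g.
Proof. by move=> /aut_setP. Qed.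

Lemma Sigma_projP (x y : disk R) : Sigma_proj G x = Sigma_proj G y <-> exists2 g, aut_set G g &
    y = g x.
Proof.
split; first by move=> /eqquotP/asboolP.
by move=> H; apply/eqquotP/asboolP.
Qed.

Lemma Omega_projP (p q : disk R * disk R) : Omega_proj G p = Omega_proj G q <->
  exists2 g, aut_set G g & q = (g p.1, g p.2).
Proof.
split; first by move=> /eqquotP/asboolP.
by move=> H; apply/eqquotP/asboolP.
Qed.

Section covering.
Hypothesis hcover : covering_map (Sigma_proj G).

(** A sheet of the covering around x0 contains at most one point of each orbit. *)
Lemma covering_local_inj (x0 : disk R) : exists2 e : R, 0 < e &
  forall (x : disk R) g, aut_set G g -> normc (\val x - \val x0) < e ->
    normc (\val (g x) - \val x0) < e -> g x = x.
Proof.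
have [_ /(_ (Sigma_proj G x0))[V [oV Vx [I [U [oU tU pU sU]]]]]] := hcover.
have : (\bigcup_i U i) x0 by rewrite -pU.
move=> [i _ Ui].
have [e e0 he] := (disk_openP (U i)).1 (oU i) _ Ui.
exists e => // x g Gg hx hgx.
have [[_ inj _] _] := sU i.
have E : Sigma_proj G x = Sigma_proj G (g x) by apply/Sigma_projP; exists g.
by apply/esym/(inj _ _ _ _ E); rewrite inE; exact: he.
Qed.

Lemma small_real_shift z (d : R) : normc z < 1 -> 0 < d -> exists2 t : R, 0 < t &
  [/\ t < d, normc (z + t%:C%C) < 1 & normc (z - t%:C%C) < 1].
Proof.
move=> z1 d0; pose t := Num.min (d / 2) ((1 - normc z) / 2).
have t0 : 0 < t by rewrite lt_min !divr_gt0// subr_gt0.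
have nt : normc (t%:C%C : C R) = t.
  by rewrite /normc /= expr0n addr0 sqrtr_sqr gtr0_norm.
have tz : t <= (1 - normc z) / 2 by rewrite ge_min lexx orbT.
have td : t <= d / 2 by rewrite ge_min lexx.
exists t => //; split; first by lra.
  by apply: (le_lt_trans (normc_triangle _ _)); rewrite nt; lra.
by apply: (le_lt_trans (normc_triangle _ _)); rewrite normcN nt; lra.
Qed.

Lemma normc_real (t : R) : 0 <= t -> normc (t%:C%C : C R) = t.
Proof. by move=> t0; rewrite /normc /= expr0n addr0 sqrtr_sqr ger0_norm. Qed.

(** By local injectivity an element that fixes x0 fixes all nearby points. They are roots of b^*
    z^2 + (a^* - a) z - b, and the three points z, z + t, z - t suffice to make its coefficients
    vanish. *)
Lemma free_action g (x0 : disk R) : aut_set G g -> g x0 = x0 -> forall x, g x = x.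
Proof.
move=> Gg gx0.
have [a [b [sab mg]]] := aut_matrix Gg.
have [e e0 he] := covering_local_inj x0.
have [d d0 hd] := mob_equicontinuous (disk_lt1 x0) e0.
have fix_near (w : C R) : normc w < 1 -> normc (w - \val x0) < Num.min d e ->
  a * w + b = w * (b^* * w + a^*).
  move=> w1; rewrite lt_min => /andP[wd we].
  have E : g (mkdisk w1) = mkdisk w1.
    apply: he => //.
    have -> : \val x0 = mob a b (\val x0) by rewrite -(moebius_ofE x0 mg) gx0.
    by rewrite (moebius_ofE _ mg); exact: hd.
  have := congr1 (fun x : disk R => \val x) E; rewrite (moebius_ofE _ mg) mkdiskK /mob => {}E.
  by rewrite -{2}E mulfVK// den_neq0.
have de0 : 0 < Num.min d e by rewrite lt_min d0.
have [t t0 [td h1 h2]] := small_real_shift (disk_lt1 x0) de0.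
set z := \val x0 in h1 h2 fix_near.
have q0 : a * z + b = z * (b^* * z + a^*).
  by apply: fix_near; rewrite ?disk_lt1// subrr normcC0.
have q1 := fix_near _ h1; have q2 := fix_near _ h2.
have {}q1 := q1 ltac:(by rewrite addrAC subrr add0r normc_real// ltW).
have {}q2 := q2 ltac:(by rewrite addrAC subrr add0r normcN normc_real// ltW).
have tn : (t%:C%C : C R) != 0.
  by rewrite -normc_eq0 normc_real ?gt_eqF// ltW.
move: q1 q2 tn; set s : C R := t%:C%C => q1 q2 tn.
have bs : b^* * (2 * s ^+ 2) = 0.
  have -> : b^* * (2 * s ^+ 2) = ((z + s) * (b^* * (z + s) + a^*) - (a * (z + s) + b)) +
    ((z - s) * (b^* * (z - s) + a^*) - (a * (z - s) + b)) - 2 * (z * (b^* * z + a^*) - (a * z + b)).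
    by ring.
  by rewrite q1 q2 q0 !subrr mulr0 subr0 addr0.
have b0 : b^* = 0.
  move/eqP: bs; rewrite mulf_eq0 => /orP[/eqP//|].
  by rewrite mulf_eq0 sqrf_eq0 (negbTE tn) pnatr_eq0.
have as0 : (a^* - a) * s = 0.
  have -> : (a^* - a) * s = ((z + s) * (b^* * (z + s) + a^*) - (a * (z + s) + b)) -
     (z * (b^* * z + a^*) - (a * z + b)) by rewrite b0; ring.
  by rewrite q1 q0 !subrr.
have aa : a^* = a.
  by move/eqP: as0; rewrite mulf_eq0 (negbTE tn) orbF subr_eq0 => /eqP.
have bb : b = 0 by apply/eqP; rewrite -conjC_eq0 b0.
move=> x; apply: disk_inj; rewrite (moebius_ofE _ mg) /mob /den b0 aa bb mul0r add0r addr0.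
by rewrite mulrAC mulfV ?mul1r// (su11_a_neq0 sab).
Qed.

Lemma free_action_eq g h (x0 : disk R) : aut_set G g -> aut_set G h -> g x0 = h x0 -> g = h.
Proof.
move=> Gg Gh E; have [k Gk [hK kK]] := aut_set_inv Gh.
have := @free_action (k \o g) x0 (aut_set_comp Gk Gg) _.
rewrite /= E hK => /(_ erefl) H.
by apply/funext => x; rewrite -[RHS](congr1 h (H x)) /= kK.
Qed.

End covering.

(** The disks of radii 1 - 1/(n + 1) have open increasing images that cover the compact
    quotient. *)
Lemma cocompact : compact [set: Sigma G] -> exists2 r : R, 0 <= r < 1 &
  forall x : disk R, exists2 g, aut_set G g & normc (\val (g x)) < r.
Proof.
move=> /compact_near_coveringP hc.
pose r (n : nat) : R := 1 - n.+1%:R^-1.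
pose f (n : nat) : set (Sigma G) := [set y | exists2 x, y = Sigma_proj G x & normc (\val x) < r n].
have r1 n : r n < 1 by rewrite /r ltrBlDr ltrDl invr_gt0.
have r0 n : 0 <= r n by rewrite /r subr_ge0 invf_le1// ler1n.
have of_ n : setT n -> open (f n).
  move=> _; rewrite /open /= /quotient_open.
  apply/disk_openP => x [x1 xx1 hx1].
  have [g Gg gx] := (Sigma_projP _ _).1 xx1.
  have [a [b [sab mg]]] := aut_matrix Gg.
  have e0 : 0 < r n - normc (\val x1) by rewrite subr_gt0.
  have [d d0 hd] := mob_equicontinuous (disk_lt1 x) e0.
  exists d => // y yd; exists (g y).
    by apply/Sigma_projP; exists g.
  have := hd a b _ sab (disk_lt1 y) yd; rewrite -!(moebius_ofE _ mg) -gx => H.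
  rewrite -(subrK (\val x1) (\val (g y))).
  by apply: (le_lt_trans (normc_triangle _ _)); rewrite -ltrBrDr.
have cov (y : Sigma G) : exists n, f n y.
  pose x : disk R := repr y.
  have yE : y = Sigma_proj G x by rewrite /x /Sigma_proj reprK.
  have x1 : 0 < 1 - normc (\val x) by rewrite subr_gt0 disk_lt1.
  exists (Num.bound (1 - normc (\val x))^-1) => //; exists x => //.
  rewrite /r ltrBrDl -ltrBrDr -[ltRHS]invrK ltf_pV2 ?posrE ?invr_gt0//.
  have x1' : 0 <= (1 - normc (\val x))^-1 by rewrite invr_ge0 ltW.
  apply: (lt_trans (archi_boundP x1')).
  by rewrite ltr_nat.
have f_le m n y : (m <= n)%N -> f m y -> f n y.
  move=> mn [x yx hx]; exists x => //; apply: (lt_le_trans hx).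
  by rewrite /r lerD2l lerN2 lef_pV2 ?posrE// ler_nat.
have [|N _ hN] := hc nat \oo f _.
  move=> y _; have [n fny] := cov y.
  exists (f n, [set m | (n <= m)%N]).
    by split; [exact: (open_nbhs_nbhs (conj (of_ n I) fny))|exists n].
  by move=> [y' m] /= [h1 h2]; exact: f_le h2 h1.
exists (r N); first by rewrite r0 r1.
move=> x; have [x1 xx1 hx1] := hN N (leqnn N) (Sigma_proj G x) I.
have [g Gg gx] := (Sigma_projP _ _).1 xx1.
by exists g => //; rewrite -gx.
Qed.

End group.

(** * The group is countably infinite *)

Section enumeration.
Variables (R : realType) (G : aut_subgroup R).
Hypothesis hcover : covering_map (Sigma_proj G).
Hypothesis hcompact : compact [set: Sigma G].
Implicit Types (z w : C R) (g : disk R -> disk R).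

Lemma normcC0_lt1 : normc (0 : C R) < 1.
Proof. by rewrite normcC0. Qed.

Let o : disk R := mkdisk normcC0_lt1.

(** Freeness in uniform form: distinct elements move a small disk around the origin to disjoint
    sets. Countability, the packing bound and the nonvanishing of the series rest on it. *)
Lemma separated_orbit : exists2 e : R, 0 < e & forall g h (x y : disk R),
  aut_set G g -> aut_set G h -> normc (\val x) < e -> normc (\val y) < e ->
  g x = h y -> g = h.
Proof.
have [e e0 he] := covering_local_inj hcover o.
exists e => // g h x y Gg Gh xe ye E.
have [k Gk [hK kK]] := aut_set_inv Gh.
have kgx : k (g x) = y by rewrite E hK.
have H : (k \o g) x = x.
  by apply: he; rewrite /= ?kgx ?mkdiskK ?subr0//; exact: aut_set_comp.
by apply: (free_action_eq hcover (x0 := x)) => //; rewrite E -[in RHS]H /= kgx.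
Qed.

Lemma rat_approx z (e : R) : 0 < e -> exists q : rat * rat,
  normc ((ratr q.1 +i* ratr q.2)%C - z) < e.
Proof.
move=> e0; case: z => x y.
have xe : x < x + e / 2 by rewrite ltrDl divr_gt0.
have ye : y < y + e / 2 by rewrite ltrDl divr_gt0.
have [p hp] := rat_in_itvoo xe; have [q hq] := rat_in_itvoo ye.
exists (p, q) => /=; move: hp hq; rewrite !in_itv/= => /andP[p1 p2] /andP[q1 q2].
rewrite -(@ltr_pXn2r _ 2)// ?nnegrE ?normcC_ge0 ?ltW// normc2E /=.
move: p1 p2 q1 q2; move: (ratr p) (ratr q) => {p q} p q p1 p2 q1 q2.
have h1 : (p - x) ^+ 2 < e ^+ 2 / 4.
  rewrite (_ : e ^+ 2 / 4 = (e / 2) ^+ 2); last by field.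
  by rewrite ltr_pXn2r// ?nnegrE; lra.
have h2 : (q - y) ^+ 2 < e ^+ 2 / 4.
  rewrite (_ : e ^+ 2 / 4 = (e / 2) ^+ 2); last by field.
  by rewrite ltr_pXn2r// ?nnegrE; lra.
nra.
Qed.

(** Disjoint open translates of a small disk contain distinct rational points. *)
Lemma aut_countable : countable (aut_set G).
Proof.
have [e e0 he] := separated_orbit.
have H g : exists q : rat * rat, aut_set G g ->
    exists2 x : disk R, normc (\val x) < e & \val (g x) = (ratr q.1 +i* ratr q.2)%C.
  have [Gg|nG] := pselect (aut_set G g); last by exists (0, 0).
  have [k Gk [gK kK]] := aut_set_inv Gg.
  have [c [d [sk mk]]] := aut_matrix Gk.
  have [s s0 hs] := mob_equicontinuous (disk_lt1 (g o)) e0.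
  have t0 : 0 < Num.min s (1 - normc (\val (g o))) by rewrite lt_min s0 subr_gt0 disk_lt1.
  have [q hq] := rat_approx (\val (g o)) t0.
  exists q => _; move: hq; set w : C R := (_ +i* _)%C; rewrite lt_min => /andP[h1 h2].
  have w1 : normc w < 1.
    rewrite -(subrK (\val (g o)) w); apply: (le_lt_trans (normc_triangle _ _)).
    by rewrite -ltrBrDr.
  exists (k (mkdisk w1)); last by rewrite kK mkdiskK.
  have := hs c d w sk w1 h1; rewrite -(moebius_ofE (g o) mk) gK.
  by rewrite -{1}(mkdiskK w1) -(moebius_ofE (mkdisk w1) mk) subr0.
have [f hf] := choice H.
apply/countable_injP; exists (fun g => pickle (f g)) => g h.
rewrite !inE => Gg Gh /(pcan_inj pickleK) E.
have [x xe gx] := hf g Gg; have [y ye hy] := hf h Gh.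
apply: (he _ _ x y) => //; apply: disk_inj.
by rewrite gx hy E.
Qed.

(** In a finite group |a| is bounded, so that points close to the circle stay close to the
    circle, against cocompactness. *)
Lemma aut_infinite : ~ finite_set (aut_set G).
Proof.
move=> finG.
have [r /andP[r0 r1] hr] := cocompact hcompact.
have H g : exists ab : C R * C R, aut_set G g -> su11 ab.1 ab.2 /\ moebius_of ab.1 ab.2 g.
  have [Gg|nG] := pselect (aut_set G g); last by exists (0, 0).
  by have [a [b ab]] := aut_matrix Gg; exists (a, b).
have [f hf] := choice H.
have [s sE] := (finite_seqP _).1 (finite_image (fun g => normc (f g).1) finG).
pose M := 1 + \sum_(x <- s) `|x|.
have hM g : aut_set G g -> normc (f g).1 <= M.
  move=> Gg; have : ((fun g => normc (f g).1) @` aut_set G) (normc (f g).1) by exists g.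
  rewrite sE /= => gs; rewrite /M (big_rem _ gs)/= ger0_norm ?normcC_ge0//.
  by rewrite addrCA lerDl addr_ge0// sumr_ge0.
have M1 : 1 <= M by rewrite /M lerDl sumr_ge0.
(* chosen so that an element with |a| <= M moves 1 - t to a point of modulus greater than r *)
pose t := (1 - r ^+ 2) / (8 * M ^+ 2).
have r2 : 0 < 1 - r ^+ 2 by rewrite subr_gt0 exprn_ilt1.
have M2 : 1 <= M ^+ 2 by rewrite exprn_ege1.
have t0 : 0 < t by rewrite divr_gt0// mulr_gt0// (lt_le_trans ltr01).
have t1 : t < 1.
  rewrite /t ltr_pdivrMr; last by rewrite mulr_gt0// (lt_le_trans ltr01).
  have := sqr_ge0 r; lra.
have tM : t * (8 * M ^+ 2) = 1 - r ^+ 2.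
  by rewrite /t mulfVK// gt_eqF// mulr_gt0// (lt_le_trans ltr01).
have nz : normc ((1 - t)%:C%C : C R) = 1 - t by rewrite normc_real// subr_ge0 ltW.
have z1 : normc ((1 - t)%:C%C : C R) < 1 by rewrite nz; lra.
have [g Gg hg] := hr (mkdisk z1).
have [sab mg] := hf g Gg; have := hM g Gg.
move: sab mg hg; case: (f g) => a b /= sab mg.
rewrite (moebius_ofE _ mg) mkdiskK => hg aM.
have g2 : normc (mob a b (1 - t)%:C%C) ^+ 2 < r ^+ 2.
  by rewrite ltr_pXn2r ?nnegrE ?normcC_ge0.
have := one_sub_mob2 sab z1; rewrite nz => E.
have dlow : (2 * M)^-1 <= normc (den a b (1 - t)%:C%C).
  apply: (@le_trans _ _ (normc a - normc b)).
    have ab := su11_normc sab; have a1 := su11_ge1 sab; have ba := su11_le sab.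
    have b0 := normcC_ge0 b.
    rewrite -div1r ler_pdivrMr; last by lra.
    have : 0 <= (normc a - normc b) * (2 * M - (normc a + normc b)).
      by apply: mulr_ge0; lra.
    by rewrite mulrBr -subr_sqr ab; lra.
  rewrite /den [X in _ <= normc X]addrC; apply: le_trans (normc_sub_ge _ _).
  rewrite normcM !normcCJ nz lerD2l lerN2 ler_piMr ?normcC_ge0//; lra.
have d0 : 0 < normc (den a b (1 - t)%:C%C) by exact: den_gt0.
move: E dlow d0; set D := normc (den _ _ _) => E dlow d0.
have D2 : D ^+ 2 * (1 - normc (mob a b (1 - t)%:C%C) ^+ 2) = 1 - (1 - t) ^+ 2.
  by rewrite E mulrC mulfVK// sqrf_eq0 gt_eqF.
have D4 : (4 * M ^+ 2)^-1 <= D ^+ 2.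
  have -> : (4 * M ^+ 2)^-1 = ((2 * M)^-1) ^+ 2 by field; rewrite gt_eqF; lra.
  by rewrite ler_pXn2r ?nnegrE ?invr_ge0 ?(ltW d0)//; lra.
have M4 : (4 * M ^+ 2)^-1 * (1 - r ^+ 2) = 2 * t.
  by rewrite -tM; field; rewrite gt_eqF; lra.
have : (4 * M ^+ 2)^-1 * (1 - r ^+ 2) < 1 - (1 - t) ^+ 2.
  rewrite -D2; apply: (@le_lt_trans _ _ (D ^+ 2 * (1 - r ^+ 2))).
    by apply: ler_wpM2r D4; exact: ltW.
  by rewrite ltr_pM2l ?exprn_gt0// ltrD2l ltrN2.
rewrite M4; have := sqr_ge0 t; nra.
Qed.

Lemma enumeration : exists (gam : nat -> disk R -> disk R) (A B : nat -> C R),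
  [/\ forall n, aut_set G (gam n), forall g, aut_set G g -> exists n, gam n = g,
      injective gam & forall n, su11 (A n) (B n) /\ moebius_of (A n) (B n) (gam n)].
Proof.
have /card_set_bijP[f [_ finj fsurj]] := eq_card_nat aut_countable aut_infinite.
have H n : exists g : disk R -> disk R, aut_set G g /\ f g = n.
  by have [g Gg fg] := fsurj n I; exists g.
have [gam hgam] := choice H.
have H2 n : exists ab : C R * C R, su11 ab.1 ab.2 /\ moebius_of ab.1 ab.2 (gam n).
  by have [a [b ab]] := aut_matrix (hgam n).1; exists (a, b).
have [ab hab] := choice H2.
exists gam, (fun n => (ab n).1), (fun n => (ab n).2); split => //.
- by move=> n; have [] := hgam n.
- move=> g Gg; exists (f g); apply: finj; rewrite ?inE//.
    by have [] := hgam (f g).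
  by have [] := hgam (f g).
- by move=> n m E; have [_ <-] := hgam n; have [_ <-] := hgam m; rewrite E.
Qed.

End enumeration.

(** * Absolutely convergent series of complex numbers *)

Section csum.
Variable R : realType.
Local Notation cnt := (@counting nat R).
Implicit Types u v : nat -> C R.

(** A series of reals is taken as an integral for the counting measure, so that linearity and
    invariance under permutations come from integration theory. *)
Definition rsum (u : nat -> R) : R := (\int[cnt]_n u n)%R.
Definition csum u : C R := (rsum (fun n => complex.Re (u n)) +i* rsum (fun n =>
    complex.Im (u n)))%C.

Definition abs_sum_le (u : nat -> C R) (M : R) := (\sum_(n <oo) (normc (u n))%:E <= M%:E)%E.

Lemma normRe (z : C R) : `|complex.Re z| <= normc z.
Proof.
rewrite -(@ler_pXn2r _ 2)// ?nnegrE ?normcC_ge0// real_normK ?num_real// normc2E.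
by rewrite lerDl sqr_ge0.
Qed.

Lemma normIm (z : C R) : `|complex.Im z| <= normc z.
Proof.
rewrite -(@ler_pXn2r _ 2)// ?nnegrE ?normcC_ge0// real_normK ?num_real// normc2E.
by rewrite lerDr sqr_ge0.
Qed.

Lemma nat_integrable (f : nat -> R) (M : R) : (\sum_(n <oo) (`|f n|)%:E <= M%:E)%E ->
  cnt.-integrable setT (EFin \o f).
Proof.
move=> H; apply/integrableP; split; first by [].
have P n : (0 <= (`|f n|)%:E)%E by rewrite lee_fin.
have := @ge0_integral_count R (fun n => (`|f n|)%:E) P.
move=> E; rewrite (_ : (\int[cnt]_x `|(EFin \o f) x| = \sum_(n <oo) (`|f n|)%:E)%E); last exact: E.
by apply: le_lt_trans H _; rewrite ltry.
Qed.

Lemma abs_sum_le_Re u M : abs_sum_le u M -> (\sum_(n <oo) (`|complex.Re (u n)|)%:E <= M%:E)%E.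
Proof.
by apply: le_trans; apply: lee_nneseries => n _ //; rewrite lee_fin normRe.
Qed.

Lemma abs_sum_le_Im u M : abs_sum_le u M -> (\sum_(n <oo) (`|complex.Im (u n)|)%:E <= M%:E)%E.
Proof.
by apply: le_trans; apply: lee_nneseries => n _ //; rewrite lee_fin normIm.
Qed.

Lemma csumD u v M M' : abs_sum_le u M -> abs_sum_le v M' ->
    csum (fun n => u n + v n) = csum u + csum v.
Proof.
move=> hu hv.
have iu1 := nat_integrable (abs_sum_le_Re hu); have iv1 := nat_integrable (abs_sum_le_Re hv).
have iu2 := nat_integrable (abs_sum_le_Im hu); have iv2 := nat_integrable (abs_sum_le_Im hv).
apply/eqP; rewrite eq_complex /= /rsum; apply/andP; split; apply/eqP.
  by under eq_Rintegral do rewrite Re_add; rewrite RintegralD.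
by under eq_Rintegral do rewrite Im_add; rewrite RintegralD.
Qed.

Lemma csumZ u M (c : C R) : abs_sum_le u M -> csum (fun n => c * u n) = c * csum u.
Proof.
move=> hu.
have iu1 := nat_integrable (abs_sum_le_Re hu); have iu2 := nat_integrable (abs_sum_le_Im hu).
have Z (k : R) (f : nat -> R) : cnt.-integrable setT (EFin \o f) ->
   cnt.-integrable setT (EFin \o (fun n => k * f n)).
  by move=> fi; exact: (integrableZl measurableT k fi).
apply/eqP; rewrite eq_complex Re_mul Im_mul /= /rsum; apply/andP; split; apply/eqP.
  under eq_Rintegral do rewrite Re_mul.
  by rewrite RintegralB ?Z// !RintegralZl.
under eq_Rintegral do rewrite Im_mul.
by rewrite RintegralD ?Z// !RintegralZl.
Qed.

Lemma rsum_le (f : nat -> R) (M : R) : (\sum_(n <oo) (`|f n|)%:E <= M%:E)%E -> `|rsum f| <= M.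
Proof.
move=> H; have fi := nat_integrable H.
apply: (le_trans (le_normr_Rintegral _ fi)) => //.
rewrite -lee_fin; apply: le_trans H; rewrite /Rintegral.
have P n : (0 <= (`|f n|)%:E)%E by rewrite lee_fin.
have E := @ge0_integral_count R (fun n => (`|f n|)%:E) P.
rewrite [X in (fine X)%:E](_ : _ = \sum_(n <oo) (`|f n|)%:E)%E; last exact: E.
rewrite fineK// -E; have /integrableP[_] := fi.
by move=> h; rewrite ge0_fin_numE// integral_ge0.
Qed.

Lemma normc_le_ReIm (z : C R) : normc z <= `|complex.Re z| + `|complex.Im z|.
Proof.
rewrite -(@ler_pXn2r _ 2)// ?nnegrE ?normcC_ge0// ?addr_ge0// normc2E sqrrD !real_normK ?num_real//.
by rewrite addrAC lerDl mulrn_wge0// mulr_ge0.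
Qed.

(** The real and the imaginary parts are bounded separately, whence the factor 2. *)
Lemma csum_le u M : abs_sum_le u M -> normc (csum u) <= 2 * M.
Proof.
move=> hu; apply: (le_trans (normc_le_ReIm _)); rewrite /= mulrDl mul1r.
by rewrite lerD// rsum_le//; [exact: abs_sum_le_Re|exact: abs_sum_le_Im].
Qed.

Lemma nneseries_perm (s : nat -> nat) (f : nat -> \bar R) : bijective s -> (forall n, 0 <= f n)%E ->
  (\sum_(n <oo) f n = \sum_(n <oo) f (s n))%E.
Proof.
move=> bs f0; rewrite !nneseries_esumT//; apply: reindex_esum.
by rewrite setTT_bijective.
Qed.

Lemma csum_perm u (s : nat -> nat) : bijective s -> csum (fun n => u (s n)) = csum u.
Proof.
move=> bs.
have Hp (h : nat -> \bar R) : (forall n, 0 <= h n)%E ->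
    (\int[cnt]_n h (s n) = \int[cnt]_n h n)%E.
  by move=> h0; rewrite !ge0_integral_count// [RHS](nneseries_perm bs).
have H (f : nat -> R) : rsum (f \o s) = rsum f.
  rewrite /rsum /Rintegral; congr fine; rewrite [LHS]integralE [RHS]integralE.
  congr (_ - _)%E.
    rewrite -(Hp _ (funepos_ge0 (fun n => (f n)%:E))).
    by apply: eq_integral => n _; rewrite !funeposE.
  rewrite -(Hp _ (funeneg_ge0 (fun n => (f n)%:E))).
  by apply: eq_integral => n _; rewrite !funenegE.
by rewrite /csum -(H (fun n => complex.Re (u n))) -(H (fun n => complex.Im (u n))).
Qed.

Lemma nneseries_single (k : nat) (f : nat -> \bar R) : (forall n, n != k -> f n = 0%E) ->
  (forall n, 0 <= f n)%E -> (\sum_(n <oo) f n = f k)%E.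
Proof.
move=> f0 fge; rewrite nneseries_esumT//.
rewrite (esumID [set k])// !setTI esum_set1// esum1 ?adde0//.
by move=> n /= nk; apply: f0; apply/eqP.
Qed.

Lemma abs_sum_le_single (k : nat) (x : C R) : abs_sum_le (fun n =>
    if n == k then x else 0) (normc x).
Proof.
rewrite /abs_sum_le (@nneseries_single k) ?eqxx//.
  by move=> n /negbTE ->; rewrite normcC0.
by move=> n; rewrite lee_fin normcC_ge0.
Qed.

Lemma csum_single (k : nat) (x : C R) : csum (fun n => if n == k then x else 0) = x.
Proof.
have H (t : R) (f : nat -> R) : (forall n, n != k -> f n = 0) -> f k = t -> rsum f = t.
  move=> f0 fk; rewrite /rsum /Rintegral [X in fine X]integralE !ge0_integral_count//.
  rewrite (@nneseries_single k)//; last by move=> n nk; rewrite funeposE /= f0// maxxx.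
  rewrite (@nneseries_single k)//; last by move=> n nk; rewrite funenegE /= f0// oppr0 maxxx.
  rewrite -[RHS]fk -[RHS]/(fine ((fun n => (f n)%:E) k)); congr fine.
  exact: (esym (congr1 (fun g => g k) (funeposneg (fun n => (f n)%:E)))).
apply/eqP; rewrite eq_complex /csum /=; apply/andP; split; apply/eqP.
  by apply: H => [n /negbTE ->|]; rewrite ?eqxx.
by apply: H => [n /negbTE ->|]; rewrite ?eqxx.
Qed.

Lemma abs_sum_le_dominated u v M (c : R) : 0 <= c -> (forall n, normc (u n) <= c * normc (v n)) ->
    abs_sum_le v M -> abs_sum_le u (c * M).
Proof.
move=> c0 uv hv; rewrite /abs_sum_le.
apply: (@le_trans _ _ (\sum_(n <oo) (c%:E * (normc (v n))%:E))%E).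
  apply: lee_nneseries => n _; first by move=> _; rewrite lee_fin normcC_ge0.
  by rewrite -EFinM lee_fin.
rewrite nneseriesZl; last by move=> n _; rewrite lee_fin normcC_ge0.
by rewrite EFinM; apply: lee_wpmul2l => //; rewrite lee_fin.
Qed.

Lemma abs_sum_leD u v M M' : abs_sum_le u M -> abs_sum_le v M' ->
    abs_sum_le (fun n => u n + v n) (M + M').
Proof.
move=> hu hv; rewrite /abs_sum_le.
apply: (@le_trans _ _ (\sum_(n <oo) ((normc (u n))%:E + (normc (v n))%:E))%E).
  apply: lee_nneseries => n _; first by move=> _; rewrite lee_fin normcC_ge0.
  by rewrite -EFinD lee_fin normc_triangle.
rewrite nneseriesD; last 2 first.
- by move=> n _; rewrite lee_fin normcC_ge0.
- by move=> n _; rewrite lee_fin normcC_ge0.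
by rewrite EFinD leeD.
Qed.

End csum.

(** * Holomorphy through second-order expansions *)

Section jets.
Variable R : realType.
Local Notation CC := (C R * C R)%type.
Implicit Types (z w h k : C R).

(** First-order expansion of f at (z0, w0) with a quadratic remainder, valid on a fixed polydisk
    of radius rho. A single constant bounds the value, the slopes and the remainder; in this
    form expansions can be multiplied and summed, and complex differentiability of a series
    reduces to the summability of constants. *)
Definition jet (rho : R) z0 w0 (A : R) (f : C R -> C R -> C R) (al be : C R) : Prop :=
  [/\ normc (f z0 w0) <= A, normc al <= A, normc be <= A &
  forall h k, normc h <= rho -> normc k <= rho ->
    normc (f (z0 + h) (w0 + k) - f z0 w0 - al * h - be * k) <= A * (normc h + normc k) ^+ 2].

Definition lin2 (al be : C R) (p : CC) : C R := al * p.1 + be * p.2.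

Lemma lin2_linear al be : linear (lin2 al be : CC -> (C R : lmodType (C R))).
Proof.
by move=> c [z w] [z' w']; rewrite /lin2 /= /GRing.scale /=; ring.
Qed.

HB.instance Definition _ al be := GRing.isLinear.Build (C R) CC (C R :
  lmodType (C R)) _ (lin2 al be) (lin2_linear al be).

Lemma lin2_continuous al be : continuous (lin2 al be : CC -> C R).
Proof.
move=> p; apply: cvgD; apply: cvgM; try exact: cvg_cst.
  exact: cvg_fst.
exact: cvg_snd.
Qed.

Lemma normc_prod_le (h : CC) : ((normc h.1)%:C%C <= `|h|) /\ ((normc h.2)%:C%C <= `|h|).
Proof.
by rewrite -!norm_normc; split; rewrite [leRHS]/Num.norm /= num_le_max ?lexx ?orbT ?normr_real.
Qed.

Lemma jet_differentiable (rho : R) z0 w0 A f al be : 0 < rho -> 0 <= A ->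
  jet rho z0 w0 A f al be ->
  differentiable (fun p : CC => f p.1 p.2) (z0, w0).
Proof.
move=> rho0 A0 [_ _ _ H].
have E : (fun p : CC => f p.1 p.2) \o shift (z0, w0) =
   cst (f z0 w0) + lin2 al be +o_ (0 : CC) id.
  apply/eqaddoP => e e0.
  have eE : e = (normc e)%:C%C by rewrite -norm_normc gtr0_norm.
  have ne0 : 0 < normc e by rewrite -ltcR -eE.
  have A4 : 0 < 4 * A + 1 by rewrite ltr_wpDl// mulr_ge0.
  pose d := Num.min rho (normc e / (4 * A + 1)).
  have d0 : 0 < d by rewrite lt_min rho0 divr_gt0.
  apply: (proj2 (@nbhs_normP _ CC (0 : CC) _)); exists (d%:C%C : C R);
    first by rewrite /= -[0]/((0 : R)%:C%C) ltcR.
  move=> h; rewrite /ball_ /= sub0r normrN => hd.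
  have [h1 h2] := normc_prod_le h.
  have nhE : `|h| = (normc `|h|)%:C%C by rewrite -norm_normc normr_id.
  move: hd h1 h2; rewrite nhE !lecR ltcR => hd h1 h2.
  have hd1 : normc `|h| < rho by apply: lt_le_trans hd _; rewrite ge_min lexx.
  have hd2 : normc `|h| < normc e / (4 * A + 1).
    by apply: lt_le_trans hd _; rewrite ge_min lexx orbT.
  have nh0 := normcC_ge0 `|h|.
  rewrite norm_normc eE -rmorphM lecR.
  have -> : ((fun p : CC => f p.1 p.2) \o shift (z0, w0) - (cst (f z0 w0) + lin2 al be)) h =
     f (z0 + h.1) (w0 + h.2) - f z0 w0 - al * h.1 - be * h.2.
    rewrite /= !fctE /= /cst /lin2 (addrC h.1) (addrC h.2); ring.
  apply: (le_trans (H _ _ (ltW (le_lt_trans h1 hd1)) (ltW (le_lt_trans h2 hd1)))).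
  apply: (@le_trans _ _ (A * (normc `|h| + normc `|h|) ^+ 2)).
    by rewrite ler_wpM2l// lerXn2r ?nnegrE ?addr_ge0 ?normcC_ge0// lerD.
  have -> : A * (normc `|h| + normc `|h|) ^+ 2 = (4 * A * normc `|h|) * normc `|h| by ring.
  rewrite ler_wpM2r//.
  move: hd2; rewrite ltr_pdivlMr// mulrDr mulr1 mulrC; lra.
have D := diff_unique (@lin2_continuous al be) E.
apply/diff_locallyP; split; rewrite D; first exact: lin2_continuous.
exact: E.
Qed.

(** The three error terms are bounded by 1, 3 and 2 times A A', whence the factor 6. *)
Lemma jet_mul rho z0 w0 A A' f g al be al' be' : 0 <= rho -> rho <= 2^-1 -> 0 <= A -> 0 <= A' ->
  jet rho z0 w0 A f al be -> jet rho z0 w0 A' g al' be' ->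
  jet rho z0 w0 (6 * (A * A')) (fun z w => f z w * g z w)
    (f z0 w0 * al' + al * g z0 w0) (f z0 w0 * be' + be * g z0 w0).
Proof.
move=> rho0 rho2 A0 A'0 [f0 a0 b0 H] [f0' a0' b0' H'].
have AA : 0 <= A * A' by rewrite mulr_ge0.
have pm x y : normc x <= A -> normc y <= A' -> normc (x * y) <= A * A'.
  by move=> hx hy; rewrite normcM ler_pM ?normcC_ge0.
have two x y x' y' : normc x <= A -> normc y <= A' -> normc x' <= A -> normc y' <= A' ->
    normc (x * y + x' * y') <= 6 * (A * A').
  move=> h1 h2 h3 h4; apply: (le_trans (normc_triangle _ _)).
  by have := pm _ _ h1 h2; have := pm _ _ h3 h4; lra.
split; [|exact: two|exact: two|].
  by have := pm _ _ f0 f0'; lra.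
move=> h k hr kr; have h0 := normcC_ge0 h; have k0 := normcC_ge0 k.
have {}H := H h k hr kr; have {}H' := H' h k hr kr.
set s := normc h + normc k in H H' *.
have s0 : 0 <= s by rewrite addr_ge0.
have s1 : s <= 1 by rewrite /s; lra.
set rf := _ - be * k in H; set rg := _ - be' * k in H'.
have hl : normc (al * h + be * k) <= A * s.
  apply: (le_trans (normc_triangle _ _)); rewrite !normcM /s mulrDr lerD// ler_wpM2r//.
have hl' : normc (al' * h + be' * k) <= A' * s.
  apply: (le_trans (normc_triangle _ _)); rewrite !normcM /s mulrDr lerD// ler_wpM2r//.
have ss : s ^+ 2 <= s by rewrite expr2 ler_piMr.
have hg0 : normc (rg + (al' * h + be' * k)) <= 2 * A' * s.
  apply: (le_trans (normc_triangle _ _)).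
  have : A' * s ^+ 2 <= A' * s by rewrite ler_wpM2l.
  lra.
have hg : normc (g z0 w0 + (rg + (al' * h + be' * k))) <= 3 * A'.
  apply: (le_trans (normc_triangle _ _)).
  have : 2 * A' * s <= 2 * A' * 1 by rewrite ler_wpM2l// mulr_ge0.
  lra.
have -> : f (z0 + h) (w0 + k) * g (z0 + h) (w0 + k) - f z0 w0 * g z0 w0 -
    (f z0 w0 * al' + al * g z0 w0) * h - (f z0 w0 * be' + be * g z0 w0) * k =
  f z0 w0 * rg + rf * (g z0 w0 + (rg + (al' * h + be' * k))) +
    (al * h + be * k) * (rg + (al' * h + be' * k)).
  by rewrite /rf /rg; ring.
have t1 : normc (f z0 w0 * rg) <= A * (A' * s ^+ 2).
  by rewrite normcM ler_pM ?normcC_ge0.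
have t2 : normc (rf * (g z0 w0 + (rg + (al' * h + be' * k)))) <= (A * s ^+ 2) * (3 * A').
  by rewrite normcM ler_pM ?normcC_ge0.
have t3 : normc ((al * h + be * k) * (rg + (al' * h + be' * k))) <= (A * s) * (2 * A' * s).
  by rewrite normcM ler_pM ?normcC_ge0.
apply: (le_trans (normc_triangle _ _)).
apply: (le_trans (lerD (normc_triangle _ _) (lexx _))).
have -> : 6 * (A * A') * s ^+ 2 = A * (A' * s ^+ 2) + (A * s ^+ 2) * (3 * A') + (A * s) * (2 * A' *
  s).
  by ring.
by rewrite !lerD.
Qed.

Lemma jet_pow rho z0 w0 A f al be n : 0 <= rho -> rho <= 2^-1 -> 0 <= A ->
  jet rho z0 w0 A f al be -> exists al' be',
  jet rho z0 w0 (6 ^+ n * A ^+ n.+1) (fun z w => f z w ^+ n.+1) al' be'.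
Proof.
move=> rho0 rho2 A0 J; elim: n => [|n [al' [be' IH]]].
  by exists al, be; rewrite expr0 mul1r expr1.
have J2 := jet_mul rho0 rho2 A0 (_ : 0 <= 6 ^+ n * A ^+ n.+1) J IH.
eexists; eexists.
have E : (fun z w => f z w ^+ n.+2) = (fun z w => f z w * f z w ^+ n.+1).
  by apply/funext => z; apply/funext => w; rewrite exprS.
rewrite E (_ : 6 ^+ n.+1 * A ^+ n.+2 = 6 * (A * (6 ^+ n * A ^+ n.+1))); last by rewrite !exprS;
  ring.
apply: J2; by rewrite mulr_ge0 ?exprn_ge0.
Qed.

Lemma jet_weaken rho z w K K' f al be : K <= K' -> jet rho z w K f al be -> jet rho z w K' f al be.
Proof.
move=> KK [h1 h2 h3 H]; split; rewrite ?(le_trans h1)// ?(le_trans h2)// ?(le_trans h3)//.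
move=> h k hr kr; apply: (le_trans (H h k hr kr)).
by rewrite ler_wpM2r// sqr_ge0.
Qed.

(** This plays the part of the Weierstrass theorem on limits of holomorphic functions: the
    expansions of the terms are added. *)
Lemma jet_csum rho z0 w0 (a : nat -> R) M (f : nat -> C R -> C R -> C R) :
  (forall n, exists al be, jet rho z0 w0 (a n) (f n) al be) ->
  (\sum_(n <oo) (a n)%:E <= M%:E)%E -> (forall n, 0 <= a n) ->
  (forall h k, normc h <= rho -> normc k <= rho ->
    exists M', abs_sum_le (fun n => f n (z0 + h) (w0 + k)) M') ->
  exists al be, jet rho z0 w0 (2 * M) (fun z w => csum (fun n => f n z w)) al be.
Proof.
move=> H aM a0 sf.
have H2 n : exists ab : C R * C R, jet rho z0 w0 (a n) (f n) ab.1 ab.2.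
  by have [al [be J]] := H n; exists (al, be).
have [ab hab] := choice H2.
have le_a (u : nat -> C R) (c : R) : 0 <= c -> (forall n, normc (u n) <= c * a n) ->
  abs_sum_le u (c * M).
  move=> c0 ua; rewrite /abs_sum_le.
  apply: (@le_trans _ _ (\sum_(n <oo) (c%:E * (a n)%:E))%E).
    apply: lee_nneseries => n _; first by move=> _; rewrite lee_fin normcC_ge0.
    by rewrite -EFinM lee_fin.
  rewrite nneseriesZl; last by move=> n _; rewrite lee_fin.
  by rewrite EFinM; apply: lee_wpmul2l => //; rewrite lee_fin.
have le_1 (u : nat -> C R) : (forall n, normc (u n) <= a n) -> abs_sum_le u M.
  by move=> ua; rewrite -[M]mul1r; apply: le_a => // n; rewrite mul1r.
have s1 : abs_sum_le (fun n => f n z0 w0) M by apply: le_1 => n; have [] := hab n.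
have s2 : abs_sum_le (fun n => (ab n).1) M by apply: le_1 => n; have [] := hab n.
have s3 : abs_sum_le (fun n => (ab n).2) M by apply: le_1 => n; have [] := hab n.
exists (csum (fun n => (ab n).1)), (csum (fun n => (ab n).2)).
split; [exact: csum_le|exact: csum_le|exact: csum_le|] => h k hr kr.
have [M' s4] := sf h k hr kr.
have E : csum (fun n => f n (z0 + h) (w0 + k)) - csum (fun n => f n z0 w0) -
    csum (fun n => (ab n).1) * h - csum (fun n => (ab n).2) * k =
  csum (fun n => f n (z0 + h) (w0 + k) + (-1) * f n z0 w0 + (- h) * (ab n).1 + (- k) * (ab n).2).
  have t1 := abs_sum_le_dominated (c := 1) (u := fun n => -1 * f n z0 w0) ler01 _ s1.
  have t2 := abs_sum_le_dominated (c := normc h) (u := fun n => - h * (ab n).1) (normcC_ge0 _) _ s2.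
  have t3 := abs_sum_le_dominated (c := normc k) (u := fun n => - k * (ab n).2) (normcC_ge0 _) _ s3.
  have {}t1 := t1 ltac:(by move=> n; rewrite normcM normcN normcC1).
  have {}t2 := t2 ltac:(by move=> n; rewrite normcM normcN).
  have {}t3 := t3 ltac:(by move=> n; rewrite normcM normcN).
  have u1 := abs_sum_leD s4 t1; have u2 := abs_sum_leD u1 t2.
  rewrite (csumD u2 t3) (csumD u1 t2) (csumD s4 t1).
  by rewrite (csumZ _ s1) (csumZ _ s2) (csumZ _ s3); ring.
rewrite E.
have -> : 2 * M * (normc h + normc k) ^+ 2 = 2 * ((normc h + normc k) ^+ 2 * M) by ring.
apply: csum_le; apply: le_a; first exact: sqr_ge0.
move=> n; have [_ _ _ J] := hab n; rewrite [leRHS]mulrC.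
apply: le_trans (J h k hr kr).
by rewrite le_eqVlt; apply/orP; left; apply/eqP; congr normc; ring.
Qed.

End jets.

(** * Finite volume of Omega for delta ^ b dV *)

Section surface.
Variables (R : realType) (G : aut_subgroup R).
Local Notation leb := (@lebesgue_measure R).
Local Notation RR := (measurableTypeR R).
Local Notation leb2 := (@plane_measure R).
Local Notation R4 := ((RR * RR) * (RR * RR))%type.
Local Notation mu4 := (leb2 \x leb2)%E.
Hypothesis hcover : covering_map (Sigma_proj G).
Hypothesis hcompact : compact [set: Sigma G].
Variables (gam : nat -> disk R -> disk R) (A B : nat -> C R).
Hypothesis gamG : forall n, aut_set G (gam n).
Hypothesis gam_surj : forall g, aut_set G g -> exists n, gam n = g.
Hypothesis gam_inj : injective gam.
Hypothesis gamAB : forall n, su11 (A n) (B n) /\ moebius_of (A n) (B n) (gam n).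
Implicit Types (z w : C R) (N : nat).

Definition volume_density (b : R) (p : C R * C R) : R := delta p `^ b * dV_density p.

Lemma volume_density_ge0 b p : 0 <= volume_density b p.
Proof.
by rewrite /volume_density mulr_ge0 ?powR_ge0// divr_ge0// exprn_ge0// normcC_ge0.
Qed.

Lemma cmeasurable_fst : cmeasurable (fun q : R4 => toC q.1).
Proof. exact: (cmeasurable_comp (cmeasurable_toC R) measurable_fst). Qed.

Lemma cmeasurable_snd : cmeasurable (fun q : R4 => toC q.2).
Proof. exact: (cmeasurable_comp (cmeasurable_toC R) measurable_snd). Qed.

Lemma measurable_volume_density b : measurable_fun setT (fun q : R4 =>
    volume_density b (of_real_coords q) : RR).
Proof.
have m1 : cmeasurable (fun q : R4 => 1 - (toC q.1)^* * toC q.2).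
  apply: cmeasurableD; first exact: cmeasurable_cst.
  by apply: cmeasurableN; apply: cmeasurableM; [apply: cmeasurableJ;
    exact: cmeasurable_fst|exact: cmeasurable_snd].
apply: measurable_funM.
  apply: (measurableT_comp (measurable_powR _)).
  apply: measurable_funM; last exact: (measurable_normc2V m1).
  apply: measurable_funM; apply: measurable_funB => //; apply: measurable_normc2.
    exact: cmeasurable_fst.
  exact: cmeasurable_snd.
apply: measurable_funM => //.
have -> : (fun q : R4 => (normc (1 - (of_real_coords q).1^* * (of_real_coords q).2) ^+ 4)^-1 : RR) =
  (fun q : R4 => ((normc (1 - (toC q.1)^* * toC q.2) ^+ 2)^-1 ^+ 2)).
  by apply/funext => q; rewrite exprVn -exprM.
by apply: measurable_funX; exact: (measurable_normc2V m1).
Qed.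

(** For |z| < r the modulus of 1 - z^* w lies between 1 - r and 2, so that only the boundary
    singularity in w remains. *)
Lemma volume_density_bound (b r : R) z w : b < 0 -> 0 <= r -> r < 1 -> normc z < r -> normc w < 1 ->
  volume_density b (z, w) <= ((1 - r ^+ 2) / 4) `^ b * (4 / (1 - r) ^+ 4) * (disk_weight b z *
    disk_weight b w).
Proof.
move=> b0 r0 r1 zr w1; have z1 := lt_trans zr r1.
have n0z := normcC_ge0 z; have n0w := normcC_ge0 w.
have r2 : 0 < 1 - r ^+ 2 by rewrite subr_gt0 exprn_ilt1.
have wpos := one_sub2_gt0 w1; have zpos := one_sub2_gt0 z1.
have low : 1 - r <= normc (1 - z^* * w).
  apply: le_trans (normc_sub_ge _ _); rewrite normcC1 normcN normcM normcCJ lerD2l lerN2.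
  by rewrite -[leRHS]mulr1; apply: ler_pM => //; exact: ltW.
have up : normc (1 - z^* * w) <= 2.
  apply: (le_trans (normc_triangle _ _)); rewrite normcC1 normcN normcM normcCJ.
  have : normc z * normc w <= 1 * 1 by apply: ler_pM => //; exact: ltW.
  lra.
have low0 : 0 < 1 - r by rewrite subr_gt0.
have up2 : normc (1 - z^* * w) ^+ 2 <= 4.
  have -> : 4 = 2 ^+ 2 :> R by ring.
  by rewrite ler_pXn2r ?nnegrE ?normcC_ge0.
have pos := sub_conj_gt0 z1 w1.
(* As b < 0 the weight of z is at least 1; with it the bound is a product of integrable
   functions of z and of w. *)
have dz : 1 <= disk_weight b z.
  rewrite /disk_weight z1; have := @powR_anti R b (1 - normc z ^+ 2) 1 b0 zpos.
  by rewrite powR1; apply; rewrite gerBl sqr_ge0.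
have dw : disk_weight b w = (1 - normc w ^+ 2) `^ b by rewrite /disk_weight w1.
have K0 : 0 <= ((1 - r ^+ 2) / 4) `^ b by exact: powR_ge0.
have dpos : 0 < (1 - r ^+ 2) / 4 * (1 - normc w ^+ 2) by rewrite mulr_gt0// divr_gt0.
have dd : (1 - r ^+ 2) / 4 * (1 - normc w ^+ 2) <= delta (z, w).
  rewrite /delta /= mulrAC ler_pdivlMr ?exprn_gt0// mulrAC -!mulrA.
  apply: ler_pM; rewrite ?(ltW r2)//.
  - by rewrite mulr_ge0 ?invr_ge0// mulr_ge0 ?sqr_ge0 ?(ltW wpos).
  - by rewrite lerD2l lerN2 ler_pXn2r ?nnegrE// ltW.
  - rewrite mulrCA -[leRHS]mulr1; apply: ler_wpM2l; first exact: ltW.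
    by rewrite mulrC ler_pdivrMr// mul1r.
have hdelta : delta (z, w) `^ b <= ((1 - r ^+ 2) / 4) `^ b * disk_weight b w.
  rewrite dw -powRM ?(ltW wpos)//; last by rewrite divr_ge0// ltW.
  exact: powR_anti.
have hdV : dV_density (z, w) <= 4 / (1 - r) ^+ 4.
  rewrite /dV_density/= ler_pM2l// lef_pV2 ?posrE ?exprn_gt0//.
  by rewrite ler_pXn2r ?nnegrE// ltW.
have dV0 : 0 <= dV_density (z, w) by rewrite /dV_density/= divr_ge0// exprn_ge0// normcC_ge0.
apply: (le_trans (ler_pM (powR_ge0 _ _) dV0 hdelta hdV)).
rewrite mulrAC; apply: ler_wpM2l.
  exact: mulr_ge0 K0 (le_trans dV0 hdV).
by rewrite -[leLHS]mul1r ler_wpM2r// disk_weight_ge0.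
Qed.

Definition coords (p : C R * C R) : R4 :=
  ((complex.Re p.1, complex.Im p.1), (complex.Re p.2, complex.Im p.2)).

Lemma coordsK p : of_real_coords (coords p) = p.
Proof. by case: p => z w; rewrite /coords /of_real_coords /=; case: z => ? ?; case: w. Qed.

Lemma of_real_coordsK q : coords (of_real_coords q) = q.
Proof. by case: q => -[? ?] [? ?]. Qed.

Lemma measurable_coords (f g : R4 -> C R) : cmeasurable f -> cmeasurable g ->
  measurable_fun setT (fun q => coords (f q, g q)).
Proof.
by move=> [f1 f2] [g1 g2]; apply: measurable_fun_pair; apply: measurable_fun_pair.
Qed.

Lemma measurable_normc_lt (f : R4 -> C R) (r : R) : cmeasurable f ->
  measurable_fun setT (fun q => (normc (f q) < r)%R : bool).
Proof. by move=> mf; apply: measurable_fun_ltr => //; exact: measurable_normc. Qed.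

(** The image of E under gam n, expressed by the inverse matrix. *)
Definition translate (E : set R4) (n : nat) : set R4 :=
  [set q | [/\ normc (toC q.1) < 1, normc (toC q.2) < 1 &
    E (coords (mob (A n)^* (- B n) (toC q.1), mob (A n)^* (- B n) (toC q.2)))]].

Lemma measurable_translate E n : measurable E -> measurable (translate E n).
Proof.
move=> mE.
have -> : translate E n = (fun q : R4 => normc (toC q.1) < 1) @^-1` [set true] `&`
   ((fun q : R4 => normc (toC q.2) < 1) @^-1` [set true] `&`
   (fun q : R4 => coords (mob (A n)^* (- B n) (toC q.1), mob (A n)^* (- B n) (toC q.2))) @^-1` E).
  by apply/seteqP; split => q /= => [[? ? ?]|[? [? ?]]].
rewrite -[X in measurable X]setTI; apply: measurableI => //; apply: measurableI;
  last apply: measurableI.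
- rewrite -[X in measurable X]setTI; apply: measurable_normc_lt => //; exact: cmeasurable_fst.
- rewrite -[X in measurable X]setTI; apply: measurable_normc_lt => //; exact: cmeasurable_snd.
- rewrite -[X in measurable X]setTI; apply: (measurable_coords _ _) => //.
    by apply: cmeasurable_mob; exact: cmeasurable_fst.
  by apply: cmeasurable_mob; exact: cmeasurable_snd.
Qed.

Lemma gam_mob n (x : disk R) : \val (gam n x) = mob (A n) (B n) (\val x).
Proof. by rewrite (moebius_ofE _ (gamAB n).2). Qed.

Lemma mob_gamV n (x y : disk R) : \val x = mob (A n)^* (- B n) (\val y) -> y = gam n x.
Proof.
move=> xy; apply: disk_inj; rewrite gam_mob xy.
have := mob_inv (su11_inv (gamAB n).1) (disk_lt1 y).
by rewrite conjCK opprK.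
Qed.

(** A common point of two translates yields two points of E in one orbit. They coincide since E
    embeds in Omega, and the two group elements coincide since the action is free. *)
Lemma trivIset_translate (E : set (disk R * disk R)) : set_inj E (Omega_proj G) ->
  trivIset setT (translate (@real_coords R @` E)).
Proof.
move=> injE; apply/trivIsetP => n m _ _ nm; apply/seteqP; split => // q.
move=> [[h1 h2 [[x1 y1] E1 e1]] [_ _ [[x2 y2] E2 e2]]]; apply: (negP nm).
pose u := mkdisk h1; pose v := mkdisk h2.
have val_coords (x y : disk R) z w : real_coords (x, y) = coords (z, w) -> \val x = z /\ \val y = w.
  rewrite /real_coords /coords /= => -[a1 a2 a3 a4]; split.
    by rewrite -[LHS]toCK a1 a2 toCK.
  by rewrite -[LHS]toCK a3 a4 toCK.
have [x1E y1E] := val_coords _ _ _ _ e1; have [x2E y2E] := val_coords _ _ _ _ e2.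
have ux1 : u = gam n x1 by apply: mob_gamV; rewrite x1E.
have vy1 : v = gam n y1 by apply: mob_gamV; rewrite y1E.
have ux2 : u = gam m x2 by apply: mob_gamV; rewrite x2E.
have vy2 : v = gam m y2 by apply: mob_gamV; rewrite y2E.
have [k Gk [gK kK]] := aut_set_inv (gamG m).
have EE : Omega_proj G (x1, y1) = Omega_proj G (x2, y2).
  apply/Omega_projP; exists (k \o gam n); first exact: aut_set_comp.
  by rewrite /= -ux1 -vy1 ux2 vy2 !gK.
have := injE _ _ _ _ EE; rewrite !inE => /(_ E1 E2) [xx _].
apply/eqP/gam_inj; apply: (free_action_eq hcover (x0 := x1)) => //.
by rewrite -ux1 ux2 xx.
Qed.

(** The density of delta ^ b dV cut to {|z| < r} x D, a set that meets every orbit. *)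
Definition cell_density (b r : R) (p : C R * C R) : R :=
  if (normc p.1 < r) && (normc p.2 < 1) then volume_density b p else 0.

Lemma cell_density_ge0 b r p : 0 <= cell_density b r p.
Proof. by rewrite /cell_density; case: ifPn => // _; exact: volume_density_ge0. Qed.

Lemma measurable_cell_density b r : measurable_fun setT (fun q : R4 =>
    cell_density b r (of_real_coords q) : RR).
Proof.
apply: measurable_fun_ifT.
- apply: measurable_and.
    exact: (measurable_normc_lt r cmeasurable_fst).
  exact: (measurable_normc_lt 1 cmeasurable_snd).
- exact: measurable_volume_density.
- exact: measurable_cst.
Qed.

Lemma cell_density_integral (b r : R) : -1 < b -> b < 0 -> 0 <= r -> r < 1 ->
  exists M : R, (\int[mu4]_q (cell_density b r (of_real_coords q))%:E <= M%:E)%E.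
Proof.
move=> b1 b0 r0 r1.
pose K := ((1 - r ^+ 2) / 4) `^ b * (4 / (1 - r) ^+ 4).
have K0 : 0 <= K.
  by rewrite /K mulr_ge0 ?powR_ge0// divr_ge0// exprn_ge0// subr_ge0 ltW.
have I_fin := disk_weight_integral b1 b0.
have I0 : (0 <= integralC (fun z : C R => (disk_weight b z)%:E))%E.
  by apply: integral_ge0 => p _; rewrite lee_fin disk_weight_ge0.
pose I := fine (integralC (fun z : C R => (disk_weight b z)%:E)).
have IE : integralC (fun z : C R => (disk_weight b z)%:E) = I%:E.
  by rewrite /I fineK// ge0_fin_numE.
exists (K * I * I).
have mdw (p : R4 -> C R) : cmeasurable p -> measurable_fun setT (fun q => (disk_weight b (p q))%:E).
  by move=> mp; apply/measurable_EFinP; exact: measurable_disk_weight.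
have mw1 : measurable_fun [set: RR * RR] (fun p : RR * RR => (disk_weight b (toC p))%:E).
  by apply/measurable_EFinP; apply: measurable_disk_weight; exact: cmeasurable_toC.
pose F (q : R4) : \bar R := (K%:E * (disk_weight b (toC q.1))%:E * (disk_weight b (toC q.2))%:E)%E.
have mF : measurable_fun setT F.
  apply: emeasurable_funM; last exact: (mdw _ cmeasurable_snd).
  by apply: emeasurable_funM => //; exact: (mdw _ cmeasurable_fst).
have d0 z : (0 <= (disk_weight b z)%:E :> \bar R)%E by rewrite lee_fin disk_weight_ge0.
have F0 q : (0 <= F q)%E by rewrite !mule_ge0// lee_fin.
apply: (@le_trans _ _ (\int[mu4]_q F q)%E).
  apply: ge0_le_integral => //.
  - by move=> q _; rewrite lee_fin cell_density_ge0.
  - by apply/measurable_EFinP; exact: measurable_cell_density.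
  - move=> q _; rewrite /cell_density; case: ifPn => [/andP[q1 q2]|_]; last exact: F0.
    by rewrite /F -!EFinM lee_fin -mulrA; exact: volume_density_bound.
rewrite -lebesgue4_eq (proj1 (tonelli4 mF F0)).
have -> : (\int[leb2]_x \int[leb2]_y F (x, y) =
    \int[leb2]_p (K%:E * (disk_weight b (toC p))%:E * I%:E))%E.
  apply: eq_integral => p _; rewrite /F /= ge0_integralZl//; last by rewrite mule_ge0// lee_fin.
  by rewrite -IE.
rewrite ge0_integralZr//; last 3 first.
- exact: emeasurable_funM.
- by move=> p _; rewrite mule_ge0// lee_fin.
- by rewrite -IE.
rewrite ge0_integralZl// -[X in (_ * X * _)%E]/(integralC (fun z : C R => (disk_weight b z)%:E)) IE.
by rewrite -!EFinM.
Qed.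

(** Pointwise form of the change of variables by gam n, under which delta ^ b dV is invariant. *)
Lemma unfolded_integrand b r (E : set (disk R * disk R)) n q :
  ((\1_(@real_coords R @` E) q)%:E *
    (if normc (mob (A n) (B n) (toC q.1)) < r then volume_density b (of_real_coords q) else 0)%:E <=
   ((\1_(translate (@real_coords R @` E) n)
       (coords (mob (A n) (B n) (toC q.1), mob (A n) (B n) (toC q.2))) *
     cell_density b r (mob (A n) (B n) (toC q.1), mob (A n) (B n) (toC q.2)))%:E *
    ((normc (den (A n) (B n) (toC q.1)) ^+ 4)^-1 *
     (normc (den (A n) (B n) (toC q.2)) ^+ 4)^-1)%:E))%E.
Proof.
have [sab mab] := gamAB n.
rewrite -!EFinM lee_fin [X in X * _ <= _]indicE.
have [|_] := boolP (q \in _); last first.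
  rewrite mul0r mulr_ge0//; first by rewrite mulr_ge0 ?cell_density_ge0.
  by rewrite mulr_ge0// invr_ge0 exprn_ge0 ?normcC_ge0.
rewrite inE => -[[x y] Exy xyq]; rewrite mul1r.
have q1 : toC q.1 = \val x by rewrite -xyq /= toCK.
have q2 : toC q.2 = \val y by rewrite -xyq /= toCK.
have z1 := disk_lt1 x; have w1 := disk_lt1 y.
rewrite /cell_density /= q1 q2 mob_lt1// andbT.
case: ifPn => _; last by rewrite !mulr0 mul0r.
rewrite indicE mem_set ?mul1r; last first.
  split; rewrite ?coordsK /=.
  - by rewrite toCK mob_lt1.
  - by rewrite toCK mob_lt1.
  - by exists (x, y) => //; rewrite !toCK !mob_inv.
rewrite /volume_density delta_mob// -mulrA dV_mob//.
by rewrite [of_real_coords q](_ : _ = (\val x, \val y))// -q1 -q2.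
Qed.

(** The set E is covered by the parts that some gam n moves into {|z| < r} x D. Moving each part
    turns the integral over E into a sum of integrals over disjoint translates, all of them
    inside {|z| < r} x D. *)
Lemma finite_volume b : -1 < b -> b < 0 -> exists M : R, forall E, embedded_borel G E ->
  (\int[@lebesgue4 R]_(q in @real_coords R @` E) (volume_density b (of_real_coords q))%:E <=
    M%:E)%E.
Proof.
move=> b1 b0.
have [r /andP[r0 r1] hr] := cocompact hcompact.
have [M hM] := cell_density_integral b1 b0 r0 r1.
exists M => E [mE injE]; rewrite lebesgue4_eq.
apply: le_trans hM.
set E' := @real_coords R @` E.
pose L n (q : R4) : \bar R := ((\1_E' q)%:E *
  (if normc (mob (A n) (B n) (toC q.1)) < r then volume_density b (of_real_coords q) else 0)%:E)%E.
have L0 n q : (0 <= L n q)%E.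
  by rewrite mule_ge0 ?lee_fin//; case: ifPn => // _; exact: volume_density_ge0.
have mL n : measurable_fun setT (L n).
  apply: emeasurable_funM; first by apply/measurable_EFinP; exact: measurable_indic.
  apply/measurable_EFinP; apply: measurable_fun_ifT.
  - by apply: measurable_normc_lt; apply: cmeasurable_mob; exact: cmeasurable_fst.
  - exact: measurable_volume_density.
  - exact: measurable_cst.
pose K n (p : C R * C R) : \bar R := (\1_(translate E' n) (coords p) * cell_density b r p)%:E.
have K0 n p : (0 <= K n p)%E by rewrite lee_fin mulr_ge0// cell_density_ge0.
have mK n : measurable_fun setT (fun q : R4 => K n (of_real_coords q)).
  apply/measurable_EFinP; apply: measurable_funM; last exact: measurable_cell_density.
  under eq_fun do rewrite of_real_coordsK.
  by apply: measurable_indic; exact: measurable_translate.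
rewrite integral_mkcond.
apply: (@le_trans _ _ (\int[mu4]_q \sum_(n <oo) L n q)%E).
  apply: ge0_le_integral => //.
  - by move=> q _; apply: erestrict_ge0 => ? _; rewrite lee_fin volume_density_ge0.
  - apply/(measurable_restrictT _ _).1 => //.
    by apply: measurable_funTS; apply/measurable_EFinP; exact: measurable_volume_density.
  - by apply: ge0_emeasurable_sum.
  move=> q _; rewrite patchE; case: ifPn => [qE|_]; last by exact: nneseries_ge0.
  have [[x y] Exy xyq] : E' q by move: qE; rewrite inE.
  have [g Gg hg] := hr x.
  have [n gn] := gam_surj Gg.
  have q1 : toC q.1 = \val x by rewrite -xyq /= toCK.
  apply: (@le_trans _ _ (L n q)).
    by rewrite /L indicE qE mul1e q1 -gam_mob gn hg.
  have := @nneseries_lim_ge R (L^~ q) xpredT 0 n.+1 (fun n _ _ => L0 n q).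
  apply: le_trans; rewrite big_mkord big_ord_recr /= leeDr//.
  by apply: sume_ge0.
rewrite integral_nneseries//.
apply: (@le_trans _ _ (\sum_(n <oo) \int[mu4]_q K n (of_real_coords q))%E).
  apply: lee_nneseries => n _; first by move=> _; exact: integral_ge0.
  have [sab mab] := gamAB n.
  have H := integral4_mob_le sab (mK n) (K0 n); rewrite lebesgue4_eq in H; apply: le_trans H.
  have cmx := cmeasurable_mob (A n) (B n) cmeasurable_fst.
  have cmy := cmeasurable_mob (A n) (B n) cmeasurable_snd.
  have V4 (f : R4 -> C R) : cmeasurable f -> measurable_fun setT
      (fun q => (normc (den (A n) (B n) (f q)) ^+ 4)^-1 : RR).
    move=> mf; under eq_fun do rewrite -[4%N]/(2 * 2)%N exprM -exprVn.
    by apply: measurable_funX; apply: measurable_normc2V; exact: cmeasurable_den.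
  apply: ge0_le_integral => //.
  - apply: emeasurable_funM.
      have -> : (fun q : R4 => K n (mob (A n) (B n) (toC q.1), mob (A n) (B n) (toC q.2))) =
        (fun q => K n (of_real_coords q)) \o
        (fun q : R4 => coords (mob (A n) (B n) (toC q.1), mob (A n) (B n) (toC q.2))).
        by apply/funext => q /=; rewrite coordsK.
      by apply: (measurableT_comp (mK n)); exact: measurable_coords.
    apply/measurable_EFinP; apply: measurable_funM; apply: V4.
      exact: cmeasurable_fst.
    exact: cmeasurable_snd.
  - by move=> q _; exact: unfolded_integrand.
rewrite -integral_nneseries//.
apply: ge0_le_integral => //.
- by move=> q _; apply: nneseries_ge0.
- by apply: ge0_emeasurable_sum.
- by apply/measurable_EFinP; exact: measurable_cell_density.
move=> q _.
(* Dirac mass at q is additive on the disjoint translates, so their indicators add up to at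
   most 1. *)
rewrite (eq_eseriesr (g := fun n =>
  ((cell_density b r (of_real_coords q))%:E * \d_q (translate E' n))%E)); last first.
  by move=> n _; rewrite /K of_real_coordsK diracE mulrC EFinM indicE.
rewrite nneseriesZl//.
rewrite -[leRHS]mule1; apply: lee_wpmul2l; first by rewrite lee_fin cell_density_ge0.
have mT n : measurable (translate E' n) by exact: measurable_translate.
have tT : trivIset setT (translate E') by exact: trivIset_translate.
have mU : measurable (\bigcup_n translate E' n) by exact: bigcupT_measurable.
have <- := @measure_semi_bigcup _ _ _ \d_q (translate E') mT tT mU.
have dE : (\d_q (\bigcup_n translate E' n) <= 1 :> \bar R)%E.
  by rewrite diracE lee_fin; case: (_ \in _).
exact: dE.
Qed.

(** * Summability of the coefficients *)

(** The translates of a small disk are disjoint in the unit disk, and the n-th of them has area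
    at least a constant times |A_n|^-4. *)
Lemma packing : exists M : R, (\sum_(n <oo) (((normc (A n)) ^+ 4)^-1)%:E <= M%:E)%E.
Proof.
have [e1 e10 he1] := separated_orbit hcover.
pose e := Num.min e1 1.
have e0 : 0 < e by rewrite lt_min e10 ltr01.
have ee1 : e <= e1 by rewrite ge_min lexx.
have e_1 : e <= 1 by rewrite ge_min lexx orbT.
pose F (n : nat) : set (RR * RR) :=
  [set p | normc (toC p) < 1 /\ normc (mob (A n)^* (- B n) (toC p)) < e].
have mlt (f : RR * RR -> C R) (r : R) : cmeasurable f -> measurable [set p | normc (f p) < r].
  move=> mf; rewrite -[X in measurable X]setTI.
  have H : measurable_fun setT (fun p => (normc (f p) < r)%R : bool).
    by apply: measurable_fun_ltr => //; exact: measurable_normc.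
  exact: (H measurableT [set true]).
have mF n : measurable (F n).
  apply: measurableI; apply: mlt; first exact: cmeasurable_toC.
  by apply: cmeasurable_mob; exact: cmeasurable_toC.
have tF : trivIset setT F.
  apply/trivIsetP => n m _ _ nm; apply/seteqP; split => // p [[p1 p2] [_ p3]].
  apply: (negP nm); apply/eqP/gam_inj.
  have x1 := mob_lt1 (su11_inv (gamAB n).1) p1.
  have y1 := mob_lt1 (su11_inv (gamAB m).1) p1.
  apply: (he1 _ _ (mkdisk x1) (mkdisk y1)) => //.
  - by rewrite mkdiskK (lt_le_trans p2).
  - by rewrite mkdiskK (lt_le_trans p3).
  rewrite -(@mob_gamV n (mkdisk x1) (mkdisk p1))//.
  by rewrite -(@mob_gamV m (mkdisk y1) (mkdisk p1)).
pose k := (e / 2) ^+ 2.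
have k0 : 0 < k by rewrite exprn_gt0// divr_gt0.
pose h n (z : C R) : \bar R := (\1_(F n) ((complex.Re z, complex.Im z) : RR * RR))%:E.
have hE n p : h n (toC p) = \d_p (F n) by rewrite /h diracE indicE; case: p.
have mh n : measurable_on_C (h n).
  apply/measurable_EFinP; rewrite (_ : (fun _ => _) = \1_(F n) :> (RR * RR -> RR)).
    exact: measurable_indic.
  by apply/funext => -[].
have h0 n z : (0 <= h n z)%E by rewrite lee_fin.
(* The weight of exponent -1/2 is integrable and at least 1 on the disk, so it bounds the area. *)
have b1 : -1 < - 2^-1 :> R by lra.
have b0 : - 2^-1 < 0 :> R by lra.
have I_fin := disk_weight_integral b1 b0.
have I0 : (0 <= integralC (fun z : C R => (disk_weight (- 2^-1) z)%:E))%E.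
  by apply: integral_ge0 => p _; rewrite lee_fin disk_weight_ge0.
pose I := fine (integralC (fun z : C R => (disk_weight (- 2^-1) z)%:E)).
have IE : integralC (fun z : C R => (disk_weight (- 2^-1) z)%:E) = I%:E.
  by rewrite /I fineK// ge0_fin_numE.
have sumh : (\sum_(n <oo) integralC (h n) <= I%:E)%E.
  rewrite -IE /integralC -integral_nneseries//.
  apply: ge0_le_integral => //.
  - by move=> p _; apply: nneseries_ge0.
  - apply: ge0_emeasurable_sum => [n p _ _|n _]; [exact: h0|exact: mh].
  - by apply/measurable_EFinP; apply: measurable_disk_weight; exact: cmeasurable_toC.
  move=> p _; rewrite (eq_eseriesr (fun n _ => hE n p)).
  have mU : measurable (\bigcup_n F n) by exact: bigcupT_measurable.
  have <- := @measure_semi_bigcup _ _ _ \d_p F mF tF mU.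
  have dE : (\d_p (\bigcup_n F n) <= (disk_weight (- 2^-1) (toC p))%:E :> \bar R)%E.
    rewrite diracE lee_fin; have [|_] := boolP (p \in _); last exact: disk_weight_ge0.
    rewrite inE => -[n _ [p1 _]]; rewrite /disk_weight p1.
    have := @powR_anti R (- 2^-1) (1 - normc (toC p) ^+ 2) 1 b0 (one_sub2_gt0 p1).
    by rewrite powR1; apply; rewrite gerBl sqr_ge0.
  exact: dE.
(* a square inside the disk of radius e, whose area is immediate *)
pose box := (`[0%R, e / 2]%classic `*` `[0%R, e / 2]%classic) : set (RR * RR).
have mbox : measurable box by apply: measurableX; exact: measurable_itv.
have vol : (\int[leb2]_p (\1_box p)%:E = k%:E)%E.
  rewrite integral_indic// setIT.
  have vE : (leb2 box = leb `[0%R, (e / 2)%R]%classic * leb `[0%R, (e / 2)%R]%classic)%E.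
    by apply: product_measure1E; exact: measurable_itv.
  have e2 : 0 < e / 2 by rewrite divr_gt0.
  have L : leb `[0%R, (e / 2)%R]%classic = (e / 2)%:E.
    by rewrite lebesgue_measure_itv/= lte_fin e2 oppr0 adde0.
  by rewrite [LHS](_ : _ = (leb `[0%R, (e / 2)%R]%classic * leb `[0%R,
    (e / 2)%R]%classic)%E) // L -EFinM.
have low n : ((k / 16 * (normc (A n) ^+ 4)^-1)%:E <= integralC (h n))%E.
  have [sab mab] := gamAB n.
  apply: le_trans (integralC_mob_le sab (mh n) (h0 n)).
  have c0 : 0 <= (normc (A n) ^+ 4)^-1 / 16 by rewrite divr_ge0// invr_ge0 exprn_ge0 ?normcC_ge0.
  rewrite mulrAC -mulrA EFinM -vol -ge0_integralZr//; last first.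
    by apply/measurable_EFinP; exact: measurable_indic.
  apply: ge0_le_integral => //.
  - by move=> p _; rewrite mule_ge0// lee_fin.
  - by apply: emeasurable_funM => //; apply/measurable_EFinP; exact: measurable_indic.
  - apply: emeasurable_funM.
      by apply: (measurable_on_C_comp (mh n)); apply: cmeasurable_mob; exact: cmeasurable_toC.
    apply/measurable_EFinP; under eq_fun do rewrite -[4%N]/(2 * 2)%N exprM -exprVn.
    by apply: measurable_funX; apply: measurable_normc2V; apply: cmeasurable_den;
      exact: cmeasurable_toC.
  move=> p _; rewrite [X in (X%:E * _ <= _)%E]indicE; have [|_] := boolP (p \in _); last first.
    by rewrite mul0e mule_ge0// lee_fin invr_ge0 exprn_ge0// normcC_ge0.
  rewrite inE => -[/=]; rewrite !in_itv/= => /andP[x0 x2] /andP[y0 y2].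
  have pe : normc (toC p) < e.
    rewrite -(@ltr_pXn2r _ 2)// ?nnegrE ?normcC_ge0 ?(ltW e0)// normc2E /=; nra.
  have p1 := lt_le_trans pe e_1.
  rewrite mul1e /h indicE mem_set; last first.
    by split => /=; rewrite toCK ?mob_lt1// mob_inv.
  have D0 := den_gt0 sab p1.
  have A0 : 0 < normc (A n) by rewrite (lt_le_trans ltr01)// (su11_ge1 sab).
  rewrite mul1e lee_fin -invfM lef_pV2 ?posrE ?mulr_gt0 ?exprn_gt0//.
  rewrite [leRHS](_ : _ = (2 * normc (A n)) ^+ 4); last by ring.
  by rewrite ler_pXn2r ?nnegrE ?normcC_ge0 ?mulr_ge0 ?normcC_ge0 ?den_upper.
exists (16 / k * I).
have k16 : 0 <= 16 / k by rewrite divr_ge0// ltW.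
rewrite (eq_eseriesr (g := fun n => ((16 / k)%:E * (k / 16 * (normc (A n) ^+ 4)^-1)%:E)%E));
  last first.
  move=> n _; rewrite -EFinM mulrA; congr EFin; rewrite (_ : 16 / k * (k / 16) = 1) ?mul1r//.
  by field; rewrite gt_eqF.
rewrite nneseriesZl; last first.
  by move=> n _; rewrite lee_fin mulr_ge0 ?divr_ge0 ?(ltW k0)// invr_ge0 exprn_ge0 ?normcC_ge0.
rewrite [leRHS]EFinM; apply: lee_wpmul2l; first by rewrite lee_fin.
apply: le_trans sumh; apply: lee_nneseries => n _; last exact: low.
by move=> _; rewrite lee_fin mulr_ge0 ?divr_ge0 ?(ltW k0)// invr_ge0 exprn_ge0 ?normcC_ge0.
Qed.

(** * Growth of the sums of powers of displacements *)

Variable M : R.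
Hypothesis hM : (\sum_(n <oo) (((normc (A n)) ^+ 4)^-1)%:E <= M%:E)%E.

Definition gap (n : nat) z w : C R := mob (A n) (B n) w - mob (A n) (B n) z.
Definition gap_sum N z w : \bar R := (\sum_(n <oo) (normc (gap n z w) ^+ N)%:E)%E.

Lemma coeff_ge0 n : 0 <= (normc (A n) ^+ 4)^-1.
Proof. by rewrite invr_ge0 exprn_ge0 ?normcC_ge0. Qed.

Lemma M_ge0 : 0 <= M.
Proof.
by rewrite -lee_fin; apply: le_trans hM; apply: nneseries_ge0 => n _ _; rewrite lee_fin coeff_ge0.
Qed.

Lemma gap_le n z w : normc z < 1 -> normc w < 1 ->
  normc (gap n z w) <= normc (w - z) / ((1 - normc z) * (1 - normc w)) * (normc (A n) ^+ 2)^-1.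
Proof.
move=> z1 w1; have [sab _] := gamAB n.
rewrite /gap mob_sub// normcM normcV normcM -mulrA -invfM.
have A0 : 0 < normc (A n) by rewrite (lt_le_trans ltr01)// (su11_ge1 sab).
rewrite ler_wpM2l ?normcC_ge0// lef_pV2 ?posrE ?mulr_gt0 ?den_gt0 ?subr_gt0 ?exprn_gt0//.
rewrite (_ : _ * _ * _ = (normc (A n) * (1 - normc z)) * (normc (A n) * (1 - normc w)));
  last by ring.
apply: ler_pM; rewrite ?den_lower// mulr_ge0 ?(ltW A0)// subr_ge0; exact: ltW.
Qed.

(** As N >= 2 and |A_n| >= 1, the N-th power of |A_n|^-2 is at most the summable |A_n|^-4. *)
Lemma gap_sum_local N z w : (2 <= N)%N -> normc z < 1 -> normc w < 1 ->
  (gap_sum N z w <= ((normc (w - z) / ((1 - normc z) * (1 - normc w))) ^+ N * M)%:E)%E.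
Proof.
move=> N2 z1 w1; set K := normc (w - z) / _.
have K0 : 0 <= K by rewrite divr_ge0 ?normcC_ge0// mulr_ge0// subr_ge0 ltW.
apply: (@le_trans _ _ (\sum_(n <oo) ((K ^+ N)%:E * ((normc (A n) ^+ 4)^-1)%:E))%E).
  apply: lee_nneseries => n _; first by move=> _; rewrite lee_fin exprn_ge0 ?normcC_ge0.
  rewrite -EFinM lee_fin.
  have H := gap_le n z1 w1; rewrite -/K in H.
  apply: (@le_trans _ _ ((K * (normc (A n) ^+ 2)^-1) ^+ N)).
    rewrite ler_pXn2r ?nnegrE ?normcC_ge0//; first by case: N N2.
    by rewrite mulr_ge0// invr_ge0 sqr_ge0.
  rewrite exprMn ler_wpM2l ?exprn_ge0// -exprVn -exprM -exprVn.
  have A1 := su11_ge1 (gamAB n).1.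
  have A0 : 0 < normc (A n) by rewrite (lt_le_trans ltr01).
  rewrite exprVn exprVn lef_pV2 ?posrE ?exprn_gt0// ler_weXn2l//.
  by rewrite (leq_mul2l 2 2 N).
rewrite nneseriesZl; last by move=> n _; rewrite lee_fin coeff_ge0.
by rewrite EFinM; apply: lee_wpmul2l => //; rewrite lee_fin exprn_ge0.
Qed.

Lemma gam_perm g : aut_set G g -> exists s : nat -> nat,
  bijective s /\ forall n, gam (s n) = gam n \o g.
Proof.
move=> Gg; have [h Gh [gK hK]] := aut_set_inv Gg.
have [s hs] := choice (fun n => gam_surj (aut_set_comp (gamG n) Gg)).
have [t ht] := choice (fun n => gam_surj (aut_set_comp (gamG n) Gh)).
exists s; split => //; exists t => n; apply: gam_inj.
  rewrite ht hs; apply/funext => x /=; by rewrite hK.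
rewrite hs ht; apply/funext => x /=; by rewrite gK.
Qed.

Lemma gap_gam n (x y : disk R) : gap n (\val x) (\val y) = \val (gam n y) - \val (gam n x).
Proof. by rewrite /gap !gam_mob. Qed.

Lemma gap_sum_inv N g (x y : disk R) : aut_set G g ->
  gap_sum N (\val (g x)) (\val (g y)) = gap_sum N (\val x) (\val y).
Proof.
move=> Gg; have [s [bs hs]] := gam_perm Gg.
rewrite /gap_sum [RHS](nneseries_perm bs); last first.
  by move=> n; rewrite lee_fin exprn_ge0 ?normcC_ge0.
by apply: eq_eseriesr => n _; rewrite !gap_gam hs.
Qed.

Lemma delta_inv g (x y : disk R) : aut_set G g ->
  delta (\val (g x), \val (g y)) = delta (\val x, \val y).
Proof.
by move=> /aut_matrix[a [b [sab mg]]]; rewrite !(moebius_ofE _ mg) delta_mob// disk_lt1.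
Qed.

Lemma delta_upper (r : R) z w : normc z < r -> r < 1 -> normc w < 1 ->
  delta (z, w) * (1 - r) ^+ 2 / 2 <= 1 - normc w.
Proof.
move=> zr r1 w1; have z1 := lt_trans zr r1.
have n0z := normcC_ge0 z; have n0w := normcC_ge0 w.
have low : 1 - r <= normc (1 - z^* * w).
  apply: le_trans (normc_sub_ge _ _); rewrite normcC1 normcN normcM normcCJ lerD2l lerN2.
  by rewrite -[leRHS]mulr1; apply: ler_pM => //; exact: ltW.
have pos := sub_conj_gt0 z1 w1.
rewrite /delta /=; set X := normc (1 - _) in low pos *.
rewrite ler_pdivrMr// mulrAC ler_pdivrMr ?exprn_gt0//.
apply: (@le_trans _ _ ((1 - normc w) * 2 * (1 - r) ^+ 2)).
  rewrite ler_wpM2r ?sqr_ge0//.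
  have -> : 1 - normc w ^+ 2 = (1 - normc w) * (1 + normc w) by ring.
  rewrite mulrCA ler_wpM2l ?subr_ge0 ?(ltW w1)//.
  have : 0 <= normc z ^+ 2 by rewrite sqr_ge0.
  have := one_sub2_gt0 z1; nra.
rewrite ler_wpM2l ?mulr_ge0 ?subr_ge0 ?(ltW w1)//.
by rewrite ler_pXn2r ?nnegrE ?subr_ge0// ltW.
Qed.

(** If y <= eta x then x + y <= (1 + eta) x, where (1 + eta)^N <= q for small eta; otherwise x +
    y <= (1 + 1/eta) y. That q may be close to 1 makes the growth exponents below arbitrarily
    small. *)
Lemma exprD_le N (q : R) : 1 < q -> exists2 Cq : R, 0 <= Cq &
  forall x y : R, 0 <= x -> 0 <= y -> (x + y) ^+ N <= q * x ^+ N + Cq * y ^+ N.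
Proof.
move=> q1; pose eta := Num.min 1 ((q - 1) / 3 ^+ N).
have e0 : 0 < eta by rewrite lt_min ltr01 divr_gt0 ?subr_gt0// exprn_gt0.
have e1 : eta <= 1 by rewrite ge_min lexx.
have bern k : (1 + eta) ^+ k <= 1 + 3 ^+ k * eta.
  elim: k => [|k IH]; first by rewrite !expr0 mul1r lerDl ltW.
  rewrite exprS; apply: (@le_trans _ _ ((1 + eta) * (1 + 3 ^+ k * eta))).
    by rewrite ler_wpM2l// addr_ge0// ltW.
  have k1 : 1 <= 3 ^+ k :> R by rewrite exprn_ege1// ler1n.
  rewrite exprS; move: k1; set c := 3 ^+ k => k1.
  have h1 : eta <= c * eta by rewrite ler_peMl// ltW.
  have h2 : c * eta * eta <= c * eta.
    by rewrite ler_piMr// mulr_ge0// ltW// (lt_le_trans ltr01).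
  nra.
have eq_ : (1 + eta) ^+ N <= q.
  apply: (le_trans (bern N)); have : eta <= (q - 1) / 3 ^+ N by rewrite ge_min lexx orbT.
  by rewrite ler_pdivlMr ?exprn_gt0// mulrC; lra.
exists ((1 + eta^-1) ^+ N); first by rewrite exprn_ge0// addr_ge0// invr_ge0 ltW.
move=> x y x0 y0; have [yx|yx] := leP y (eta * x).
  apply: (@le_trans _ _ (((1 + eta) * x) ^+ N)).
    by apply: lerXn2r; rewrite ?nnegrE ?addr_ge0 ?mulr_ge0 ?addr_ge0 ?(ltW e0)//; lra.
  rewrite exprMn; apply: (@le_trans _ _ (q * x ^+ N)).
    by rewrite ler_wpM2r// exprn_ge0.
  rewrite lerDl mulr_ge0 ?exprn_ge0// addr_ge0// invr_ge0 ltW//.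
apply: (@le_trans _ _ (((1 + eta^-1) * y) ^+ N)).
  apply: lerXn2r; rewrite ?nnegrE ?addr_ge0 ?mulr_ge0 ?addr_ge0 ?invr_ge0 ?(ltW e0)//.
  have : x <= eta^-1 * y by rewrite mulrC ler_pdivlMr// mulrC ltW.
  by rewrite mulrDl mul1r; lra.
by rewrite exprMn lerDr mulr_ge0 ?exprn_ge0// ltW// (lt_trans ltr01).
Qed.

Lemma gap_sum_triangle N (q : R) : 1 < q -> exists2 Cq : R, 0 <= Cq & forall z w v,
  (gap_sum N z v <= q%:E * gap_sum N z w + Cq%:E * gap_sum N w v)%E.
Proof.
move=> q1; have [Cq Cq0 H] := exprD_le N q1; exists Cq => // z w v.
have S0 n x y : (0 <= (normc (gap n x y) ^+ N)%:E)%E by rewrite lee_fin exprn_ge0 ?normcC_ge0.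
have q0 : 0 <= q by rewrite ltW// (lt_trans ltr01).
rewrite /gap_sum -!nneseriesZl//.
rewrite -nneseriesD; last 2 first.
- by move=> n _; rewrite mule_ge0// lee_fin.
- by move=> n _; rewrite mule_ge0// lee_fin.
apply: lee_nneseries => // n _.
rewrite -!EFinM -EFinD lee_fin.
have -> : gap n z v = gap n z w + gap n w v by rewrite /gap; ring.
apply: le_trans (H _ _ (normcC_ge0 _) (normcC_ge0 _)).
by apply: lerXn2r; rewrite ?nnegrE ?addr_ge0 ?normcC_ge0// normc_triangle.
Qed.

(** By invariance z may be moved into {|z| < r}; there a lower bound on delta keeps w away from
    the circle. *)
Lemma gap_sum_delta N (d0 : R) : (2 <= N)%N -> 0 < d0 -> exists2 K : R, 0 <= K &
  forall z w, normc z < 1 -> normc w < 1 -> d0 <= delta (z, w) -> (gap_sum N z w <= K%:E)%E.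
Proof.
move=> N2 d00; have [r /andP[r0 r1] hr] := cocompact hcompact.
pose c := d0 * (1 - r) ^+ 2 / 2.
have r10 : 0 < 1 - r by rewrite subr_gt0.
have c0 : 0 < c by rewrite divr_gt0// mulr_gt0// exprn_gt0.
have K0 : 0 <= 2 / ((1 - r) * c) by rewrite divr_ge0// ltW// mulr_gt0.
exists ((2 / ((1 - r) * c)) ^+ N * M); first by rewrite mulr_ge0 ?exprn_ge0 ?M_ge0.
move=> z w z1 w1 dzw.
have [g Gg hg] := hr (mkdisk z1).
rewrite -(mkdiskK z1) -(mkdiskK w1) -(gap_sum_inv N (mkdisk z1) (mkdisk w1) Gg).
have gw := delta_upper hg r1 (disk_lt1 (g (mkdisk w1))).
rewrite delta_inv// !mkdiskK in gw.
apply: (le_trans (gap_sum_local N2 (disk_lt1 _) (disk_lt1 _))).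
move: hg gw; set z' := \val _ => hz; set w' := \val _ => gw.
have cw : c <= 1 - normc w'.
  by apply: le_trans gw; rewrite ler_pM2r// ler_pM2r// exprn_gt0.
have w'1 : normc w' < 1 by exact: disk_lt1.
have z'1 : normc z' < 1 by exact: disk_lt1.
rewrite lee_fin ler_wpM2r ?M_ge0//; apply: lerXn2r; rewrite ?nnegrE//.
  by rewrite divr_ge0 ?normcC_ge0// mulr_ge0// subr_ge0 ltW.
apply: ler_pM; rewrite ?normcC_ge0 ?invr_ge0 ?mulr_ge0 ?subr_ge0 ?(ltW w'1) ?(ltW z'1)//.
  by apply: (le_trans (normc_triangle _ _)); rewrite normcN; lra.
rewrite lef_pV2 ?posrE ?mulr_gt0 ?subr_gt0//; apply: ler_pM; [exact: ltW|exact: ltW| |exact: cw].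
by rewrite lerD2l lerN2 ltW.
Qed.

Lemma normc_scale (s : R) z : 0 <= s -> normc (s%:C%C * z) = s * normc z.
Proof. by move=> s0; rewrite normcM normc_real. Qed.

Lemma delta_radial (s : R) w : 0 <= s <= 1 -> normc w < 1 ->
  delta (s%:C%C * w, w) = (1 - (s * normc w) ^+ 2) * (1 - normc w ^+ 2) / (1 - s *
    normc w ^+ 2) ^+ 2.
Proof.
move=> /andP[s0 s1] w1; rewrite /delta /= normc_scale//; congr (_ / _ ^+ 2).
have -> : (s%:C%C * w)^* * w = (s * normc w ^+ 2)%:C%C.
  have sJ : (s%:C%C : C R)^* = s%:C%C.
    by apply/eqP; rewrite eq_complex /= oppr0 !eqxx.
  by rewrite rmorphM/= sJ -mulrA normcJ_mul -rmorphM.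
rewrite -[1 in LHS]/((1 : R)%:C%C) -rmorphB normc_real// subr_ge0.
have w2 : normc w ^+ 2 <= 1 by rewrite exprn_ile1 ?normcC_ge0 ?(ltW w1).
by rewrite -[leRHS]mulr1; apply: ler_pM => //; rewrite sqr_ge0.
Qed.

(** As delta is a function of the hyperbolic distance, this says that doubling 1 - |w| along the
    radius is a step of bounded length. *)
Lemma radial_step (w : C R) : normc w < 1 -> exists w', [/\ normc w' < 1,
  2 / 9 <= delta (w', w) & Num.min 1 (2 * (1 - normc w)) <= 1 - normc w'].
Proof.
move=> w1; have w0 := normcC_ge0 w.
have [wh|wh] := leP (normc w) (1 / 2).
  exists 0; split; first by rewrite normcC0.
    have := @delta_radial 0 w _ w1; rewrite lexx ler01 => /(_ isT).
    rewrite -[X in delta (X * _, _)]/(0 : C R) !mul0r => ->.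
    rewrite expr0n/= !subr0 expr1n divr1 mul1r.
    nra.
  by rewrite normcC0 subr0 ge_min lexx.
(* the scalar for which 1 - |s w| = 2 (1 - |w|) *)
pose s := (2 * normc w - 1) / normc w.
have wp : 0 < normc w by lra.
have s0 : 0 <= s by rewrite divr_ge0// ; lra.
have s1 : s <= 1 by rewrite ler_pdivrMr//; lra.
have sw : s * normc w = 2 * normc w - 1 by rewrite /s mulfVK// gt_eqF.
exists (s%:C%C * w); split; first by rewrite normc_scale// sw; lra.
  rewrite delta_radial ?s0// expr2 (mulrA s) sw.
  have X0 : 0 < 1 - (2 * normc w - 1) * normc w by nra.
  rewrite ler_pdivlMr ?exprn_gt0//.
  have -> : 1 - normc w ^+ 2 = (1 - normc w) * (1 + normc w) by ring.
  have -> : 1 - (2 * normc w - 1) ^+ 2 = (2 * (1 - normc w)) * (2 * normc w) by ring.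
  have -> : 1 - (2 * normc w - 1) * normc w = (1 - normc w) * (1 + 2 * normc w) by ring.
  have t2 : 0 <= (1 - normc w) ^+ 2 by rewrite sqr_ge0.
  rewrite exprMn.
  have -> : 2 * (1 - normc w) * (2 * normc w) * ((1 - normc w) * (1 + normc w)) =
    (1 - normc w) ^+ 2 * (4 * normc w * (1 + normc w)) by ring.
  rewrite mulrCA ler_wpM2l//; nra.
by rewrite normc_scale// sw ge_min; apply/orP; right; lra.
Qed.

Lemma gap_sumxx N z : (0 < N)%N -> gap_sum N z z = 0%E.
Proof.
move=> N0; apply: eseries0 => n _ _; by rewrite /gap subrr normcC0 expr0n; case: N N0.
Qed.

(** With q = 2^eps, m radial steps from w to the origin cost a factor q^m = (2^m)^eps, and 2^m
    is comparable to 1 / (1 - |w|). *)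
Lemma gap_sum_growth N (eps : R) : (2 <= N)%N -> 0 < eps -> exists2 K : R, 0 <= K &
  forall w, normc w < 1 -> (gap_sum N 0 w <= (K * (1 - normc w) `^ (- eps))%:E)%E.
Proof.
move=> N2 eps0.
pose q : R := 2 `^ eps.
have q1 : 1 < q.
  by have := @gt0_ltr_powR R eps eps0 1 2; rewrite powR1; apply; rewrite ?nnegrE ?ltr1n.
have [Cq Cq0 Hq] := gap_sum_triangle N q1.
have d29 : 0 < 2 / 9 :> R by lra.
have [C1 C10 H1] := gap_sum_delta N2 d29.
(* The bound L q^m - L solves the recursion u_(m+1) = q u_m + Cq C1 with u_0 = 0. *)
pose L := Cq * C1 / (q - 1).
have L0 : 0 <= L by rewrite divr_ge0 ?mulr_ge0// subr_ge0 ltW.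
have LE : Cq * C1 = L * (q - 1) by rewrite /L mulfVK// gt_eqF// subr_gt0.
have q0 : 0 < q by rewrite (lt_trans ltr01).
have step m w : normc w < 1 -> (2^-1) ^+ m <= 1 - normc w ->
    (gap_sum N 0 w <= (L * q ^+ m - L)%:E)%E.
  elim: m w => [|m IH] w w1 hw.
    have w0 : w = 0.
      by apply/eqP; rewrite -normc_eq0 eq_le normcC_ge0 andbT; rewrite expr0 in hw; lra.
    by rewrite w0 gap_sumxx ?expr0 ?mulr1 ?subrr// (leq_trans _ N2).
  have [w' [w'1 dw hw']] := radial_step w1.
  have pm : (2^-1) ^+ m <= 1 - normc w'.
    apply: le_trans hw'; rewrite le_min exprn_ile1//=; last by lra.
    by move: hw; rewrite exprS; lra.
  apply: (le_trans (Hq 0 w' w)).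
  apply: (@le_trans _ _ (q%:E * (L * q ^+ m - L)%:E + Cq%:E * C1%:E)%E).
    apply: leeD; apply: lee_wpmul2l; rewrite ?lee_fin ?(ltW q0)//.
      exact: IH.
    exact: H1.
  rewrite -!EFinM -EFinD lee_fin LE exprS.
  by rewrite le_eqVlt; apply/orP; left; apply/eqP; ring.
exists (L * q); first by rewrite mulr_ge0// ltW.
move=> w w1; have t0 : 0 < 1 - normc w by rewrite subr_gt0.
have ex : exists m, (2^-1) ^+ m <= 1 - normc w.
  exists (Num.bound (1 - normc w)^-1).
  have t0' : 0 <= (1 - normc w)^-1 by rewrite invr_ge0 ltW.
  rewrite exprVn -[leRHS]invrK lef_pV2 ?posrE ?exprn_gt0 ?invr_gt0//.
  apply: (le_trans (ltW (archi_boundP t0'))).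
  by rewrite -natrX ler_nat ltnW// ltn_expl.
have mono x y : 0 <= x -> x <= y -> x `^ eps <= y `^ eps.
  by move=> x0 xy; rewrite ge0_ler_powR ?nnegrE ?(ltW eps0)// (le_trans x0).
case: (ex_minnP ex) => m hm mmin.
apply: (le_trans (step m w w1 hm)); rewrite lee_fin.
apply: (@le_trans _ _ (L * q ^+ m)); first by rewrite gerBl.
rewrite -mulrA ler_wpM2l//.
have qm k : q ^+ k = (2 ^+ k) `^ eps.
  by rewrite /q -powR_mulrn ?powR_ge0// -powRrM mulrC powRrM powR_mulrn.
have tE : (1 - normc w) `^ (- eps) = ((1 - normc w)^-1) `^ eps.
  by rewrite -[in RHS]powR_inv1 ?(ltW t0)// -powRrM mulN1r.
case: m hm mmin => [|m] hm mmin.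
  rewrite expr0 -[leLHS]mul1r ler_pM// ?(ltW q1)//.
  rewrite tE; have := mono 1 (1 - normc w)^-1 ler01; rewrite powR1; apply.
  by rewrite invf_ge1// gerBl normcC_ge0.
rewrite exprS ler_wpM2l ?(ltW q0)// qm tE mono//.
have [|tm] := leP ((2^-1) ^+ m) (1 - normc w); first by move=> /mmin; rewrite ltnn.
by rewrite -[leLHS]invrK lef_pV2 ?posrE ?invr_gt0 ?exprn_gt0// -exprVn ltW.
Qed.

(** Both sides are invariant, so |z| < r may be assumed. Then S(z, 0) is bounded, S(0, w) is
    controlled by the radial growth, and 1 - |w| is at least a multiple of delta. *)
Lemma gap_sum_bound N (eps : R) : (2 <= N)%N -> 0 < eps -> exists2 K : R, 0 <= K &
  forall z w, normc z < 1 -> normc w < 1 ->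
    (gap_sum N z w <= (K * delta (z, w) `^ (- eps))%:E)%E.
Proof.
move=> N2 eps0.
have [K1 K10 H1] := gap_sum_growth N2 eps0.
have [Cq Cq0 Hq] := gap_sum_triangle N (ltr1n R 2).
have [r /andP[r0 r1] hr] := cocompact hcompact.
have r10 : 0 < 1 - r by rewrite subr_gt0.
pose c := (1 - r) ^+ 2 / 2.
have c0 : 0 < c by rewrite divr_gt0// exprn_gt0.
pose K2 := (1 / ((1 - r) * 1)) ^+ N * M.
have K20 : 0 <= K2.
  by rewrite mulr_ge0 ?M_ge0// exprn_ge0// divr_ge0// mulr1 ltW.
have neps : - eps < 0 by rewrite oppr_lt0.
exists ((2 * K2 + Cq * K1) * c `^ (- eps)).
  by rewrite mulr_ge0 ?powR_ge0// addr_ge0// mulr_ge0.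
move=> z w z1 w1.
have [g Gg hg] := hr (mkdisk z1).
rewrite -(mkdiskK z1) -(mkdiskK w1) -(gap_sum_inv N (mkdisk z1) (mkdisk w1) Gg).
rewrite -(delta_inv (mkdisk z1) (mkdisk w1) Gg).
have z'1 := disk_lt1 (g (mkdisk z1)); have w'1 := disk_lt1 (g (mkdisk w1)).
move: hg z'1 w'1; set z' := \val _; set w' := \val _ => hz z'1 w'1.
have dp := delta_gt0 z'1 w'1.
have dc0 : 0 < delta (z', w') * c by rewrite mulr_gt0.
have dcw : delta (z', w') * c <= 1 - normc w' by rewrite mulrA; exact: delta_upper hz r1 w'1.
have dc1 : delta (z', w') * c <= 1 by apply: (le_trans dcw); rewrite gerBl normcC_ge0.
have P1 : 1 <= (delta (z', w') * c) `^ (- eps).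
  by have := powR_anti neps dc0 dc1; rewrite powR1.
have n00 : normc (0 : C R) < 1 by rewrite normcC0.
apply: (le_trans (Hq z' 0 w')).
have S1 : (gap_sum N z' 0 <= K2%:E)%E.
  apply: (le_trans (gap_sum_local N2 z'1 n00)); rewrite lee_fin ler_wpM2r ?M_ge0//.
  have nz := normcC_ge0 z'.
  rewrite normcC0 subr0 sub0r normcN; apply: lerXn2r; rewrite ?nnegrE.
  - by rewrite divr_ge0// mulr1 subr_ge0 ltW.
  - by rewrite divr_ge0// mulr1 ltW.
  rewrite !mulr1; apply: ler_pM; rewrite ?invr_ge0 ?subr_ge0 ?(ltW z'1)//.
  by rewrite lef_pV2 ?posrE ?subr_gt0// lerD2l lerN2 ltW.
have S2 : (gap_sum N 0 w' <= (K1 * (delta (z', w') * c) `^ (- eps))%:E)%E.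
  apply: (le_trans (H1 _ w'1)); rewrite lee_fin ler_wpM2l//.
  exact: powR_anti.
apply: (@le_trans _ _ (2%:E * K2%:E + Cq%:E * (K1 * (delta (z', w') * c) `^ (- eps))%:E)%E).
  by apply: leeD; apply: lee_wpmul2l; rewrite ?lee_fin.
rewrite -!EFinM -EFinD lee_fin -[leRHS]mulrA -powRM ?(ltW c0) ?(ltW dp)// (mulrC c).
move: P1; set P := (_ `^ _) => P1.
rewrite -subr_ge0 [leRHS](_ : _ = 2 * K2 * (P - 1)); last by ring.
have P0 : 0 <= P - 1 by rewrite subr_ge0.
exact: mulr_ge0 (mulr_ge0 (ler0n R 2) K20) P0.
Qed.

(** * The series and its holomorphy *)

Definition poincare N z w : C R := csum (fun n => gap n z w ^+ N).

Lemma abs_sum_le_gap N z w K : (gap_sum N z w <= K%:E)%E -> abs_sum_le (fun n => gap n z w ^+ N) K.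
Proof.
rewrite /abs_sum_le; apply: le_trans; apply: lee_nneseries => n _; last by rewrite normcX.
by move=> _; rewrite lee_fin normcC_ge0.
Qed.

Lemma poincare_inv N g (x y : disk R) : aut_set G g ->
  poincare N (\val (g x)) (\val (g y)) = poincare N (\val x) (\val y).
Proof.
move=> Gg; have [s [bs hs]] := gam_perm Gg.
rewrite /poincare -[RHS](csum_perm _ bs); congr csum; apply/funext => n.
by rewrite !gap_gam hs.
Qed.

Lemma poincare_bound N (eps : R) : (2 <= N)%N -> 0 < eps -> exists2 K : R, 0 <= K &
  forall z w, normc z < 1 -> normc w < 1 -> normc (poincare N z w) <= K * delta (z, w) `^ (- eps).
Proof.
move=> N2 eps0.
have [K K0 H] := gap_sum_bound N2 eps0.
exists (2 * K); first by rewrite mulr_ge0.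
by move=> z w z1 w1; rewrite -mulrA; apply: csum_le; apply: abs_sum_le_gap; exact: H.
Qed.

(** The remainder is exactly - b^* h^2 / (den(z)^2 den(z + h)). *)
Lemma mob_taylor n z h : normc z < 1 -> normc h <= (1 - normc z) / 2 ->
  normc (mob (A n) (B n) (z + h) - mob (A n) (B n) z - (den (A n) (B n) z) ^- 2 * h)
    <= 2 / (1 - normc z) ^+ 3 * (normc (A n) ^+ 2)^-1 * normc h ^+ 2.
Proof.
move=> z1 hz; have [sab _] := gamAB n.
have d0 : 0 < 1 - normc z by rewrite subr_gt0.
have zh : normc (z + h) <= 1 - (1 - normc z) / 2.
  by apply: (le_trans (normc_triangle _ _)); lra.
have zh1 : normc (z + h) < 1 by lra.
have e1 := den_neq0 sab z1; have e2 := den_neq0 sab zh1.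
have -> : mob (A n) (B n) (z + h) - mob (A n) (B n) z - (den (A n) (B n) z) ^- 2 * h =
   - (B n)^* * h ^+ 2 / (den (A n) (B n) z ^+ 2 * den (A n) (B n) (z + h)).
  rewrite mob_sub// (_ : z + h - z = h); last by ring.
  have Ed : den (A n) (B n) (z + h) = den (A n) (B n) z + (B n)^* * h by rewrite /den; ring.
  move: e1 e2; rewrite Ed; set x := den _ _ z => e1 e2.
  by field; rewrite e1 e2.
have A0 : 0 < normc (A n) by rewrite (lt_le_trans ltr01)// (su11_ge1 sab).
rewrite normcM normcV [normc (_ * h ^+ 2)]normcM [normc (_ ^+ 2 * _)]normcM !normcX normcN normcCJ.
have l1 := den_lower sab z1; have l2 := den_lower sab zh1.
set X := normc (den _ _ z) in l1 *; set Y := normc (den _ _ _) in l2 *.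
have lY : normc (A n) * ((1 - normc z) / 2) <= Y.
  by apply: le_trans l2; rewrite ler_wpM2l ?(ltW A0)//; lra.
have X0 : 0 < X by apply: lt_le_trans l1; rewrite mulr_gt0.
have Y0 : 0 < Y by apply: lt_le_trans lY; rewrite mulr_gt0 ?divr_gt0.
have lX2 : (normc (A n) * (1 - normc z)) ^+ 2 <= X ^+ 2.
  by rewrite ler_pXn2r ?nnegrE ?(ltW X0) ?mulr_ge0 ?(ltW A0) ?(ltW d0).
have lXY : (normc (A n) * (1 - normc z)) ^+ 2 * (normc (A n) * ((1 - normc z) / 2)) <= X ^+ 2 * Y.
  by apply: ler_pM; rewrite ?sqr_ge0 ?mulr_ge0 ?divr_ge0 ?(ltW A0) ?(ltW d0).
have Z0 : 0 < (normc (A n) * (1 - normc z)) ^+ 2 * (normc (A n) * ((1 - normc z) / 2)).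
  by rewrite mulr_gt0 ?exprn_gt0 ?mulr_gt0 ?divr_gt0.
have BA := su11_le sab; have h0 := normcC_ge0 h.
apply: (@le_trans _ _ (normc (A n) * normc h ^+ 2 /
  ((normc (A n) * (1 - normc z)) ^+ 2 * (normc (A n) * ((1 - normc z) / 2))))).
  apply: ler_pM; rewrite ?invr_ge0 ?mulr_ge0 ?exprn_ge0 ?normcC_ge0 ?(ltW X0) ?(ltW Y0)//.
    by rewrite ler_wpM2r// sqr_ge0.
  by rewrite lef_pV2 ?posrE// mulr_gt0 ?exprn_gt0.
rewrite le_eqVlt; apply/orP; left; apply/eqP.
by field; rewrite !gt_eqF.
Qed.

(** It bounds the displacement, its slopes and its second-order remainder at (z, w), up to the
    factor |A_n|^-2. *)
Definition jet_const z w : R :=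
  2 / ((1 - normc z) * (1 - normc w)) + 2 / (1 - normc z) ^+ 3 + 2 / (1 - normc w) ^+ 3.

Definition jet_radius z w : R := Num.min (1 - normc z) (1 - normc w) / 2.

Lemma jet_radius_gt0 z w : normc z < 1 -> normc w < 1 -> 0 < jet_radius z w.
Proof. by move=> z1 w1; rewrite divr_gt0// lt_min !subr_gt0 z1. Qed.

Lemma jet_radius_le z w : [/\ jet_radius z w <= 2^-1, jet_radius z w <= (1 - normc z) / 2 &
    jet_radius z w <= (1 - normc w) / 2].
Proof.
have h : Num.min (1 - normc z) (1 - normc w) <= 1 - normc z by rewrite ge_min lexx.
have h' : Num.min (1 - normc z) (1 - normc w) <= 1 - normc w by rewrite ge_min lexx orbT.
have := normcC_ge0 z; rewrite /jet_radius => z0; split; lra.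
Qed.

Lemma jet_const_ge0 z w : normc z < 1 -> normc w < 1 -> 0 <= jet_const z w.
Proof.
move=> z1 w1; have d1 : 0 <= 1 - normc z by rewrite subr_ge0 ltW.
have d2 : 0 <= 1 - normc w by rewrite subr_ge0 ltW.
by rewrite /jet_const !addr_ge0// divr_ge0// ?mulr_ge0// exprn_ge0.
Qed.

Lemma jet_gap n z w : normc z < 1 -> normc w < 1 ->
  jet (jet_radius z w) z w (jet_const z w * (normc (A n) ^+ 2)^-1) (gap n)
    (- (den (A n) (B n) z) ^- 2) ((den (A n) (B n) w) ^- 2).
Proof.
move=> z1 w1; have [sab _] := gamAB n.
have [_ r1 r2] := jet_radius_le z w.
have dz : 0 < 1 - normc z by rewrite subr_gt0.
have dw : 0 < 1 - normc w by rewrite subr_gt0.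
have A0 : 0 < normc (A n) by rewrite (lt_le_trans ltr01)// (su11_ge1 sab).
have V0 : 0 <= (normc (A n) ^+ 2)^-1 by rewrite invr_ge0 sqr_ge0.
have p1 : 0 <= 2 / ((1 - normc z) * (1 - normc w)) by rewrite divr_ge0// mulr_ge0// ltW.
have p2 : 0 <= 2 / (1 - normc z) ^+ 3 by rewrite divr_ge0// exprn_ge0// ltW.
have p3 : 0 <= 2 / (1 - normc w) ^+ 3 by rewrite divr_ge0// exprn_ge0// ltW.
have der x : normc x < 1 -> normc ((den (A n) (B n) x) ^- 2) <=
  2 / (1 - normc x) ^+ 3 * (normc (A n) ^+ 2)^-1.
  move=> x1; have dx : 0 < 1 - normc x by rewrite subr_gt0.
  rewrite normcV normcX; have l := den_lower sab x1.
  apply: (@le_trans _ _ ((normc (A n) * (1 - normc x)) ^+ 2)^-1).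
    rewrite lef_pV2 ?posrE ?exprn_gt0 ?den_gt0 ?mulr_gt0//.
    by rewrite ler_pXn2r ?nnegrE ?normcC_ge0 ?mulr_ge0 ?(ltW A0) ?(ltW dx).
  rewrite exprMn invfM mulrC ler_wpM2r//.
  rewrite ler_pdivlMr ?exprn_gt0// exprS mulrCA mulVf ?mulr1; last first.
    by rewrite sqrf_eq0 gt_eqF.
  by have := normcC_ge0 x; lra.
split.
- apply: (le_trans (gap_le n z1 w1)); rewrite ler_wpM2r//.
  apply: (@le_trans _ _ (2 / ((1 - normc z) * (1 - normc w)))); last by rewrite /jet_const; lra.
  rewrite ler_wpM2r ?invr_ge0 ?mulr_ge0 ?(ltW dz) ?(ltW dw)//.
  by apply: (le_trans (normc_triangle _ _)); rewrite normcN; lra.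
- rewrite normcN; apply: (le_trans (der _ z1)); rewrite ler_wpM2r// /jet_const; lra.
- apply: (le_trans (der _ w1)); rewrite ler_wpM2r// /jet_const; lra.
move=> h k hr kr.
have t1 := mob_taylor n z1 (le_trans hr r1); have t2 := mob_taylor n w1 (le_trans kr r2).
have -> : gap n (z + h) (w + k) - gap n z w - - (den (A n) (B n) z) ^- 2 *
  h - (den (A n) (B n) w) ^- 2 * k =
  (mob (A n) (B n) (w + k) - mob (A n) (B n) w - (den (A n) (B n) w) ^- 2 * k) -
  (mob (A n) (B n) (z + h) - mob (A n) (B n) z - (den (A n) (B n) z) ^- 2 * h).
  by rewrite /gap; ring.
apply: (le_trans (normc_triangle _ _)); rewrite normcN.
have h0 := normcC_ge0 h; have k0 := normcC_ge0 k.
apply: (le_trans (lerD t2 t1)).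
have s1 : normc h ^+ 2 <= (normc h + normc k) ^+ 2 by rewrite lerXn2r ?nnegrE ?addr_ge0// lerDl.
have s2 : normc k ^+ 2 <= (normc h + normc k) ^+ 2 by rewrite lerXn2r ?nnegrE ?addr_ge0// lerDr.
have q1 := mulr_ge0 p2 V0; have q2 := mulr_ge0 p3 V0.
apply: (le_trans (lerD (ler_wpM2l q2 s2) (ler_wpM2l q1 s1))).
rewrite [leLHS](_ : _ = (2 / (1 - normc w) ^+ 3 + 2 / (1 - normc z) ^+ 3) *
  (normc (A n) ^+ 2)^-1 * (normc h + normc k) ^+ 2); last by ring.
rewrite ler_wpM2r ?sqr_ge0// ler_wpM2r// /jet_const; lra.
Qed.

(** The N-th power of the n-th displacement has a jet whose constant is of order |A_n|^(- 2 N),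
    which is summable. *)
Lemma jet_poincare N z w : (2 <= N)%N -> normc z < 1 -> normc w < 1 ->
  exists2 K, 0 <= K & exists al be, jet (jet_radius z w) z w K (poincare N) al be.
Proof.
move=> N2 z1 w1; case: N N2 => [//|N] N2.
have K0 := jet_const_ge0 z1 w1; have rho0 := jet_radius_gt0 z1 w1.
have [r2 r1 r1'] := jet_radius_le z w.
pose c := 6 ^+ N * jet_const z w ^+ N.+1.
have c0 : 0 <= c by rewrite mulr_ge0 ?exprn_ge0.
exists (2 * (c * M)).
  exact: mulr_ge0 (ler0n R 2) (mulr_ge0 c0 M_ge0).
apply: (jet_csum (a := fun n => c * (normc (A n) ^+ 4)^-1)).
- move=> n.
  have V0 : 0 <= (normc (A n) ^+ 2)^-1 by rewrite invr_ge0 sqr_ge0.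
  have [al [be J]] := jet_pow N (ltW rho0) r2 (mulr_ge0 K0 V0) (jet_gap n z1 w1).
  exists al, be; apply: jet_weaken J.
  rewrite exprMn mulrA ler_wpM2l//.
  have A1 := su11_ge1 (gamAB n).1.
  have A0 : 0 < normc (A n) by rewrite (lt_le_trans ltr01).
  rewrite exprVn -exprM lef_pV2 ?posrE ?exprn_gt0// ler_weXn2l//.
  by rewrite (leq_mul2l 2 2 N.+1).
- rewrite (eq_eseriesr (g := fun n => (c%:E * ((normc (A n) ^+ 4)^-1)%:E)%E)); last first.
    by move=> n _; rewrite -EFinM.
  rewrite nneseriesZl; last by move=> n _; rewrite lee_fin coeff_ge0.
  by rewrite [leRHS]EFinM; apply: lee_wpmul2l => //; rewrite lee_fin.
- by move=> n; rewrite mulr_ge0 ?coeff_ge0.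
- move=> h k hr kr.
  have zh1 : normc (z + h) < 1.
    by apply: (le_lt_trans (normc_triangle _ _)); have := le_trans hr r1; lra.
  have wk1 : normc (w + k) < 1.
    by apply: (le_lt_trans (normc_triangle _ _)); have := le_trans kr r1'; lra.
  eexists; apply: abs_sum_le_gap; exact: (gap_sum_local N2 zh1 wk1).
Qed.

(** * Nonvanishing of the series *)

(** At (0, t) the identity contributes t^N. Every other element moves 0 by at least e, so
    |A_n|^-2 = 1 - |gam_n 0|^2 <= 1 - e^2 and the displacement is at most kap t with kap < 1;
    the other terms add up to at most a constant times t^N kap^(N - 2). *)
Lemma nonvanishing : exists N (t : R), [/\ (2 <= N)%N, 0 < t, t < 1 & poincare N 0 t%:C%C != 0].
Proof.
have M0 := M_ge0.
have [e1 e10 he1] := separated_orbit hcover.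
pose e := Num.min e1 2^-1.
have e0 : 0 < e by rewrite lt_min e10 /= invr_gt0 ltr0n.
have ee1 : e <= e1 by rewrite ge_min lexx.
have e_1 : e <= 2^-1 by rewrite ge_min lexx orbT.
have [n0 hn0] := gam_surj (aut_set_id G).
pose o : disk R := mkdisk (normcC0_lt1 R).
have An n : n != n0 -> (normc (A n) ^+ 2)^-1 <= 1 - e ^+ 2.
  move=> nn0; have [sab mab] := gamAB n.
  have := one_sub_mob2 sab (normcC0_lt1 R).
  rewrite /den mulr0 add0r normcCJ normcC0 expr0n subr0 div1r => <-.
  rewrite lerD2l lerN2 lerXn2r ?nnegrE ?(ltW e0) ?normcC_ge0//.
  rewrite leNgt; apply/negP => lt; apply: (negP nn0); apply/eqP/gam_inj; rewrite hn0.
  apply: (he1 _ _ o (gam n o)) => //; first exact: aut_set_id.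
    by rewrite mkdiskK normcC0.
  by rewrite gam_mob mkdiskK (lt_le_trans lt).
(* t < e^2, so that (1 - e^2) / (1 - t) < 1 *)
pose t := e ^+ 2 / 2.
have e2 : e ^+ 2 <= 4^-1.
  have -> : 4^-1 = 2^-1 ^+ 2 :> R by field.
  by rewrite lerXn2r ?nnegrE ?(ltW e0).
have e20 : 0 < e ^+ 2 by rewrite exprn_gt0.
have t0 : 0 < t by rewrite divr_gt0.
have t1 : t < 1 by rewrite /t; lra.
pose kap := (1 - e ^+ 2) / (1 - t).
have kap0 : 0 <= kap by rewrite divr_ge0// ; [lra|rewrite subr_ge0 ltW].
have kap1 : kap < 1 by rewrite ltr_pdivrMr ?subr_gt0// /t; lra.
pose c := 2 * ((1 - t) ^- 2 * M).
have c0 : 0 <= c by rewrite mulr_ge0// mulr_ge0// invr_ge0 exprn_ge0// subr_ge0 ltW.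
have [k hk] : exists k, c * kap ^+ k < 1.
  have c1 : 0 < (c + 1)^-1 by rewrite invr_gt0 ltr_wpDl.
  have kn : `|kap| < 1 by rewrite ger0_norm.
  have := cvg_expr kn => /cvgrPdist_lt /(_ _ c1) [k _ hk].
  exists k; have := hk k (leqnn k); rewrite /= sub0r normrN ger0_norm ?exprn_ge0//.
  have q0 : 0 <= kap ^+ k by rewrite exprn_ge0.
  by rewrite -[X in _ < X -> _]div1r ltr_pdivlMr ?ltr_wpDl// mulrDr mulr1 mulrC; lra.
exists k.+2, t; split => //.
have nt : normc (t%:C%C : C R) = t by rewrite normc_real// ltW.
have tn1 : normc (t%:C%C : C R) < 1 by rewrite nt.
pose u n : C R := gap n 0 t%:C%C ^+ k.+2.
pose v n : C R := if n == n0 then 0 else u n.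
have u0 : u n0 = t%:C%C ^+ k.+2.
  rewrite /u; congr (_ ^+ _).
  have := gap_gam n0 o (mkdisk tn1); rewrite hn0 !mkdiskK => ->.
  by rewrite subr0.
have hv : abs_sum_le v (t ^+ k.+2 * (kap ^+ k * ((1 - t) ^- 2 * M))).
  have cc : 0 <= t ^+ k.+2 * (kap ^+ k * (1 - t) ^- 2).
    have i0 : 0 <= (1 - t) ^- 2 by rewrite invr_ge0 sqr_ge0.
    exact: mulr_ge0 (exprn_ge0 _ (ltW t0)) (mulr_ge0 (exprn_ge0 _ kap0) i0).
  rewrite /abs_sum_le !mulrA -(mulrA (t ^+ _)).
  apply: (@le_trans _ _ (\sum_(n <oo) ((t ^+ k.+2 * (kap ^+ k * (1 - t) ^- 2))%:E *
    ((normc (A n) ^+ 4)^-1)%:E))%E).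
    apply: lee_nneseries => n _; first by move=> _; rewrite lee_fin normcC_ge0.
    rewrite -EFinM lee_fin /v; case: ifPn => [_|nn0].
      by rewrite normcC0 mulr_ge0// coeff_ge0.
    rewrite normcX.
    have g := gap_le n (normcC0_lt1 R) tn1.
    rewrite subr0 normcC0 subr0 mul1r nt in g.
    set a := (normc (A n) ^+ 2)^-1 in g.
    have a0 : 0 <= a by rewrite invr_ge0 sqr_ge0.
    have ak : a / (1 - t) <= kap by rewrite ler_wpM2r ?An// invr_ge0 subr_ge0 ltW.
    have at0 : 0 <= a / (1 - t) by rewrite divr_ge0// subr_ge0 ltW.
    have -> : (normc (A n) ^+ 4)^-1 = a ^+ 2 by rewrite /a exprVn -exprM.
    apply: (@le_trans _ _ ((t / (1 - t) * a) ^+ k.+2)).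
      by rewrite lerXn2r ?nnegrE ?normcC_ge0// mulr_ge0// divr_ge0 ?(ltW t0)// subr_ge0 ltW.
    have -> : t / (1 - t) * a = t * (a / (1 - t)) by rewrite mulrAC mulrA.
    rewrite exprMn -[leRHS]mulrA ler_wpM2l ?exprn_ge0 ?(ltW t0)//.
    rewrite -addn2 exprD -[leRHS]mulrA; apply: ler_pM; rewrite ?exprn_ge0//.
      by rewrite lerXn2r ?nnegrE.
    by rewrite expr_div_n mulrC.
  rewrite nneseriesZl; last by move=> n _; rewrite lee_fin coeff_ge0.
  by rewrite [leRHS]EFinM; apply: lee_wpmul2l => //; rewrite lee_fin.
have E : poincare k.+2 0 t%:C%C = t%:C%C ^+ k.+2 + csum v.
  rewrite -u0 -(csum_single n0 (u n0)) -(csumD (abs_sum_le_single n0 (u n0)) hv) /poincare.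
  congr csum; apply/funext => n; rewrite /v /u; case: eqP => [->|_]; first by rewrite addr0.
  by rewrite add0r.
apply/negP => /eqP F0; have := csum_le hv.
have -> : csum v = - t%:C%C ^+ k.+2 by apply/eqP; rewrite -subr_eq0 opprK addrC -E F0.
rewrite normcN normcX nt => le.
have tp : 0 < t ^+ k.+2 by rewrite exprn_gt0.
have : t ^+ k.+2 * (c * kap ^+ k) < t ^+ k.+2 * 1 by rewrite ltr_pM2l.
rewrite mulr1 => /(le_lt_trans _); move=> /(_ (t ^+ k.+2)); rewrite ltxx.
have -> : t ^+ k.+2 * (c * kap ^+ k) =
  2 * (t ^+ k.+2 * (kap ^+ k * ((1 - t) ^- 2 * M))) by rewrite /c; ring.
by move=> H; have := H le.
Qed.

(** * Membership in the Bergman space *)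

(** The integral of a nonnegative function is the supremum of the integrals of the simple
    functions below it. *)
Lemma ge0_le_integral_nonmeas d (T : measurableType d) (mu : {measure set T -> \bar R})
    (D : set T) (f g : T -> \bar R) :
  (forall x, D x -> (0 <= f x)%E) -> (forall x, D x -> (f x <= g x)%E) ->
  (\int[mu]_(x in D) f x <= \int[mu]_(x in D) g x)%E.
Proof.
move=> f0 fg.
have g0 x : D x -> (0 <= g x)%E by move=> Dx; apply: le_trans (f0 _ Dx) (fg _ Dx).
rewrite !ge0_integralE//; apply: le_ereal_sup => _ [h hf <-]; exists h => // x.
apply: (le_trans (hf x)); rewrite !patchE; case: ifPn => // xD.
by apply: fg; rewrite inE in xD.
Qed.

(** The value at the chosen representative of the orbit; by invariance every choice gives the
    same one. *)
Definition descend N (q : Omega G) : C R := poincare N (\val (repr q).1) (\val (repr q).2).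

Lemma descendE N (x y : disk R) : descend N (Omega_proj G (x, y)) = poincare N (\val x) (\val y).
Proof.
rewrite /descend; set o := Omega_proj G (x, y).
have : Omega_proj G (repr o) = Omega_proj G (x, y) by rewrite /Omega_proj reprK.
move=> /Omega_projP[g Gg [-> ->]].
by rewrite poincare_inv.
Qed.

Lemma pullback_descend N m z w : normc z < 1 -> normc w < 1 ->
  pullback (fun o => descend N o ^+ m) (z, w) = poincare N z w ^+ m.
Proof.
move=> z1 w1; rewrite /pullback /=.
have hz : z \in @unit_disk R by apply/mem_set/unit_diskP.
have hw : w \in @unit_disk R by apply/mem_set/unit_diskP.
rewrite (insubT (fun c => c \in @unit_disk R) hz) (insubT (fun c => c \in @unit_disk R) hw).
by rewrite descendE.
Qed.

Lemma holomorphic_descend N m : (2 <= N)%N -> holomorphic (fun o => descend N o ^+ m.+1).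
Proof.
move=> N2 [z w] /= /unit_diskP z1 /unit_diskP w1.
have [K K0 [al [be J]]] := jet_poincare N2 z1 w1.
have rho0 := jet_radius_gt0 z1 w1; have [r2 r1 r1'] := jet_radius_le z w.
have [al' [be' J2]] := jet_pow m (ltW rho0) r2 K0 J.
have KK : 0 <= 6 ^+ m * K ^+ m.+1 by rewrite mulr_ge0 ?exprn_ge0.
pose f z w : C R := pullback (fun o => descend N o ^+ m.+1) (z, w).
have fE : (fun p : C R * C R => f p.1 p.2) = pullback (fun o => descend N o ^+ m.+1).
  by apply/funext => -[].
rewrite -fE; apply: (jet_differentiable rho0 KK (al := al') (be := be')).
case: J2 => h1 h2 h3 h4; split => //; first by rewrite /f pullback_descend.
move=> h k hr kr; rewrite /f !pullback_descend//; first exact: h4.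
  by apply: (le_lt_trans (normc_triangle _ _)); have := le_trans hr r1; lra.
by apply: (le_lt_trans (normc_triangle _ _)); have := le_trans kr r1'; lra.
Qed.

(** With b between -1 and min (alpha, 0), the growth bound is applied with 2 (m + 1) eps = alpha
    - b. *)
Lemma bergman_descend N m (alpha : R) : (2 <= N)%N -> -1 < alpha ->
  bergman_space alpha (fun o => descend N o ^+ m.+1).
Proof.
move=> N2 a1; split; first exact: holomorphic_descend.
pose b : R := (-1 + Num.min alpha 0) / 2.
have ma : Num.min alpha 0 <= alpha by rewrite ge_min lexx.
have m0 : Num.min alpha 0 <= 0 by rewrite ge_min lexx orbT.
have m1 : -1 < Num.min alpha 0 by rewrite lt_min a1 /=; lra.
have b1 : -1 < b by rewrite /b; lra.
have b0 : b < 0 by rewrite /b; lra.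
have ba : b < alpha by rewrite /b; lra.
pose eps := (alpha - b) / (2 * m.+1%:R).
have eps0 : 0 < eps by rewrite divr_gt0 ?subr_gt0 ?mulr_gt0.
have [K K0 hK] := poincare_bound N2 eps0.
have [V hV] := finite_volume b1 b0.
pose c := (K ^+ m.+1) ^+ 2.
have c0 : 0 <= c by rewrite sqr_ge0.
have point z w : normc z < 1 -> normc w < 1 ->
    normc (poincare N z w ^+ m.+1) ^+ 2 * delta (z, w) `^ alpha <= c * delta (z, w) `^ b.
  move=> z1 w1; have dp := delta_gt0 z1 w1.
  rewrite normcX.
  apply: (@le_trans _ _ (((K * delta (z, w) `^ (- eps)) ^+ m.+1) ^+ 2 * delta (z, w) `^ alpha)).
    rewrite ler_wpM2r ?powR_ge0//.
    have D0 : 0 <= K * delta (z, w) `^ (- eps) by rewrite mulr_ge0 ?powR_ge0.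
    by rewrite lerXn2r ?nnegrE ?exprn_ge0 ?normcC_ge0// lerXn2r ?nnegrE ?normcC_ge0// hK.
  rewrite exprMn exprMn -mulrA ler_wpM2l// -exprM.
  rewrite -powR_mulrn ?powR_ge0// -powRrM -powRD; last by apply/implyP => _; rewrite gt_eqF.
  rewrite le_eqVlt; apply/orP; left; apply/eqP; congr (_ `^ _).
  have mn : m.+1%:R != 0 :> R by rewrite pnatr_eq0.
  by rewrite natrM /eps; move: m.+1%:R mn => a an; field.
have I0 : (0 <= integral_Omega G (fun p => (normc (pullback (fun o => descend N o ^+ m.+1) p) ^+ 2 *
    delta p `^ alpha)%R))%E.
  apply: ereal_sup_ubound; exists set0.
    split; last by move=> x y; rewrite inE.
    by rewrite image_set0; exact: measurable0.
  by rewrite image_set0 lebesgue4_eq integral_set0.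
have I1 : (integral_Omega G (fun p => (normc (pullback (fun o => descend N o ^+ m.+1) p) ^+ 2 *
    delta p `^ alpha)%R) <= (c * V)%:E)%E.
  apply: ge_ereal_sup => _ [E hE <-].
  have := hV E hE; rewrite lebesgue4_eq => {}hV.
  have [mE _] := hE.
  apply: (@le_trans _ _ (\int[mu4]_(q in @real_coords R @` E) (c%:E *
    (volume_density b (of_real_coords q))%:E))%E).
    apply: ge0_le_integral_nonmeas => q.
      move=> _; rewrite lee_fin mulr_ge0//; first by rewrite mulr_ge0 ?sqr_ge0 ?powR_ge0.
      by rewrite divr_ge0// exprn_ge0 ?normcC_ge0.
    move=> [[x y] Exy <-]; rewrite -EFinM lee_fin.
    have -> : of_real_coords (real_coords (x, y)) = (\val x, \val y).
      by rewrite /of_real_coords /real_coords /=; case: (\val x) => ? ?; case: (\val y).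
    have x1 := disk_lt1 x; have y1 := disk_lt1 y.
    rewrite pullback_descend// /volume_density [leRHS]mulrA ler_wpM2r//; last exact: point.
    by rewrite divr_ge0// exprn_ge0 ?normcC_ge0.
  rewrite ge0_integralZl//; last 2 first.
  - by apply: measurable_funTS; apply/measurable_EFinP; exact: measurable_volume_density.
  - by move=> q _; rewrite lee_fin volume_density_ge0.
  by rewrite [leRHS]EFinM; apply: lee_wpmul2l => //; rewrite lee_fin.
rewrite /bergman_norm2; set I := integral_Omega _ _ in I0 I1 *.
have If : I \is a fin_num by rewrite ge0_fin_numE// (le_lt_trans I1)// ltry.
by rewrite -(fineK If) -EFinM ltry.
Qed.

End surface.

(** * Linear independence of the powers *)

Section conclusion.
Variable R : realType.

(** Along the segment the expansion gives a Lipschitz bound near each point. *)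
Lemma jet_continuous_norm (rho : R) (w : C R) K (f : C R -> C R ->
    C R) al be (t s : R) : 0 < rho -> 0 <= K ->
  w = (s * t)%:C%C -> jet rho 0 w K f al be ->
  {for s, continuous (fun x : R => normc (f 0 (x * t)%:C%C) : R)}.
Proof.
move=> rho0 K0 wE [_ _ bK H]; apply/cvgrPdist_lt => e e0.
pose c := 2 * K * `|t| + `|t| + 1.
have c0 : 0 < c by rewrite ltr_wpDl// addr_ge0// !mulr_ge0.
pose d := Num.min (Num.min rho 1) e / c.
have d0 : 0 < d by rewrite divr_gt0// !lt_min rho0 ltr01.
apply/nbhs_normP; exists d => // x; rewrite /ball_ /= => xd.
have mE : Num.min (Num.min rho 1) e <= e by rewrite ge_min lexx orbT.
have mr : Num.min (Num.min rho 1) e <= rho by rewrite !ge_min lexx.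
have m1 : Num.min (Num.min rho 1) e <= 1 by rewrite !ge_min lexx ?orbT.
have xc : `|s - x| * c < Num.min (Num.min rho 1) e by rewrite -ltr_pdivlMr.
pose k : C R := ((x - s) * t)%:C%C.
have kE : (x * t)%:C%C = w + k by rewrite wE /k -rmorphD; congr (_ %:C)%C; ring.
have nk : normc k = `|s - x| * `|t|.
  by rewrite /k /normc /= expr0n addr0 sqrtr_sqr normrM distrC.
have ns := normr_ge0 (s - x); have nt := normr_ge0 t.
have kc : normc k <= `|s - x| * c.
  rewrite nk ler_wpM2l// /c; have : 0 <= 2 * K * `|t| by rewrite !mulr_ge0.
  lra.
have kr : normc k <= rho by apply: (le_trans kc); apply: (le_trans (ltW xc)).
have k1 : normc k <= 1 by apply: (le_trans kc); apply: (le_trans (ltW xc)).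
have r0 : normc (0 : C R) <= rho by rewrite normcC0 ltW.
have := H 0 k r0 kr; rewrite addr0 mulr0 subr0 normcC0 add0r -kE => Hk.
have bound : normc (f 0 (x * t)%:C%C - f 0 w) <= 2 * K * normc k.
  rewrite -(subrK (be * k) (f 0 (x * t)%:C%C - f 0 w)).
  apply: (le_trans (normc_triangle _ _)).
  have h1 : normc (be * k) <= K * normc k by rewrite normcM ler_wpM2r ?normcC_ge0.
  have h2 : K * normc k ^+ 2 <= K * normc k by rewrite ler_wpM2l// expr2 ler_piMl ?normcC_ge0.
  lra.
rewrite -wE.
have tri a b : `|normc a - normc b| <= normc (b - a) :> R.
  rewrite ler_norml; apply/andP; split.
    rewrite lerNl opprB; have := normc_triangle (b - a) a; rewrite subrK; lra.
  have := normc_triangle (a - b) b; rewrite subrK -[normc (a - b)]normcN opprB; lra.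
apply: (le_lt_trans (tri _ _)); apply: (le_lt_trans bound).
apply: (@le_lt_trans _ _ (`|s - x| * c)); last exact: lt_le_trans xc mE.
rewrite nk /c; have : 0 <= `|s - x| * `|t| by rewrite mulr_ge0.
nra.
Qed.

(** Along the segment from 0 to t the modulus of g is continuous and goes from 0 to a positive
    number, so it takes all values in between. *)
Lemma infinitely_many_values (g : C R -> C R) (t : R) :
  (forall s, 0 <= s <= 1 -> {for s, continuous (fun x : R => normc (g (x * t)%:C%C) : R)}) ->
  g 0 = 0 -> g t%:C%C != 0 ->
  forall n, exists r : seq (C R), [/\ uniq r, size r = n &
    forall y, y \in r -> exists2 s, 0 <= s <= 1 & y = g (s * t)%:C%C].
Proof.
move=> cg g0 gt n.
pose phi (x : R) := normc (g (x * t)%:C%C).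
have c0 : 0 < phi 1 by rewrite /phi mul1r lt_def normc_eq0 gt normcC_ge0.
have phi0 : phi 0 = 0 by rewrite /phi mul0r g0 normcC0.
have H (i : nat) : exists s : R, (i < n)%N -> 0 <= s <= 1 /\ phi s = phi 1 * (i%:R / n%:R).
  have [i_n|_] := ltnP i n; last by exists 0.
  have n0 : 0 < n%:R :> R by rewrite ltr0n (leq_ltn_trans _ i_n).
  have [||s] := @IVT R phi 0 1 (phi 1 * (i%:R / n%:R)) ler01.
  - apply: continuous_in_subspaceT => x; rewrite inE/= in_itv/=; exact: cg.
  - rewrite phi0 (min_l (ltW c0)) (max_r (ltW c0)) mulr_ge0 ?divr_ge0 ?(ltW c0)//=.
    by rewrite ler_piMr ?(ltW c0)// ler_pdivrMr// mul1r ler_nat ltnW.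
  by rewrite in_itv/= => s01 E; exists s.
have [s hs] := choice H.
exists [seq g (s i * t)%:C%C | i <- iota 0 n]; split.
- rewrite map_inj_in_uniq ?iota_uniq// => i j; rewrite !mem_iota /= add0n => i_n j_n E.
  have [_ Ei] := hs i i_n; have [_ Ej] := hs j j_n.
  have n0 : n%:R != 0 :> R by rewrite pnatr_eq0; case: n i_n {H hs Ei Ej j_n}.
  have : phi (s i) = phi (s j) by rewrite /phi E.
  rewrite Ei Ej => /(mulfI (lt0r_neq0 c0)) /(mulIf (invr_neq0 n0)) /eqP.
  by rewrite eqr_nat => /eqP.
- by rewrite size_map size_iota.
- move=> y; set f := fun i => _; case/(@mapP nat (C R) f (iota 0 n) y) => i.
  rewrite mem_iota /= add0n => i_n ->.
  by exists (s i) => //; have [] := hs i i_n.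
Qed.

(** If n functions spanned the powers F, ..., F^(n + 1), then these n + 1 powers would be
    linearly dependent, and all values of F would be roots of one nonzero polynomial. *)
Lemma powers_independent (T : Type) (S : set (T -> C R)) (F : T -> C R) :
  (forall m, S (fun o => F o ^+ m.+1)) ->
  (forall n, exists r : seq (C R), [/\ uniq r, size r = n & forall y, y \in r ->
    exists o, y = F o]) ->
  infinite_dimensional (S : set (T -> C R : lmodType (C R))).
Proof.
move=> SF vals [n [v [Sv span]]].
have [cf hcf] := choice (fun k : 'I_n.+1 => span _ (SF k)).
pose Q : 'M[C R]_(n.+1, n) := \matrix_(k, i) cf k i.
have : (0 < \rank (kermx Q))%N.
  by rewrite mxrank_ker subn_gt0 (leq_ltn_trans (rank_leq_col _)).
rewrite lt0n mxrank_eq0 => /matrix0Pn[i0 [j0 hij]].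
pose x := row i0 (kermx Q).
have xQ : x *m Q = 0 by rewrite -row_mul mulmx_ker row0.
have xj : x 0 j0 != 0 by rewrite mxE.
pose P : {poly (C R)} := \sum_(k < n.+1) x 0 k *: 'X^(k.+1).
have Pcoef : P`_j0.+1 = x 0 j0.
  rewrite /P coef_sum (bigD1 j0)//= coefZ coefXn eqxx mulr1 big1 ?addr0// => k kj.
  by rewrite coefZ coefXn eqSS eq_sym (inj_eq val_inj) (negbTE kj) mulr0.
have P0 : P != 0 by apply: contra xj => /eqP P0; rewrite -Pcoef P0 coef0.
have root_F o : root P (F o).
  rewrite /root /P horner_sum; apply/eqP.
  transitivity (\sum_(i < n) (x *m Q) 0 i * v i o).
    under eq_bigr do rewrite hornerZ hornerXn.
    under [RHS]eq_bigr do rewrite mxE big_distrl.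
    rewrite exchange_big /=; apply: eq_bigr => k _.
    have -> : F o ^+ k.+1 = \sum_(i < n) cf k i * v i o.
      transitivity ((\sum_(i < n) cf k i *: v i) o).
        exact: (congr1 (fun f => f o) (hcf k)).
      by rewrite fct_sumE.
    by rewrite big_distrr /=; apply: eq_bigr => i _; rewrite [Q k i]mxE mulrA.
  by rewrite xQ big1// => i _; rewrite mxE mul0r.
have [r [ur sr hr]] := vals (size P).
have rr : all (root P) r by apply/allP => y /hr [q yE]; rewrite yE; exact: root_F.
by have := max_poly_roots P0 rr ur; rewrite sr ltnn.
Qed.

End conclusion.

Theorem corollary1 (R : realType) (G : aut_subgroup R) (g : nat)
  (hG : fuchsian G)
  (hcover : covering_map (Sigma_proj G))
  (hcompact : compact [set: Sigma G])
  (hgenus : Sigma_genus G g) (hg : (2 <= g)%N)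
  (alpha : R) (halpha : -1 < alpha) :
  infinite_dimensional (@bergman_space R G alpha).
Proof.
have [gam [A [B [gamG gam_surj gam_inj gamAB]]]] := enumeration hcover hcompact.
have [M hM] := packing hcover gamG gam_inj gamAB.
have [N [t [N2 t0 t1 Ft]]] := nonvanishing hcover gamG gam_surj gam_inj gamAB hM.
have n00 : normc (0 : C R) < 1 by rewrite normcC0.
apply: (powers_independent (F := descend A B N)).
  by move=> m; exact: (bergman_descend hcover hcompact gamG gam_surj gam_inj gamAB hM).
move=> n.
have nst s : 0 <= s <= 1 -> normc ((s * t)%:C%C : C R) < 1.
  move=> /andP[s0 s1]; rewrite normc_real ?mulr_ge0 ?(ltW t0)//.
  by apply: le_lt_trans t1; rewrite ler_piMl ?(ltW t0).
have [|||r [ur sr hr]] := @infinitely_many_values R (poincare A B N 0) t _ _ _ n.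
- move=> s s01.
  have [K K0 [al [be J]]] := jet_poincare gamAB hM N2 n00 (nst s s01).
  exact: (jet_continuous_norm (jet_radius_gt0 n00 (nst s s01)) K0 erefl J).
- rewrite /poincare -[RHS](csum_single 0%N 0); congr csum; apply/funext => k.
  by rewrite /gap subrr expr0n; case: N N2 {Ft} => // N _; case: ifP.
- exact: Ft.
exists r; split => // y /hr [s s01 yE]; rewrite yE.
exists (Omega_proj G (mkdisk n00, mkdisk (nst s s01))).
by rewrite (descendE gamG gam_surj gam_inj gamAB).
Qed.
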